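(* Let $\epsilon>0$ be a target accuracy (such that the double logarithm below is defined, i.e. $\epsilon<1/\sqrt8$), let $0<\eta<1$, and let $k$ be a positive integer with $$k\;\ge\;\frac{\log_2(1/\eta)}{\log_2(4/3)}+\log_2\log_2\!\left(\frac{1}{\sqrt8\,\epsilon}\right)+1 .$$ Let $F=(f\circ g)^{\circ k}$ be the random map on $SU(2)$ described in the context. Then every $U\in SU(2)$ is mapped by $F$ to within distance $\epsilon$ of $\mathbb 1$ with probability at least $1-\eta$: $$\Pr\big[\|F(U)-\mathbb 1\|\le\epsilon\big]\ \ge\ 1-\eta .$$ Expanding $F(U)$ gives a pulse sequence of the form $R_1UR_2\cdots R_nUR_{n+1}$ with unitary $R_i$ independent of $U$, which, by conjugating by $R_{n+1}^\dagger$, is changed into the form $R_1UR_2U\cdots R_nU$ (with a new $R_1$). The number $n$ of pulses equals the number of uses of $U$, namely $n=4^k$, and, with $k$ taken to be the right-hand side of the displayed lower bound rounded up to an integer, $$n=4^k\ \le\ \frac{16}{\eta^5}\,\log_2^2\!\left(\frac{1}{\sqrt8\,\epsilon}\right).$$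
   Context: $X,Y,Z$ are the $2\times2$ Pauli matrices, $\boldsymbol\sigma=(X,Y,Z)^T$, and $\mathbb 1$ is the $2\times 2$ identity. The norm is the rescaled Hilbert–Schmidt norm $\|A\|=\frac12\sqrt{\operatorname{Tr}(A^\dagger A)}$, and the distance of $W$ from $\mathbb 1$ is $\|W-\mathbb 1\|$. The map $f:SU(2)\to SU(2)$ is $f(U)=XUX\,YUY\,ZUZ\,U$ (product of matrices in this order). The random map $g$ is $g(U)=(\boldsymbol r\cdot\boldsymbol\sigma)\,U\,(\boldsymbol r\cdot\boldsymbol\sigma)^\dagger$, where each application of $g$ chooses a unit vector $\boldsymbol r\in\mathbb R^3$ uniformly at random according to the spherical measure on $S^2$ (independently for each application, and independently of $U$). $(f\circ g)^{\circ k}$ denotes the $k$-fold composition of $f\circ g$. Probabilities are over the draws of $\boldsymbol r$.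
   Formalization: The probability claim is proved with the added assumption k ≥ log2(1/η)/log2(4/3)+1, automatic for ε ≤ 1/(2√8); without it the claim is false for ε near 1/√8 (k=1, traceless U), where the double logarithm is negative. *)

(* Defs.v *)
From HB Require Import structures.
From mathcomp Require Import all_boot all_order all_algebra.
From mathcomp Require Import all_classical all_reals all_analysis.
From mathcomp Require Import spectral complex.

Set Implicit Arguments.
Unset Strict Implicit.
Unset Printing Implicit Defensive.

Import Order.TTheory GRing.Theory Num.Theory.
Import numFieldNormedType.Exports.

Local Open Scope classical_set_scope.
Local Open Scope sesquilinear_scope.
Local Open Scope complex_scope.
Local Open Scope ring_scope.

Section Defs.
Context {R : realType}.

Definition log2 (x : R) : R := ln x / ln 2.

Definition mx2 (a b c d : R[i]) : 'M[R[i]]_2 :=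
  \matrix_(i < 2, j < 2)
    if i == 0 then (if j == 0 then a else b) else (if j == 0 then c else d).

Definition pauliX : 'M[R[i]]_2 := mx2 0 1 1 0.
Definition pauliY : 'M[R[i]]_2 := mx2 0 (- 'i%C) 'i%C 0.
Definition pauliZ : 'M[R[i]]_2 := mx2 1 0 0 (- 1).

Definition inSU2 (U : 'M[R[i]]_2) : Prop := U \is unitarymx /\ \det U = 1.

(* Tr (A^dagger A) is a nonnegative real number, so nothing is lost by [Re]. *)
Definition hsnorm (A : 'M[R[i]]_2) : R :=
  2^-1 * Num.sqrt (complex.Re (\tr (A ^t* *m A))).

Definition dot_sigma (r : R * R * R) : 'M[R[i]]_2 :=
  r.1.1%:C *: pauliX + r.1.2%:C *: pauliY + r.2%:C *: pauliZ.

(* [fmap], [gmap] and [Fmap] are defined on all 2 x 2 matrices; they send SU(2)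
   to itself (for unit vectors r). *)
Definition fmap (U : 'M[R[i]]_2) : 'M[R[i]]_2 :=
  pauliX *m U *m pauliX *m pauliY *m U *m pauliY *m
  pauliZ *m U *m pauliZ *m U.

Definition gmap (r : R * R * R) (U : 'M[R[i]]_2) : 'M[R[i]]_2 :=
  dot_sigma r *m U *m (dot_sigma r) ^t*.

(* The k-fold composition of f o g in which the j-th application of g
   (j = 0 being the innermost one) draws the vector [r j]. *)
Definition Fmap (k : nat) (r : 'I_k -> R * R * R) (U : 'M[R[i]]_2) :
    'M[R[i]]_2 :=
  foldl (fun W j => fmap (gmap (r j) W)) U (enum 'I_k).

Definition unit_vector (r : R * R * R) : Prop :=
  r.1.1 ^+ 2 + r.1.2 ^+ 2 + r.2 ^+ 2 = 1.

Definition spherical_coord (theta phi : R) : R * R * R :=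
  (sin theta * cos phi, sin theta * sin phi, cos theta).

(* Normalised surface measure of S^2 (area element sin theta dtheta dphi, total
   area 4 pi), as a Borel probability on R^3 carried by S^2. *)
Definition sphere_measure (A : set (R * R * R)) : \bar R :=
  ((4 * pi)^-1%:E *
   \int[lebesgue_measure]_(theta in `[0%R, pi])
     \int[lebesgue_measure]_(phi in `[0%R, (2 * pi)%R])
       (\1_A (spherical_coord theta phi) * sin theta)%:E)%E.

(* The random vectors r_j are independent and uniformly distributed on S^2. *)
Definition iid_uniform_sphere (d : measure_display) (T : measurableType d)
    (P : probability T R) (k : nat) (r : 'I_k -> T -> R * R * R) : Prop :=
  [/\ forall j, measurable_fun setT (r j),
      forall j (A : set (R * R * R)), measurable A ->
        P (r j @^-1` A) = sphere_measure A
    & forall (J : {set 'I_k}) (A : 'I_k -> set (R * R * R)),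
        (forall j, measurable (A j)) ->
        P (\bigcap_(j in [set` J]) (r j @^-1` A j)) =
        (\prod_(j in J) P (r j @^-1` A j))%E].

(* V_1 U V_2 U ... V_n U, with the product taken from left to right. *)
Definition pulses (n : nat) (V : nat -> 'M[R[i]]_2) (U : 'M[R[i]]_2) :
    'M[R[i]]_2 :=
  \prod_(1 <= i < n.+1) (V i *m U).

(* The number of iterations of f o g that is asked for. *)
Definition iterations (eta eps : R) : R :=
  log2 (1 / eta) / log2 (4 / 3) + log2 (log2 (1 / (Num.sqrt 8 * eps))) + 1.

End Defs.

(* Main.v *)
Require Import Defs.
From HB Require Import structures.
From mathcomp Require Import all_boot all_order all_algebra.
From mathcomp Require Import all_classical all_reals all_analysis.
From mathcomp Require Import spectral complex.
From mathcomp Require Import measurable_realfun.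
From mathcomp Require Import ring lra.

(** Write U = a + i (b X + c Y + d Z) and let e = 1 - a be its infidelity, so that
    ||U - 1|| ^ 2 = e. Then f replaces e by 8 b ^ 2 d ^ 2, and g replaces the direction n of
    (b, c, d) by n' = 2 (r . n) r - n; together they give
    e' = 8 (e (2 - e)) ^ 2 (n'_x n'_z) ^ 2 <= 8 e ^ 2, so sqrt (8 e) is at worst squared.
    The vector n' is not uniform on the sphere, but on sets invariant under the antipodal map
    its law is at least 1 / sqrt 2 times the uniform one (rotate n to the pole and use
    sin t + cos t >= sqrt 2 sin 2t). This bounds below the probability that |n'_x n'_z| <= tau,
    and a potential of e that is constant on four ranges turns these bounds into a failure
    probability at most (3 / 4) ^ (N - 1) for reaching the basin of the deterministic quadratic
    convergence within N steps. *)

(** No single step fails with probability at most 3 / 4 from every start: for e near 1 the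
    probability certified here of reaching sqrt (8 e) <= 0.39 at once is only about 0.11. The rate 3
    / 4 emerges over several steps, because a step that misses may still move e to a lower range,
    and the potential credits this partial progress. It also depends on the number of steps left:
    squaring is free, so with more steps to go a larger threshold already counts as success. The cut
    0.145 lies just below the fixed point of e -> 2 (e (2 - e)) ^ 2, which bounds the next
    infidelity whatever r is; hence the set e <= 0.145 is never left. Antipodal symmetry of the test
    sets costs nothing, since only |n'_x n'_z| enters. *)

Set Implicit Arguments.
Unset Strict Implicit.
Unset Printing Implicit Defensive.

Import Order.TTheory GRing.Theory Num.Theory.
Import numFieldNormedType.Exports.

Local Open Scope classical_set_scope.
Local Open Scope sesquilinear_scope.
Local Open Scope complex_scope.
Local Open Scope ring_scope.

(** * Change of variables in Lebesgue integrals *)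

Section Density.
Local Open Scope ereal_scope.
Context d (T : measurableType d) (R : realType).
Variable mu : {measure set T -> \bar R}.
Variable h : T -> R.
Hypotheses (mh : measurable_fun setT h) (h0 : forall x, (0 <= h x)%R).

Let mhE : measurable_fun [set: T] (fun x => (h x)%:E : \bar R). Proof. exact/measurable_EFinP. Qed.

Let dens (A : set T) := \int[mu]_(x in A) (h x)%:E.

Let dens0 : dens set0 = 0. Proof. exact: integral_set0. Qed.

Let dens_ge0 A : 0 <= dens A.
Proof. by apply: integral_ge0 => x _; rewrite lee_fin. Qed.

Let dens_sigma_additive : semi_sigma_additive dens.
Proof.
move=> A mA tA mUA; rewrite /dens ge0_integral_bigcup//.
- by apply: is_cvg_ereal_nneg_natsum_cond => n _ _; exact: dens_ge0.
- exact: measurable_funTS.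
- by move=> x _; rewrite lee_fin.
Qed.

Let densm : {measure set T -> \bar R} :=
  HB.pack dens (isMeasure.Build _ _ _ dens dens0 dens_ge0 dens_sigma_additive).

Import HBNNSimple.

(** The change of variables below compares this measure with Lebesgue measure through uniqueness of
    measures, so it is needed as a bundled object. The integral formula passes from simple functions
    to [g] by monotone convergence. *)
Lemma density_measure : exists nu : {measure set T -> \bar R},
  (forall A, measurable A -> nu A = \int[mu]_(x in A) (h x)%:E) /\
  (forall g : T -> \bar R, measurable_fun setT g -> (forall x, 0 <= g x) ->
     \int[nu]_x g x = \int[mu]_x (g x * (h x)%:E)).
Proof.
exists densm; split=> // g mg g0.
pose g_ := nnsfun_approx measurableT mg.
have cg x : (g_ n x)%:E @[n --> \oo] --> g x by exact: cvg_nnsfun_approx.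
have ndg x : {homo (fun n => (g_ n x)%:E) : m n / (m <= n)%N >-> m <= n}.
  by move=> m n mn; rewrite lee_fin; exact/lefP/nd_nnsfun_approx.
transitivity (limn (fun n => \int[densm]_x (g_ n x)%:E)).
  rewrite -monotone_convergence//.
  - by apply: eq_integral => x _; apply/esym/cvg_lim.
  - by move=> n; exact/measurable_EFinP.
  - by move=> n x _; rewrite lee_fin.
transitivity (limn (fun n => \int[mu]_x ((g_ n x)%:E * (h x)%:E))); last first.
  rewrite -monotone_convergence//.
  - apply: eq_integral => x _; rewrite limeMr//.
      by congr (_ * _); exact/cvg_lim.
    by apply/cvg_ex; exists (g x).
  - by move=> n; apply: emeasurable_funM => //; exact/measurable_EFinP.
  - by move=> n x _; rewrite mule_ge0// lee_fin.
  - by move=> x _ m n mn; apply: lee_wpmul2r; [rewrite lee_fin|exact: ndg].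
congr (limn _); apply/funext => n.
transitivity (\int[densm]_x
   (\sum_(y \in range (g_ n)) (y * \1_(g_ n @^-1` [set y]) x)%:E)).
  by apply: eq_integral => t _; rewrite /= fimfunE -fsumEFin.
have mindic r : measurable_fun setT (fun x => (r * \1_(g_ n @^-1` [set r]) x)%:E).
  by apply: (measurable_comp measurableT) => //; exact: measurable_funM.
rewrite ge0_integral_fsum//; last by move=> m y Ey; exact: nnfun_muleindic_ge0.
transitivity (\int[mu]_x (\sum_(y \in range (g_ n))
    (y * \1_(g_ n @^-1` [set y]) x)%:E * (h x)%:E)); last first.
  under eq_integral => x _.
    rewrite -ge0_mule_fsuml => [|y]; last exact: nnfun_muleindic_ge0.
    rewrite fsumEFin // -(fimfunE _ x); over.
  by [].
rewrite ge0_integral_fsum//; last 2 first.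
  - by move=> y; apply: emeasurable_funM.
  - by move=> m y _; rewrite mule_ge0 ?lee_fin ?h0// -lee_fin nnfun_muleindic_ge0.
apply: eq_fsbigr => r rhn.
under eq_integral do rewrite EFinM.
rewrite integralZl_indic_nnsfun => //.
under [RHS]eq_integral do rewrite EFinM -muleA.
rewrite ge0_integralZl//.
- under [in RHS]eq_integral do rewrite muleC.
  rewrite [in RHS](eq_integral ((EFin \o h) \_ (g_ n @^-1` [set r]))); last first.
    by move=> x xE; rewrite epatch_indic.
  by rewrite -integral_mkcond integral_indic// setIT.
- by apply: emeasurable_funM => //; exact/measurable_EFinP.
- by move=> t _; rewrite mule_ge0 ?lee_fin.
- by move: rhn; rewrite inE => -[t _ <-]; rewrite lee_fin.
Qed.
End Density.

(** The bundled push-forward is hidden behind an existential, so that later proofs see only its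
    values and can feed it to uniqueness theorems. *)
Lemma pushforward_measureP d d' (T1 : measurableType d) (T2 : measurableType d')
    (R : realType) (m : {measure set T1 -> \bar R}) (f : T1 -> T2) :
  measurable_fun setT f ->
  exists m1 : {measure set T2 -> \bar R}, forall A, m1 A = m (f @^-1` A).
Proof.
move=> mf.
by exists (measure_function_pushforward__canonical__measure_function_Measure m mf).
Qed.

(** Clamping [c] and [e] to [A, B] yields the endpoints of the intersection of ]A, B] and ]c, e]
    when it is nonempty; [clamp_ge] covers the empty case. *)
Lemma clamp_lt (R : realType) (A B c e : R) : A <= B ->
  Num.max A c < Num.min B e ->
  Num.max A (Num.min c B) = Num.max A c /\ Num.max A (Num.min e B) = Num.min B e.
Proof.
move=> AB; rewrite gt_max !lt_min => /andP[/andP[_ Ae] /andP[cB ce]].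
by split; [rewrite (min_l (ltW cB))|rewrite minC max_r// le_min AB ltW].
Qed.

Lemma clamp_ge (R : realType) (A B c e : R) : A <= B ->
  Num.min B e <= Num.max A c ->
  Num.max A (Num.min e B) <= Num.max A (Num.min c B).
Proof.
move=> AB h; rewrite ge_max; apply/andP; split; first by rewrite le_max lexx.
have [cB|/ltW Bc] := leP c B; first by rewrite minC.
by rewrite le_max !ge_min lexx !orbT.
Qed.

Section Substitution.
Context {R : realType}.
Local Notation leb := (@lebesgue_measure R).
Variables (F f : R -> R) (a b : R).
Hypotheses (ab : a <= b) (dF : forall x : R, is_derive x 1 F (f x))
  (cf : continuous f)
  (incF : {in `[a, b] &, {homo F : x y / x < y}})
  (f0 : forall x, x \in `]a, b] -> 0 <= f x).

Let cF : continuous F.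
Proof.
move=> x; apply: differentiable_continuous; apply/derivable1_diffP.
by have [] := dF x.
Qed.

Let mf : measurable_fun setT f. Proof. exact: continuous_measurable_fun. Qed.

Lemma FTC2_is_derive (c d : R) : c <= d ->
  (\int[leb]_(x in `]c, d]) (f x)%:E = (F d - F c)%:E)%E.
Proof.
rewrite le_eqVlt => /predU1P[->|cd].
  by rewrite set_itvoc0 integral_set0 subrr.
rewrite (@integral_itv_obnd_cbnd _ _ (BRight d)); last first.
  by apply/measurable_EFinP; exact: measurable_funTS.
rewrite (@continuous_FTC2 _ f F)//.
- by apply: continuous_subspaceT => x; exact: cf.
- split.
  + by move=> x _; have [] := dF x.
  + by apply: cvg_at_right_filter; exact: cF.
  + by apply: cvg_at_left_filter; exact: cF.
- by move=> x _; rewrite derive1E; apply: derive_val.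
Qed.

(** Two such points [u], [v], for [c] and [e], make the part of the preimage of ]c, e] inside ]a, b]
    equal to ]u, v]. *)
Let clampF (c : R) : exists2 x, x \in `[a, b] & F x = Num.max (F a) (Num.min c (F b)).
Proof.
have Fab : F a <= F b.
  have [->//|anb] := eqVneq a b.
  by apply/ltW/incF; rewrite ?in_itv/= ?lexx ?ab// lt_neqAle anb.
have [] := @IVT _ F a b (Num.max (F a) (Num.min c (F b))) ab.
- by apply: continuous_subspaceT => x; exact: cF.
- rewrite (min_l Fab) (max_r Fab) le_max lexx/= ge_max Fab/=.
  by rewrite ge_min lexx orbT.
by move=> x ? ?; exists x.
Qed.

Let f0_ := fun x => if x \in `]a, b] then f x else 0.

Let f0_ge0 x : 0 <= f0_ x.
Proof. by rewrite /f0_; case: ifPn => // /f0. Qed.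

Let mf0 : measurable_fun setT f0_.
Proof.
rewrite (_ : f0_ = f \_ `]a, b]); last first.
  by apply/funext => x; rewrite /f0_ patchE; case: ifPn => xab; rewrite ?mem_setE ?xab// (negbTE xab).
apply/(measurable_restrictT _ _).1 => //.
exact: measurable_funTS.
Qed.

(** No continuity of [g] is assumed, since the integrands below carry indicators and inverse square
    roots. The image under [F] of the measure f dx on ]a, b] and Lebesgue measure on ]F a, F b]
    agree on half-open intervals by the fundamental theorem, hence everywhere. *)
Lemma ge0_integral_substitution (g : R -> \bar R) :
  measurable_fun setT g -> (forall x, 0 <= g x)%E ->
  (\int[leb]_(x in `]a, b]) (g (F x) * (f x)%:E) =
   \int[leb]_(y in `]F a, F b]) g y)%E.
Proof.
move=> mg g0.
have [nu [nuE nuI]] := density_measure leb mf0 f0_ge0.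

have mF : measurable_fun setT F by exact: continuous_measurable_fun.
have leFab : F a <= F b.
  have [->//|anb] := eqVneq a b.
  by apply/ltW/incF; rewrite ?in_itv/= ?lexx ?ab// lt_neqAle anb.
transitivity (\int[nu]_x g (F x))%E.
  rewrite nuI//; last exact: measurableT_comp.
  rewrite [LHS]integral_mkcond; apply: eq_integral => x _.
  rewrite patchE /f0_ mem_setE; case: ifPn => xab //.
  by rewrite mule0.
rewrite -[LHS](@ge0_integral_pushforward _ _ (measurableTypeR R)
  (measurableTypeR R) R F mF nu setT g measurableT mg (fun y _ => g0 y)).
have [lam [lamE lamI]] := @density_measure _ (measurableTypeR R) _ leb _
  (measurable_indic (measurable_itv `]F a, F b]))
  (fun x => ler0n _ _).
transitivity (\int[lam]_x g x)%E.
  apply: eq_measure_integral => A mA _.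
  have [m1 m1E] := @pushforward_measureP _ _ (measurableTypeR R)
    (measurableTypeR R) R nu F mF.
  have ocE (c e : R) : m1 `]c, e]%classic = lam `]c, e]%classic.
    rewrite m1E nuE ?lamE//; last by rewrite -[X in measurable X]setTI; exact: mF.
    have monoF : {in `[a, b] &, {mono F : x y / x < y}}.
      exact/leW_mono_in/le_mono_in.
    have [u uab Fu] := clampF c; have [v vab Fv] := clampF e.
    have uvE x : (x \in `]u, v]) = (x \in `]a, b]) && (c < F x <= e).
      rewrite !in_itv/=; move: (uab) (vab); rewrite !in_itv/= => /andP[au ub] /andP[av vb].
      have [/andP[ax xb]|] := boolP (a < x <= b); last first.
        apply: contraNF => /andP[ux xv].
        by rewrite (le_lt_trans au ux) (le_trans xv vb).
      have xab : x \in `[a, b] by rewrite in_itv/= (ltW ax) xb.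
      have aab : a \in `[a, b] by rewrite in_itv/= lexx ab.
      have bab : b \in `[a, b] by rewrite in_itv/= lexx ab.
      have Fax : F a < F x by rewrite monoF.
      have Fxb : F x <= F b by rewrite leNgt monoF// -leNgt.
      rewrite -(monoF u x)// [x <= v]leNgt -(monoF v x)// -leNgt Fu Fv.
      by rewrite gt_max Fax/= gt_min (ltNge (F b)) Fxb orbF le_max (leNgt _ (F a)) Fax/= le_min Fxb andbT.
    rewrite (_ : (\int[leb]_(x in F @^-1` `]c, e]) _ = \int[leb]_(x in `]u, v]) (f x)%:E)%E); last first.
      rewrite [LHS]integral_mkcond [RHS]integral_mkcond; apply: eq_integral => x _.
      rewrite !patchE /f0_.
      have -> : (x \in [set` `]u, v]]) = (x \in `]u, v]) by apply/idP/idP => [/set_mem|h]//; exact/mem_set.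
      rewrite uvE.
      have -> : (x \in F @^-1` `]c, e]) = (c < F x <= e).
        by apply/idP/idP => [/set_mem/=|h]; [|apply/mem_set => /=]; rewrite in_itv.
      by case: (x \in `]a, b]); case: (c < F x <= e).
    rewrite integral_indic//= (_ : `]F a, F b] `&` `]c, e] = `]Num.max (F a) c, Num.min (F b) e])%classic; last first.
      by apply/seteqP; split=> x /=; rewrite !in_itv/= gt_max le_min;
        [move=> [/andP[-> ->] /andP[-> ->]]|move=> /andP[/andP[-> ->] /andP[-> ->]]].
    rewrite lebesgue_measure_itv/= lte_fin -EFinB.
    have [uv|vu] := leP u v.
      rewrite FTC2_is_derive// Fu Fv.
      have : F u <= F v by rewrite leNgt monoF// -leNgt.
      rewrite Fu Fv => {}uv.
      case: ifPn => [|pq].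
        by move=> /(clamp_lt leFab)[-> ->].
      congr EFin; apply/eqP; rewrite subr_eq0 eq_le uv andbT.
      by rewrite (clamp_ge leFab)// leNgt.
    have : F v < F u by rewrite monoF.
    rewrite set_itv_ge ?integral_set0; last by rewrite bnd_simp -leNgt ltW.
    rewrite Fu Fv => h; rewrite ifF//.
    apply/negbTE; rewrite -leNgt.
    rewrite leNgt; apply: contraTN h => pq.
    by have [-> ->] := clamp_lt leFab pq; rewrite -leNgt ltW.
  transitivity (m1 A); first by rewrite m1E.
  apply: (@measure_unique _ _ (measurableTypeR R) (@ocitv R)
    (fun n => `]- n%:R, n%:R]%classic) _ _ _ _ m1 lam) => //.
  - exact: ocitvI.
  - by move=> n; exists (- n%:R, n%:R).
  - rewrite -subTset => x _ /=; exists (Num.truncn `|x|).+1 => //=.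
    have := truncnS_gt `|x|; rewrite in_itv/= ltr_norml => /andP[-> /ltW->//].
  - by move=> _ [[c e] _ <-].
  - move=> n; rewrite ocE lamE//.
    rewrite integral_indic// (le_lt_trans (measureIl _ _ _))//.
    by rewrite /= lebesgue_measure_itv/=; case: ifPn; rewrite ltry.
rewrite lamI// [RHS]integral_mkcond; apply: eq_integral => x _.
rewrite patchE indicE; case: ifPn => _; first by rewrite mule1.
by rewrite mule0.
Qed.

End Substitution.

(** * Rotation invariance of the uniform measure *)

Section SphereIntegral.
Context {R : realType}.
Local Notation leb := (@lebesgue_measure R).
Implicit Types (f : R * R * R -> \bar R).

(** Unnormalised, with total mass 4 pi; the half-open intervals split into disjoint pieces and fit
    [ge0_integral_substitution]. *)
Definition sphere_int f : \bar R :=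
  (\int[leb]_(t in `]0%R, pi]) \int[leb]_(p in `]0%R, (2 * pi)%R])
     (f (spherical_coord t p) * (sin t)%:E))%E.

Lemma measurable_sin : measurable_fun setT (@sin R).
Proof. by apply: continuous_measurable_fun; exact: continuous_sin. Qed.

Lemma measurable_cos : measurable_fun setT (@cos R).
Proof. by apply: continuous_measurable_fun; exact: continuous_cos. Qed.

Lemma measurable_sqrt : measurable_fun setT (@Num.sqrt R).
Proof. by apply: continuous_measurable_fun; exact: sqrt_continuous. Qed.

Lemma measurable_sqrtV : measurable_fun setT (fun x : R => (Num.sqrt x)^-1).
Proof.
rewrite (_ : (fun x => _) = (@powR R ^~ (-1)) \o Num.sqrt).
  by apply: measurableT_comp; [exact: measurable_powR|exact: measurable_sqrt].
by apply/funext => x /=; rewrite powR_inv1// sqrtr_ge0.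
Qed.

Lemma measurable_spherical_coord :
  measurable_fun setT (fun tp : R * R => spherical_coord tp.1 tp.2).
Proof.
have ms1 : measurable_fun setT (fun tp : R * R => sin tp.1) by exact: (measurableT_comp measurable_sin).
have mc1 : measurable_fun setT (fun tp : R * R => cos tp.1) by exact: (measurableT_comp measurable_cos).
have ms2 : measurable_fun setT (fun tp : R * R => sin tp.2) by exact: (measurableT_comp measurable_sin).
have mc2 : measurable_fun setT (fun tp : R * R => cos tp.2) by exact: (measurableT_comp measurable_cos).
apply: measurable_fun_pair => //; apply: measurable_fun_pair => //; exact: measurable_funM.
Qed.

(** Substitution x = - s cos p, the sign making it increasing on [0, pi]; here dx = s sin p dp and s
    sin p = sqrt (s ^ 2 - x ^ 2). *)
Lemma half_circle_int (s : R) (h : R -> \bar R) : 0 < s ->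
  measurable_fun setT h -> (forall x, 0 <= h x)%E ->
  (\int[leb]_(p in `]0%R, pi]) h (- s * cos p)%R =
   \int[leb]_x (h x * ((Num.sqrt (s ^+ 2 - x ^+ 2))^-1)%:E))%E.
Proof.
move=> s0 mh h0.
pose g x := (h x * ((Num.sqrt (s ^+ 2 - x ^+ 2))^-1)%:E)%E.
have mg : measurable_fun setT g.
  apply: emeasurable_funM => //; apply/measurable_EFinP.
  apply: (measurableT_comp measurable_sqrtV).
  by apply: measurable_funB => //; exact: measurable_funX.
have g0 x : (0 <= g x)%E by rewrite mule_ge0// lee_fin invr_ge0 sqrtr_ge0.
have mhc : measurable_fun setT (fun p => h (- s * cos p)).
  by apply: measurableT_comp => //; apply: measurable_funM => //; exact: measurable_cos.
transitivity (\int[leb]_(p in `]0%R, pi]) (g (- s * cos p)%R * (s * sin p)%:E))%E.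
  (* The Jacobian vanishes at the endpoints, so it is cancelled on the open interval only. *)
  rewrite [LHS]integral_itv_bndoo; last exact: measurable_funTS.
  rewrite [RHS]integral_itv_bndoo; last first.
    apply: measurable_funTS; apply: emeasurable_funM.
      by apply: measurableT_comp => //; apply: measurable_funM => //; exact: measurable_cos.
    by apply/measurable_EFinP; apply: measurable_funM => //; exact: measurable_sin.
  apply: eq_integral => p; rewrite inE/= in_itv/= => p0.
  have sp : 0 < sin p by exact: sin_gt0_pi.
  rewrite /g.
  have -> : s ^+ 2 - (- s * cos p) ^+ 2 = (s * sin p) ^+ 2.
    by rewrite !exprMn sqrrN sin2cos2; ring.
  by rewrite sqrtr_sqr gtr0_norm ?mulr_gt0// -muleA -EFinM mulVf ?mule1// gt_eqF// mulr_gt0.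
have dF (x : R) : is_derive x 1 (fun p : R => - s * cos p) (s * sin x).
  by apply: is_derive_eq; rewrite /GRing.scale/=; ring.
have cF : continuous (fun p : R => s * sin p).
  by move=> x; apply: cvgM; [exact: cvg_cst|exact: continuous_sin].
have incF : {in `[0, pi] &, {homo (fun p : R => - s * cos p) : x y / x < y}}.
  by move=> x y x0 y0 xy; rewrite !mulNr ltrN2 ltr_pM2l// ltr_cos.
have f0 p : p \in `]0, pi] -> 0 <= s * sin p.
  rewrite in_itv/= => /andP[p0 pp].
  by rewrite mulr_ge0 ?(ltW s0)// sin_ge0_pi// (ltW p0).
rewrite (ge0_integral_substitution (pi_ge0 R) dF cF incF f0 mg g0).
rewrite cos0 cospi mulr1 mulrN1 opprK [RHS](_ : _ = \int[leb]_x g x)%E//.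
rewrite integral_mkcond; apply: eq_integral => x _; rewrite patchE.
case: ifPn => // xs; rewrite /g.
(* Outside ]- s, s] the root is 0 and so is its inverse, by convention; this is why the integral may
   run over the whole line. *)
rewrite ler0_sqrtr ?invr0 ?mule0//.
have {xs} : (x <= - s) || (s < x).
  move: xs; rewrite notin_setE/= in_itv/= => /negP.
  by rewrite negb_and -leNgt -ltNge.
by case/orP => xs; nra.
Qed.

Lemma integral_translate (c a b : R) (h : R -> \bar R) :
  measurable_fun setT h -> (forall x, 0 <= h x)%E -> a <= b ->
  (\int[leb]_(p in `]a, b]) h (p + c)%R = \int[leb]_(p in `](a + c)%R, (b + c)%R]) h p)%E.
Proof.
move=> mh h0 ab.
have dF (x : R) : is_derive x 1 (fun p : R => p + c) 1.
  by apply: is_derive_eq; rewrite addr0.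
have cF : continuous (cst 1 : R -> R) by move=> x; exact: cst_continuous.
have incF : {in `[a, b] &, {homo (fun p : R => p + c) : x y / x < y}}.
  by move=> x y _ _; rewrite ltrD2r.
rewrite -(ge0_integral_substitution ab dF cF incF (fun _ _ => ler01) mh h0).
by apply: eq_integral => x _; rewrite mule1.
Qed.

Lemma integralN (h : R -> \bar R) :
  measurable_fun setT h -> (forall x, 0 <= h x)%E ->
  (\int[leb]_x h (- x)%R = \int[leb]_x h x)%E.
Proof.
move=> mh h0.
have mN : measurable_fun [set: measurableTypeR R] (-%R : measurableTypeR R -> measurableTypeR R).
  exact: measurable_funN.
rewrite -[LHS](@ge0_integral_pushforward _ _ (measurableTypeR R)
  (measurableTypeR R) R -%R mN leb setT h measurableT mh (fun y _ => h0 y)).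
by apply: eq_measure_integral => //= A mA _; exact: lebesgue_measureN.
Qed.

End SphereIntegral.

(** * The sphere in Cartesian coordinates and the exchange of two axes *)

Section SphereRotation.
Context {R : realType}.
Local Notation leb := (@lebesgue_measure R).
Implicit Types (f : R * R * R -> \bar R).

Lemma measurable_int_param (D : set R) (F : R * R -> \bar R) : measurable D ->
  measurable_fun setT F -> (forall z, 0 <= F z)%E ->
  measurable_fun setT (fun w => \int[leb]_(p in D) F (w, p))%E.
Proof.
move=> mD mF F0.
pose G (z : R * R) := (F z * (\1_D z.2)%:E)%E.
have mG : measurable_fun setT G.
  apply: emeasurable_funM => //; apply/measurable_EFinP.
  by apply: measurableT_comp.
have G0 z : (0 <= G z)%E by rewrite mule_ge0// lee_fin.
rewrite (_ : (fun w => _) = fubini_F leb G).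
  exact: (@measurable_fun_fubini_tonelli_F _ _ (measurableTypeR R) (measurableTypeR R) R leb G mG G0).
apply/funext => w; rewrite /fubini_F [LHS]integral_mkcond; apply: eq_integral => p _.
by rewrite patchE /G/= indicE; case: ifPn => _; rewrite ?mule1 ?mule0.
Qed.

Definition disk_height (z : R * R) := Num.sqrt (1 - z.1 ^+ 2 - z.2 ^+ 2).

(** The sphere projected along the y axis: over a point (z, x) of the unit disk lie the two points y
    = +- [disk_height], and the area element is dz dx / [disk_height]. Outside the disk the value is
    0 by the convention on inverses. *)
Definition disk_integrand f (z : R * R) : \bar R :=
  ((f (z.2, disk_height z, z.1) + f (z.2, - disk_height z, z.1)%R) *
   ((disk_height z)^-1)%:E)%E.

Lemma measurable_disk_height : measurable_fun setT disk_height.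
Proof.
apply: (measurableT_comp measurable_sqrt); apply: measurable_funB.
  by apply: measurable_funB => //; exact: measurable_funX.
exact: measurable_funX.
Qed.

Lemma measurable_disk_integrand f : measurable_fun setT f ->
  measurable_fun setT (disk_integrand f).
Proof.
move=> mf; have mh := measurable_disk_height.
apply: emeasurable_funM; last first.
  apply/measurable_EFinP; apply: (measurableT_comp measurable_sqrtV).
  apply: measurable_funB.
    by apply: measurable_funB => //; exact: measurable_funX.
  exact: measurable_funX.
apply: emeasurable_funD; apply: (measurableT_comp mf);
  apply: measurable_fun_pair => //; apply: measurable_fun_pair => //.
exact: measurable_funN.
Qed.

Lemma disk_integrand_ge0 f z : (forall v, 0 <= f v)%E -> (0 <= disk_integrand f z)%E.
Proof.
by move=> f0; rewrite mule_ge0 ?adde_ge0// lee_fin invr_ge0 sqrtr_ge0.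
Qed.

(** The half circles with y >= 0 and y <= 0 are parametrised by x separately; a shift by pi maps the
    first onto the second. *)
Lemma circle_int f (s z : R) : 0 < s -> measurable_fun setT f -> (forall v, 0 <= f v)%E ->
  (\int[leb]_(p in `]0%R, (2 * pi)%R]) f (s * cos p, s * sin p, z)%R =
   \int[leb]_x ((f (x, Num.sqrt (s ^+ 2 - x ^+ 2), z)%R +
                 f (x, - Num.sqrt (s ^+ 2 - x ^+ 2), z)%R) *
                ((Num.sqrt (s ^+ 2 - x ^+ 2))^-1)%:E))%E.
Proof.
move=> s0 mf f0.
pose y x := Num.sqrt (s ^+ 2 - x ^+ 2).
have my : measurable_fun setT y.
  apply: (measurableT_comp measurable_sqrt); apply: measurable_funB => //.
have mF (a b : R -> R) : measurable_fun setT a -> measurable_fun setT b ->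
    measurable_fun setT (fun x => f (a x, b x, z)).
  move=> ma mb; apply: (measurableT_comp mf).
  by apply: measurable_fun_pair => //; apply: measurable_fun_pair.
have mcos (c : R) : measurable_fun setT (fun p : R => c * cos p).
  by apply: measurable_funM => //; exact: measurable_cos.
have msin (c : R) : measurable_fun setT (fun p : R => c * sin p).
  by apply: measurable_funM => //; exact: measurable_sin.
have pi0 : 0 <= pi :> R := pi_ge0 R.
have -> : [set` `]0, 2 * pi]] = [set` `]0, pi]] `|` [set` `]pi, 2 * pi]] :> set R.
  apply/seteqP; split=> x /=; rewrite !in_itv/=.
    by move=> /andP[x0 x2]; have [xp|px] := leP x pi; [left|right]; rewrite ?x0 ?x2.
  by case=> /andP[h1 h2]; apply/andP; split=> //; lra.
have dis : [disjoint [set` `]0, pi]] & [set` `]pi, 2 * pi]] : set R].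
  rewrite disj_set2E; apply/eqP/seteqP; split=> x //=; rewrite !in_itv/=.
  by move=> [/andP[_ h1] /andP[h2 _]]; move: h1; rewrite leNgt h2.
rewrite ge0_integral_setU//; last by apply: measurable_funTS; exact: mF.
have yE p : p \in `]0, pi] -> y (- s * cos p) = s * sin p.
  rewrite in_itv/= => /andP[p0 pp].
  have -> : y (- s * cos p) = Num.sqrt ((s * sin p) ^+ 2).
    by rewrite /y !exprMn sqrrN sin2cos2; congr Num.sqrt; ring.
  rewrite sqrtr_sqr ger0_norm// mulr_ge0 ?(ltW s0)//.
  by rewrite sin_ge0_pi// (ltW p0).
have H1 : (\int[leb]_(p in `]0%R, pi]) f (s * cos p, s * sin p, z)%R =
    \int[leb]_x (f (x, y x, z) * ((y x)^-1)%:E))%E.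
  (* [half_circle_int] lets x increase while s cos p decreases, hence the reflected integrand,
     undone by [integralN]. *)
  pose h x := f (- x, y x, z).
  transitivity (\int[leb]_(p in `]0%R, pi]) h (- s * cos p)%R)%E.
    apply: eq_integral => p; rewrite inE/= => pp.
    by rewrite /h yE// mulNr opprK.
  have mh : measurable_fun setT h by apply: mF => //; exact: measurable_funN.
  rewrite (half_circle_int s0 mh (fun x => f0 _)) -[LHS]integralN.
  - by apply: eq_integral => x _; rewrite /h opprK /y sqrrN.
  - apply: emeasurable_funM => //; apply/measurable_EFinP.
    apply: (measurableT_comp measurable_sqrtV).
    by apply: measurable_funB => //; exact: measurable_funX.
  - by move=> x; apply: mule_ge0; [exact: f0|rewrite lee_fin invr_ge0 sqrtr_ge0].
have H2 : (\int[leb]_(p in `]pi, (2 * pi)%R]) f (s * cos p, s * sin p, z)%R =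
    \int[leb]_x (f (x, - y x, z)%R * ((y x)^-1)%:E))%E.
  rewrite (_ : [set` `]pi, 2 * pi]] = [set` `](0 + pi), (pi + pi)]] :> set R); last first.
    by rewrite add0r mulr_natl mulr2n.
  rewrite -integral_translate//; last exact: mF.
  pose h x := f (x, - y x, z).
  transitivity (\int[leb]_(p in `]0%R, pi]) h (- s * cos p)%R)%E.
    apply: eq_integral => p; rewrite inE/= => pp.
    by rewrite /h yE// cosDpi sinDpi !mulrN mulNr.
  have mh : measurable_fun setT h by apply: mF => //; exact: measurable_funN.
  by rewrite (half_circle_int s0 mh (fun x => f0 _)).
have mK (a : R -> R) : measurable_fun setT a ->
    measurable_fun setT (fun x => f (x, a x, z) * ((y x)^-1)%:E)%E.
  move=> ma; apply: emeasurable_funM; first exact: mF.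
  apply/measurable_EFinP; apply: (measurableT_comp measurable_sqrtV).
  by apply: measurable_funB => //; exact: measurable_funX.
have K0 (a : R -> R) x : (0 <= f (x, a x, z) * ((y x)^-1)%:E)%E.
  by apply: mule_ge0; [exact: f0|rewrite lee_fin invr_ge0 sqrtr_ge0].
have my' : measurable_fun setT (fun x => - y x) by exact: measurable_funN.
rewrite H1 H2 -[LHS](ge0_integralD leb measurableT (fun x _ => K0 y x) (mK y my)
  (fun x _ => K0 (fun x => - y x) x) (mK _ my')).
by apply: eq_integral => x _; rewrite -ge0_muleDl.
Qed.

(** In the variable w = - cos t the weight sin t cancels the inverse root of [half_circle_int], so
    the height is uniformly distributed, and [circle_int] treats each horizontal circle. *)
Lemma sphere_int_disk f : measurable_fun setT f -> (forall v, 0 <= f v)%E ->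
  sphere_int f = (\int[leb]_w \int[leb]_x disk_integrand f (w, x))%E.
Proof.
move=> mf f0.
pose s w : R := Num.sqrt (1 - w ^+ 2).
pose H w : \bar R := (\int[leb]_(p in `]0%R, (2 * pi)%R])
  f (s w * cos p, s w * sin p, - w)%R)%E.
have ms : measurable_fun setT s.
  apply: (measurableT_comp measurable_sqrt).
  by apply: measurable_funB => //; exact: measurable_funX.
have mH : measurable_fun setT H.
  apply: (@measurable_int_param [set` `]0, 2 * pi]]
    (fun z => f (s z.1 * cos z.2, s z.1 * sin z.2, - z.1))) => //.
  have ms1 : measurable_fun setT (fun z : R * R => s z.1) by exact: measurableT_comp.
  apply: (measurableT_comp mf); apply: measurable_fun_pair; last first.
    by apply: measurable_funN.
  apply: measurable_fun_pair; apply: measurable_funM => //.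
    exact: (measurableT_comp measurable_cos).
  exact: (measurableT_comp measurable_sin).
have H0 w : (0 <= H w)%E by exact: integral_ge0.
transitivity (\int[leb]_(t in `]0%R, pi]) ((H (-1 * cos t)%R * (s (-1 * cos t)%R)%:E)))%E.
  apply: eq_integral => t; rewrite inE/= in_itv/= => /andP[t0 tp].
  have st : s (-1 * cos t) = sin t.
    rewrite /s mulN1r sqrrN -sin2cos2 sqrtr_sqr ger0_norm// sin_ge0_pi//.
    by rewrite (ltW t0).
  rewrite ge0_integralZr//.
  - by rewrite st; congr (_ * _)%E; apply: eq_integral => p _; rewrite st mulN1r opprK.
  - apply: measurable_funTS; apply: (measurableT_comp mf).
    apply: measurable_fun_pair => //; apply: measurable_fun_pair; apply: measurable_funM => //.
      exact: measurable_cos.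
    exact: measurable_sin.
  - by rewrite lee_fin sin_ge0_pi// (ltW t0).
have mHs : measurable_fun setT (fun w => H w * (s w)%:E)%E.
  by apply: emeasurable_funM => //; exact/measurable_EFinP.
rewrite (half_circle_int ltr01 mHs); last first.
  by move=> w; apply: mule_ge0; [exact: H0|rewrite lee_fin sqrtr_ge0].
rewrite -[LHS]integralN.
- apply: eq_integral => w _.
  rewrite /disk_integrand /disk_height/= expr1n sqrrN.
  have [w1|w1] := leP (1 - w ^+ 2) 0.
    rewrite ler0_sqrtr// invr0 mule0; apply/esym/integral0_eq => x _.
    rewrite (ler0_sqrtr (a := 1 - w ^+ 2 - x ^+ 2)) ?invr0 ?mule0//.
    by rewrite (le_trans _ w1)// lerBlDr lerDl sqr_ge0.
  have s0 : 0 < s w by rewrite sqrtr_gt0.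
  rewrite -muleA -EFinM /s sqrrN mulfV ?mule1 ?gt_eqF//.
  rewrite /H opprK /s sqrrN (circle_int w s0 mf f0).
  by rewrite sqr_sqrtr// ltW.
- apply: emeasurable_funM; first exact: mHs.
  apply/measurable_EFinP; apply: (measurableT_comp measurable_sqrtV).
  by apply: measurable_funB => //; exact: measurable_funX.
- move=> w; apply: mule_ge0; last by rewrite lee_fin invr_ge0 sqrtr_ge0.
  by apply: mule_ge0; [exact: H0|rewrite lee_fin sqrtr_ge0].
Qed.

Definition swap13 (v : R * R * R) : R * R * R := (v.2, v.1.2, v.1.1).

(** The disk chart is symmetric in its two coordinates, so this is Tonelli's theorem. Spherical
    coordinates show only the rotations about z; this reflection supplies what is missing to reach
    every direction. *)
Lemma sphere_int_swap13 f : measurable_fun setT f -> (forall v, 0 <= f v)%E ->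
  sphere_int (f \o swap13) = sphere_int f.
Proof.
move=> mf f0.
have ms : measurable_fun setT swap13.
  have m1 := measurableT_comp (@measurable_fst _ _ R R) (@measurable_fst _ _ (R * R)%type R).
  have m2 := measurableT_comp (@measurable_snd _ _ R R) (@measurable_fst _ _ (R * R)%type R).
  have m3 := @measurable_snd _ _ (R * R)%type R.
  exact: (measurable_fun_pair (measurable_fun_pair m3 m2) m1).
rewrite (sphere_int_disk mf f0).
rewrite (sphere_int_disk (measurableT_comp mf ms) (fun v => f0 (swap13 v))).
rewrite [RHS](@fubini_tonelli _ _ (measurableTypeR R) (measurableTypeR R) R leb leb
  (disk_integrand f) (measurable_disk_integrand mf)); last first.
  by move=> z; exact: disk_integrand_ge0.
apply: eq_integral => x _; apply: eq_integral => w _.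
rewrite /disk_integrand /swap13/=.
by have -> : disk_height (x, w) = disk_height (w, x) by rewrite /disk_height/= addrAC.
Qed.

End SphereRotation.

(** * Isometries of the sphere that carry the pole to a given direction *)

Section SphereIsometry.
Context {R : realType}.
Local Notation leb := (@lebesgue_measure R).
Implicit Types (f : R * R * R -> \bar R) (u v n r : R * R * R).

Lemma integral_itv_split (h : R -> \bar R) (x y z : R) :
  measurable_fun setT h -> (forall x, 0 <= h x)%E -> x <= y -> y <= z ->
  (\int[leb]_(p in `]x, z]) h p =
   \int[leb]_(p in `]x, y]) h p + \int[leb]_(p in `]y, z]) h p)%E.
Proof.
move=> mh h0 xy yz; rewrite -ge0_integral_setU//.
- congr (integral _ _ _); apply/seteqP; split=> p /=; rewrite !in_itv/=.
    by move=> /andP[p0 p2]; have [|] := leP p y; [left|right]; rewrite ?p0 ?p2.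
  by case=> /andP[h1 h2]; apply/andP; split=> //; lra.
- exact: measurable_funTS.
- rewrite disj_set2E; apply/eqP/seteqP; split=> p //=; rewrite !in_itv/=.
  by move=> [/andP[_ h1] /andP[h2 _]]; move: h1; rewrite leNgt h2.
Qed.

Lemma periodic_int (h : R -> \bar R) (a : R) : 0 <= a <= 2 * pi ->
  measurable_fun setT h -> (forall x, 0 <= h x)%E ->
  (forall x, h (x + 2 * pi) = h x) ->
  (\int[leb]_(p in `]0%R, (2 * pi)%R]) h (p + a)%R =
   \int[leb]_(p in `]0%R, (2 * pi)%R]) h p)%E.
Proof.
move=> /andP[a0 a2] mh h0 hp; have pi0 : 0 <= 2 * pi :> R by rewrite mulr_ge0// pi_ge0.
rewrite integral_translate// add0r.
rewrite (@integral_itv_split h a (2 * pi) (2 * pi + a))//; last by rewrite lerDl.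
rewrite (@integral_itv_split h 0 a (2 * pi))// addeC; congr (_ + _)%E.
have -> : `](2 * pi)%R, (2 * pi + a)%R] = `](0 + 2 * pi)%R, (a + 2 * pi)%R] :> interval R.
  by rewrite add0r addrC.
by rewrite -integral_translate//; apply: eq_integral => p _; rewrite hp.
Qed.

Definition rotz (a : R) v : R * R * R :=
  (v.1.1 * cos a - v.1.2 * sin a, v.1.1 * sin a + v.1.2 * cos a, v.2).

Lemma measurable_coord :
  [/\ measurable_fun setT (fun v : R * R * R => v.1.1),
      measurable_fun setT (fun v : R * R * R => v.1.2) &
      measurable_fun setT (fun v : R * R * R => v.2)].
Proof.
split; last exact: measurable_snd.
- exact: measurableT_comp (@measurable_fst _ _ R R) (@measurable_fst _ _ (R * R)%type R).
- exact: measurableT_comp (@measurable_snd _ _ R R) (@measurable_fst _ _ (R * R)%type R).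
Qed.

Lemma measurable_triple d (T : measurableType d) (x y z : T -> R) :
  measurable_fun setT x -> measurable_fun setT y -> measurable_fun setT z ->
  measurable_fun setT (fun t => (x t, y t, z t)).
Proof. by move=> mx my mz; do 2 apply: measurable_fun_pair => //. Qed.

Lemma measurable_rotz a : measurable_fun setT (rotz a).
Proof.
have [m1 m2 m3] := measurable_coord.
apply: measurable_triple => //.
  by apply: measurable_funB; apply: measurable_funM.
by apply: measurable_funD; apply: measurable_funM.
Qed.

Lemma sphere_int_rotz a f : 0 <= a <= 2 * pi ->
  measurable_fun setT f -> (forall v, 0 <= f v)%E ->
  sphere_int (f \o rotz a) = sphere_int f.
Proof.
move=> a0 mf f0; apply: eq_integral => t; rewrite inE/= in_itv/= => /andP[t0 tp].
have st : 0 <= sin t by rewrite sin_ge0_pi// (ltW t0).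
pose h p := (f (spherical_coord t p) * (sin t)%:E)%E.
have mh : measurable_fun setT h.
  apply: emeasurable_funM => //; apply: (measurableT_comp mf).
  apply: measurable_triple => //; apply: measurable_funM => //.
    exact: measurable_cos.
  exact: measurable_sin.
rewrite -[RHS](@periodic_int h a)//.
- apply: eq_integral => p _; rewrite /h/=; congr (f _ * _)%E.
  by rewrite /rotz /spherical_coord/= cosD sinD; congr (_, _, _); ring.
- by move=> x; apply: mule_ge0; [exact: f0|rewrite lee_fin].
- move=> x; rewrite /h /spherical_coord.
  by rewrite mulr_natl cosD2pi sinD2pi.
Qed.

Definition dot3 u v : R := u.1.1 * v.1.1 + u.1.2 * v.1.2 + u.2 * v.2.

Definition lin3 (a : R) u (b : R) v : R * R * R :=
  (a * u.1.1 + b * v.1.1, a * u.1.2 + b * v.1.2, a * u.2 + b * v.2).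

(** The half turn of [n] about [r], which is how conjugation by r . sigma acts on the vector part.
    Written with [dot3] and [lin3], it visibly commutes with linear isometries. *)
Definition axial n r := lin3 (2 * dot3 r n) r (-1) n.

(** What is required to transport the law of [axial] from the pole to [n]. Linearity for two-term
    combinations suffices, as [axial] and the antipodal map have that form. *)
Record sphere_isometry (Q : R * R * R -> R * R * R) := SphereIsometry {
  measurable_isometry : measurable_fun setT Q;
  isometry_int : forall f, measurable_fun setT f -> (forall v, 0 <= f v)%E ->
    sphere_int (f \o Q) = sphere_int f;
  isometry_dot : forall u v, dot3 (Q u) (Q v) = dot3 u v;
  isometry_lin : forall a u b v, Q (lin3 a u b v) = lin3 a (Q u) b (Q v) }.

Lemma isometry_comp Q1 Q2 : sphere_isometry Q1 -> sphere_isometry Q2 ->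
  sphere_isometry (Q1 \o Q2).
Proof.
move=> [m1 i1 d1 l1] [m2 i2 d2 l2]; split.
- exact: measurableT_comp.
- move=> f mf f0; have fQ0 v : (0 <= (f \o Q1) v)%E by exact: f0.
  by rewrite -(i1 f mf f0) -(i2 _ (measurableT_comp mf m1) fQ0).
- by move=> u v; rewrite /= d1 d2.
- by move=> a u b v; rewrite /= l2 l1.
Qed.

Lemma isometry_swap13 : sphere_isometry swap13.
Proof.
have [m1 m2 m3] := measurable_coord; split.
- exact: measurable_triple.
- exact: sphere_int_swap13.
- by move=> u v; rewrite /dot3/=; ring.
- by [].
Qed.

Lemma isometry_rotz a : 0 <= a <= 2 * pi -> sphere_isometry (rotz a).
Proof.
move=> a0; split.
- exact: measurable_rotz.
- by move=> f mf f0; exact: sphere_int_rotz.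
- move=> u v; rewrite /dot3/=.
  transitivity ((u.1.1 * v.1.1 + u.1.2 * v.1.2) * (cos a ^+ 2 + sin a ^+ 2) + u.2 * v.2).
    by ring.
  by rewrite cos2Dsin2 mulr1.
- by move=> b u c v; rewrite /lin3 /rotz/=; congr (_, _, _); ring.
Qed.

Lemma polar_angle (x y : R) : x ^+ 2 + y ^+ 2 = 1 ->
  exists2 a, 0 <= a <= 2 * pi & x = cos a /\ y = sin a.
Proof.
move=> xy; have x1 : -1 <= x <= 1 by apply/andP; split; nra.
have ca : cos (acos x) = x by rewrite acosK// in_itv.
have sa : sin (acos x) = `|y|.
  by rewrite sin_acos// -sqrtr_sqr -xy; congr Num.sqrt; ring.
have a0 := acos_ge0 x1; have ap := acos_lepi x1; have p0 := pi_ge0 R.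
have [y0|y0] := leP 0 y.
  by exists (acos x); [lra|rewrite ca sa ger0_norm].
exists (2 * pi - acos x); first lra.
rewrite mulr_natl addrC cosD2pi sinD2pi cosN sinN ca sa ltr0_norm//.
by rewrite opprK.
Qed.

(** Conjugating a rotation about z by [swap13] gives a rotation about x, which tilts the pole to the
    polar angle of [n]; a rotation about z then adjusts the azimuth. *)
Lemma isometry_pole n : unit_vector n ->
  exists2 Q, sphere_isometry Q & Q (0, 0, 1) = n.
Proof.
case: n => [[x y] z]; rewrite /unit_vector/= => n1.
have z1 : -1 <= z <= 1 by apply/andP; split; nra.
have b0 := acos_ge0 z1; have bp := acos_lepi z1; have p0 := pi_ge0 R.
have cb : cos (acos z) = z by rewrite acosK// in_itv.
have sb : sin (acos z) ^+ 2 = x ^+ 2 + y ^+ 2 by rewrite sin2cos2 cb -n1; ring.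
set s := sin (acos z) in sb.
have [a a0 [xa ya]] : exists2 a : R, 0 <= a <= 2 * pi & x = - (s * sin a) /\ y = s * cos a.
  (* At the poles the azimuth is arbitrary and 0 is taken. *)
  have [s0|s0] := eqVneq s 0.
    exists 0; first by rewrite lexx/= mulr_ge0.
    by move: sb; rewrite s0 !mul0r; nra.
  have [|a a0 [ca sa]] := @polar_angle (y / s) (- x / s).
    by rewrite !expr_div_n sqrrN -mulrDl addrC -sb divff// expf_neq0.
  by exists a => //; rewrite -ca -sa; split; field.
exists (rotz a \o (swap13 \o (rotz (acos z) \o swap13))).
  apply: isometry_comp; first exact: isometry_rotz.
  apply: isometry_comp; first exact: isometry_swap13.
  apply: isometry_comp; last exact: isometry_swap13.
  by apply: isometry_rotz; lra.
rewrite /rotz /swap13/= cb -/s xa ya; congr (_, _, _); ring.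
Qed.

Lemma axial_isometry Q n r : sphere_isometry Q -> axial (Q n) (Q r) = Q (axial n r).
Proof. by move=> HQ; rewrite /axial (isometry_dot HQ) -(isometry_lin HQ). Qed.

End SphereIsometry.

(** * Law of the axial map *)

Section AxialLaw.
Context {R : realType}.
Local Notation leb := (@lebesgue_measure R).
Implicit Types (f h : R * R * R -> \bar R) (n : R * R * R).

(** The shift by pi / 2 turns |sin| into |cos|. Applied to the doubled polar angle of the axial map
    and to the band, whose defining product is symmetric in sin t and cos t. *)
Lemma quarter_turn_fold (M : R -> \bar R) : measurable_fun setT M ->
  (forall t, 0 <= M t)%E -> (forall t, M (t + pi / 2) = M t) ->
  (\int[leb]_(t in `]0%R, pi]) (M t * (`|sin t|)%:E) =
   \int[leb]_(t in `]0%R, (pi / 2)%R]) (M t * (`|sin t| + `|cos t|)%:E))%E.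
Proof.
move=> mM M0 Mp; have pi0 : 0 <= pi :> R := pi_ge0 R.
pose K t : \bar R := (M t * (`|sin t|)%:E)%E.
have mK : measurable_fun setT K.
  apply: emeasurable_funM => //; apply/measurable_EFinP; apply: measurableT_comp => //.
  exact: measurable_sin.
have K0 t : (0 <= K t)%E by apply: mule_ge0; [exact: M0|rewrite lee_fin].
rewrite (@integral_itv_split _ K 0 (pi / 2) pi)//; [|lra|lra].
have -> : `](pi / 2)%R, pi] = `](0 + pi / 2)%R, (pi / 2 + pi / 2)%R] :> interval R.
  by rewrite add0r -splitr.
rewrite -integral_translate//; last lra.
rewrite -ge0_integralD//.
- apply: eq_integral => t _; rewrite EFinD ge0_muleDr ?lee_fin//; congr (_ + _)%E.
  by rewrite /K Mp sinDpihalf.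
- exact: measurable_funTS.
- apply: measurable_funTS; apply: (measurableT_comp mK).
  exact: measurable_funD.
Qed.

Definition even3 h := forall x y z, h (- x, - y, - z) = h (x, y, z).

Lemma sin_cos_ineq (a b s : R) : 0 <= a -> 0 <= b -> b ^+ 2 + a ^+ 2 = 1 ->
  s ^+ 2 = 2 -> 0 < s -> s * (2 * (a * b)) <= a + b.
Proof.
move=> a0 b0 ab1 s2 s0.
have abs : a + b <= s.
  rewrite -(ler_pXn2r (n:=2)) ?nnegrE ?addr_ge0// ?(ltW s0)// s2.
  have := sqr_ge0 (a - b); nra.
(* With u = a + b one has 2 a b = u ^ 2 - 1, and s u ^ 2 - u - s = (u - s) (s u + 1). Equality at a
   = b shows that 1 / sqrt 2 is the exact minimum of the density. *)
have : 0 <= (s - (a + b)) * (s * (a + b) + 1).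
  by rewrite mulr_ge0 ?subr_ge0// addr_ge0// mulr_ge0 ?(ltW s0)// addr_ge0.
have -> : (s - (a + b)) * (s * (a + b) + 1) =
    s ^+ 2 * (a + b) + s - s * ((b ^+ 2 + a ^+ 2) + 2 * (a * b)) - (a + b) by ring.
by rewrite s2 ab1; lra.
Qed.

(* The law of the axial map of the pole has density (sin (g/2) + cos (g/2)) / (2 sin g)
   with respect to the uniform law at polar angle g (up to sign). *)
Lemma axial_pole_ge h : measurable_fun setT h -> (forall v, 0 <= h v)%E -> even3 h ->
  (((Num.sqrt 2)^-1)%:E * sphere_int h <=
   sphere_int (h \o axial (0, 0, 1)%R))%E.
Proof.
move=> mh h0 hev.
pose G (g : R) := (\int[leb]_(p in `]0%R, (2 * pi)%R]) h (spherical_coord g p))%E.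
have mhs : measurable_fun setT (fun z : R * R => h (spherical_coord z.1 z.2)).
  exact: (measurableT_comp mh measurable_spherical_coord).
have mG : measurable_fun setT G by exact: (@measurable_int_param _ _ (fun z => h (spherical_coord z.1 z.2))).
have G0 g : (0 <= G g)%E by exact: integral_ge0.
(* Adding pi to the polar angle is the antipodal map; this is where evenness enters. *)
have Gpi g : G (g + pi) = G g.
  apply: eq_integral => p _; rewrite /spherical_coord sinDpi cosDpi !mulNr; exact: hev.
have mh1 g : measurable_fun setT (fun p => h (spherical_coord g p)).
  apply: (measurableT_comp mh); apply: measurable_triple => //; apply: measurable_funM => //.
    exact: measurable_cos.
  exact: measurable_sin.
have inner (c g : R) : 0 <= c -> (\int[leb]_(p in `]0%R, (2 * pi)%R])
    (h (spherical_coord g p) * c%:E) = G g * c%:E)%E.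
  by move=> c0; rewrite ge0_integralZr//; apply: measurable_funTS; exact: mh1.
have pi0 : 0 <= pi :> R := pi_ge0 R.
pose K t : \bar R := (G (2 * t)%R * (`|sin t|)%:E)%E.
have mabs (g : R -> R) : measurable_fun setT g -> measurable_fun setT (fun t => `|g t|%:E).
  by move=> mg; apply/measurable_EFinP; apply: measurableT_comp.
have m2 : measurable_fun setT (fun t : R => 2 * t) by apply: measurable_funM.
have mG2 : measurable_fun setT (fun t : R => G (2 * t)) by exact: measurableT_comp.
have mK : measurable_fun setT K.
  by apply: emeasurable_funM => //; apply: mabs; exact: measurable_sin.
have K0 t : (0 <= K t)%E by apply: mule_ge0; [exact: G0|rewrite lee_fin].
(* The half turn about the direction with angles t, p carries the pole to the direction with angles
   2 t, p. *)
have -> : sphere_int (h \o axial (0, 0, 1)) = (\int[leb]_(t in `]0%R, pi]) K t)%E.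
  apply: eq_integral => t; rewrite inE/= in_itv/= => /andP[t0 tp].
  have st : 0 <= sin t by rewrite sin_ge0_pi// (ltW t0).
  rewrite /K ger0_norm// -inner//; apply: eq_integral => p _ /=; congr (h _ * _)%E.
  rewrite /axial /lin3 /dot3 /spherical_coord/= (mulr_natl t) sin_mulr2n cos_mulr2n.
  by congr (_, _, _); ring.
have split2 : (\int[leb]_(t in `]0%R, pi]) K t =
    \int[leb]_(t in `]0%R, (pi / 2)%R]) (G (2 * t)%R * (`|sin t| + `|cos t|)%:E))%E.
  apply: (quarter_turn_fold mG2) => // t.
  by rewrite (_ : 2 * (t + pi / 2) = 2 * t + pi) ?Gpi//; field.
rewrite split2.
have dF (x : R) : is_derive x 1 (fun t : R => 2 * t) 2.
  by apply: is_derive_eq; rewrite /GRing.scale/=; ring.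
have cF : continuous (cst 2 : R -> R) by move=> x; exact: cst_continuous.
have incF : {in `[0, pi / 2] &, {homo (fun t : R => 2 * t) : x y / x < y}}.
  by move=> x y _ _; rewrite ltr_pM2l.
pose L g : \bar R := (G g * (`|sin g|)%:E)%E.
have mL : measurable_fun setT L.
  by apply: emeasurable_funM => //; apply: mabs; exact: measurable_sin.
have L0 g : (0 <= L g)%E by apply: mule_ge0; [exact: G0|rewrite lee_fin].
have -> : sphere_int h = (\int[leb]_(t in `]0%R, (pi / 2)%R]) (L (2 * t)%R * 2%:E))%E.
  rewrite (ge0_integral_substitution _ dF cF incF (fun _ _ => ler0n R 2) mL L0); last lra.
  rewrite mulr0 (_ : 2 * (pi / 2) = pi); last by field.
  apply: eq_integral => t; rewrite inE/= in_itv/= => /andP[t0 tp].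
  have st : 0 <= sin t by rewrite sin_ge0_pi// (ltW t0).
  by rewrite inner// /L ger0_norm.
have mL2 : measurable_fun setT (fun t : R => L (2 * t)%R * 2%:E)%E.
  by apply: emeasurable_funM => //; exact: measurableT_comp.
have L20 (t : R) : (0 <= L (2 * t)%R * 2%:E)%E.
  by apply: mule_ge0; [exact: L0|rewrite lee_fin].
have c0 : (0 <= ((Num.sqrt 2)^-1 : R)%:E)%E by rewrite lee_fin invr_ge0 sqrtr_ge0.
rewrite -(ge0_integralZl leb (measurable_itv _) (measurable_funTS mL2) (fun t _ => L20 t) c0).
apply: ge0_le_integral => //.
- by move=> t _; apply: mule_ge0.
- by apply: measurable_funTS; apply: emeasurable_funM.
- apply: measurable_funTS; apply: emeasurable_funM => //; apply/measurable_EFinP.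
  apply: measurable_funD; apply: measurableT_comp => //.
    exact: measurable_sin.
  exact: measurable_cos.
move=> t; rewrite /= in_itv/= => /andP[t0 tp].
rewrite /L muleC -!muleA -!EFinM; apply: lee_wpmul2l => //; rewrite lee_fin.
have st : 0 <= sin t by rewrite sin_ge0_pi// (ltW t0)/=; lra.
have ct : 0 <= cos t by rewrite cos_ge0_pihalf//; lra.
rewrite (mulr_natl t) sin_mulr2n !ger0_norm ?mulrn_wge0 ?mulr_ge0//.
have s2 : Num.sqrt 2 ^+ 2 = 2 :> R by rewrite sqr_sqrtr.
have s20 : 0 < Num.sqrt 2 :> R by rewrite sqrtr_gt0.
have cs := cos2Dsin2 t.
set a := sin t in st cs *; set b := cos t in ct cs *.
have sc := sin_cos_ineq st ct cs s2 s20.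
have -> : (b * a) *+ 2 * (2 * (Num.sqrt 2)^-1) = Num.sqrt 2 * (2 * (a * b)).
  rewrite -[X in X * (_)^-1]s2 expr2 mulfK ?gt_eqF// -mulr_natr; ring.
by [].
Qed.

Lemma axial_law_ge n h : unit_vector n ->
  measurable_fun setT h -> (forall v, 0 <= h v)%E -> even3 h ->
  (((Num.sqrt 2)^-1)%:E * sphere_int h <= sphere_int (h \o axial n))%E.
Proof.
move=> n1 mh h0 hev; have [Q HQ Qn] := isometry_pole n1.
have man : measurable_fun setT (axial n).
  have [m1 m2 m3] := @measurable_coord R.
  have md : measurable_fun setT (fun r => 2 * dot3 r n).
    apply: measurable_funM => //; apply: measurable_funD; last exact: measurable_funM.
    by apply: measurable_funD; apply: measurable_funM.
  by apply: measurable_triple; apply: measurable_funD => //; apply: measurable_funM.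
rewrite -(isometry_int HQ (measurableT_comp mh man) (fun v => h0 _)).
rewrite -(isometry_int HQ mh h0).
have -> : (h \o axial n) \o Q = (h \o Q) \o axial (0, 0, 1).
  by apply/funext => r /=; rewrite -(axial_isometry _ _ HQ) Qn.
apply: axial_pole_ge.
- exact: measurableT_comp mh (measurable_isometry HQ).
- by move=> v; exact: h0.
move=> x y z /=; have -> : (- x, - y, - z) = lin3 (-1) (x, y, z) 0 (x, y, z) :> R * R * R.
  by rewrite /lin3/=; congr (_, _, _); ring.
rewrite (isometry_lin HQ); case: (Q _) => [[a b] c]; rewrite -(hev a b c).
by congr h; rewrite /lin3/=; congr (_, _, _); ring.
Qed.

End AxialLaw.

(** * Elementary bounds for sine, cosine and pi *)

Section TrigBounds.
Context {R : realType}.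
Implicit Types x : R.

Lemma sin_le x : 0 <= x -> sin x <= x.
Proof.
move=> x0.
have [->|xn0] := eqVneq x 0; first by rewrite sin0.
have {}x0 : 0 < x by rewrite lt_neqAle eq_sym xn0.
have dF (y : R) : is_derive y 1 (fun y : R => y - sin y) (1 - cos y) by apply: is_derive_eq.
have cF : {within `[0, x], continuous (fun y : R => y - sin y)}.
  by apply: continuous_subspaceT => y; apply: cvgB; [exact: cvg_id|exact: continuous_sin].
have [c _] := MVT x0 (fun y _ => dF y) cF.
rewrite sin0 !subr0 => xE; by rewrite -subr_ge0 xE mulr_ge0 ?(ltW x0)// subr_ge0 cos_le1.
Qed.

Lemma norm_sin_le x : `|sin x| <= `|x|.
Proof.
have h (y : R) : 0 <= y -> `|sin y| <= y.
  move=> y0; rewrite ler_norml; apply/andP; split; last exact: sin_le.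
  have [y1|y1] := leP y 1; last by rewrite (le_trans _ (sin_geN1 y))// lerN2 ltW.
  rewrite (@le_trans _ _ 0)// ?oppr_le0// sin_ge0_pi// y0/=.
  by rewrite (le_trans y1)// (le_trans _ (pi_ge2 R))// ler1n.
have [x0|x0] := leP 0 x; first by rewrite (ger0_norm x0) h.
by rewrite -normrN -sinN (ltr0_norm x0) h// oppr_ge0 ltW.
Qed.

Lemma cos_ge x : 1 - x ^+ 2 / 2 <= cos x.
Proof.
have -> : cos x = 1 - 2 * sin (x / 2) ^+ 2.
  rewrite {1}(splitr x) cosD -!expr2 cos2sin2; ring.
have := norm_sin_le (x / 2); rewrite -ler_sqr ?nnegrE// !real_normK ?num_real//.
have -> : (x / 2) ^+ 2 = x ^+ 2 / 4 by field.
lra.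
Qed.

Lemma sin_ge x : 0 <= x -> x - x ^+ 3 / 6 <= sin x.
Proof.
move=> x0.
have [->|xn0] := eqVneq x 0; first by rewrite sin0 expr0n/= mul0r subr0.
have {}x0 : 0 < x by rewrite lt_neqAle eq_sym xn0.
have dF (y : R) : is_derive y 1 (fun y : R => sin y - y + y ^+ 3 / 6)
    (cos y - 1 + y ^+ 2 / 2).
  by apply: is_derive_eq; rewrite /GRing.scale/=; field.
have cF : {within `[0, x], continuous (fun y : R => sin y - y + y ^+ 3 / 6)}.
  apply: continuous_subspaceT => y; apply: cvgD.
    by apply: cvgB; [exact: continuous_sin|exact: cvg_id].
  apply: cvgM; last exact: cvg_cst.
  exact: exprn_continuous.
have [c _] := MVT x0 (fun y _ => dF y) cF.
rewrite sin0 expr0n/= mul0r !(subr0, addr0) => xE.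
suff : 0 <= sin x - x + x ^+ 3 / 6 by lra.
rewrite xE mulr_ge0 ?(ltW x0)//.
by have := cos_ge c; lra.
Qed.

Lemma sin_pi6 : sin (pi / 6) = 1 / 2 :> R.
Proof.
set x : R := pi / 6.
have h0 : sin (x + (x + x)) = 1.
  by rewrite [X in sin X](_ : _ = pi / 2) ?sin_pihalf// /x; field.
have h : sin x * (cos x ^+ 2 - sin x ^+ 2) + cos x * (sin x * cos x + cos x * sin x) = 1.
  by rewrite -h0 (sinD x) (sinD x x) cosD !expr2.
have c2 := cos2sin2 x.
have s0 : 0 <= sin x.
  have p0 := pi_ge0 R; rewrite sin_ge0_pi// /x; lra.
set s := sin x in h c2 s0 *; set c := cos x in h c2.
(* The triple angle formula at 3 x = pi / 2 reads 3 s - 4 s ^ 3 = 1, whose only root s >= 0 is 1 /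
   2. *)
have : (s + 1) * (2 * s - 1) ^+ 2 = 0.
  have <- : 1 - (s * (c ^+ 2 - s ^+ 2) + c * (s * c + c * s)) = 0 by rewrite h subrr.
  have -> : c * (s * c + c * s) = 2 * s * c ^+ 2 by ring.
  rewrite c2; ring.
move/eqP; rewrite mulf_eq0 sqrf_eq0 => /orP[|] /eqP; lra.
Qed.

Lemma pi_ge3 : 3 <= pi :> R.
Proof. by have := @sin_le (pi / 6); rewrite sin_pi6; have := pi_ge0 R; lra. Qed.

Lemma pi_le : pi <= 3144 / 1000 :> R.
Proof.
have := @sin_ge (pi / 6); rewrite sin_pi6; have := pi_ge0 R; have := pihalf_lt2 R.
set x : R := pi / 6; have -> : pi = 6 * x by rewrite /x; field.
move=> x4 x0 /(_ _) h; have {}h := h ltac:(lra).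
have [//|xb] := leP (6 * x) (3144/1000).
(* At 0.524 = 3.144 / 6 the cubic x - x ^ 3 / 6 already exceeds 1 / 2, and it increases up to 1,
   against sin x = 1 / 2. *)
have x1 : 0 <= (x - 524/1000) * (1 - x) by apply: mulr_ge0; lra.
nra.
Qed.

End TrigBounds.

(** * Probability of a band around two great circles *)

Section Band.
Context {R : realType}.
Local Notation leb := (@lebesgue_measure R).

Definition band (tau : R) : set (R * R * R) := [set v | `|v.1.1 * v.2| <= tau].

Lemma measurable_band tau : measurable (band tau).
Proof.
have [m1 m2 m3] := @measurable_coord R.
have -> : band tau = (fun v : R * R * R => `|v.1.1 * v.2|) @^-1` `]-oo, tau].
  by apply/seteqP; split => v /=; rewrite in_itv.
rewrite -[X in measurable X]setTI.
have : measurable_fun setT (fun v : R * R * R => `|v.1.1 * v.2|).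
  by apply: measurableT_comp => //; exact: measurable_funM.
by apply.
Qed.

(** |cos p| is at most the distance from p to a zero of cos, so [B] contains the arcs of radius tau
    / c around pi / 2 and 3 pi / 2; the bound pi / 2 on the radius keeps them from overlapping. *)
Lemma arc_ge (c tau : R) (B : set R) : measurable B -> 0 < c -> 0 < tau ->
  tau / c <= pi / 2 -> (forall p, `|c * cos p| <= tau -> B p) ->
  ((4 * (tau / c))%:E <= \int[leb]_(p in `]0%R, (2 * pi)%R]) (\1_B p)%:E)%E.
Proof.
move=> mB c0 t0 r2 HB; set r := tau / c in r2 *.
have r0 : 0 < r by rewrite divr_gt0.
have p0 := pi_gt0 R.
have mI : measurable_fun setT (fun p => (\1_B p)%:E : \bar R).
  by apply/measurable_EFinP.
have I0 p : (0 <= (\1_B p)%:E :> \bar R)%E by rewrite lee_fin.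
have half (x a b : R) : (forall p, `|cos p| <= `|p - x|) -> a <= x - r -> x + r <= b ->
    ((2 * r)%:E <= \int[leb]_(p in `]a, b]) (\1_B p)%:E)%E.
  move=> cx ax xb.
  apply: (@le_trans _ _ (\int[leb]_(p in `](x - r)%R, (x + r)%R]) (\1_B p)%:E)%E); last first.
    apply: ge0_subset_integral => //; first exact: measurable_funTS.
    by apply: subset_itv; rewrite bnd_simp.
  rewrite (eq_integral (cst 1%E)); last first.
    move=> p; rewrite inE/= in_itv/= => /andP[h1 h2].
    rewrite indicE mem_set//; apply: HB.
    rewrite normrM gtr0_norm// mulrC -ler_pdivlMr//.
    by apply: (le_trans (cx p)); rewrite -/r ler_norml; apply/andP; split; lra.
  rewrite integral_cst//= mul1e lebesgue_measure_itv/= lte_fin ifT; last lra.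
  by rewrite -EFinB lee_fin; lra.
rewrite (@integral_itv_split _ _ 0 pi (2 * pi))//; [|lra|lra].
have -> : 4 * r = 2 * r + 2 * r by ring.
rewrite EFinD; apply: leeD.
  apply: (half (pi / 2)); [|lra|lra] => p.
  have -> : cos p = - sin (p - pi / 2) by rewrite sinBpihalf opprK.
  by rewrite normrN norm_sin_le.
apply: (half (pi + pi / 2)); [|lra|lra] => p.
have -> : cos p = sin (p - (pi + pi / 2)).
  by rewrite opprD addrA sinBpihalf -[in LHS](subrK pi p) cosDpi.
exact: norm_sin_le.
Qed.

Lemma sphere_int_band tau :
  sphere_int (fun v => (\1_(band tau) v)%:E) =
  (\int[leb]_(t in `]0%R, (pi / 2)%R])
     ((\int[leb]_(p in `]0%R, (2 * pi)%R]) (\1_(band tau) (spherical_coord t p))%:E) *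
      (`|sin t| + `|cos t|)%:E))%E.
Proof.
pose M (t : R) := (\int[leb]_(p in `]0%R, (2 * pi)%R]) (\1_(band tau) (spherical_coord t p))%:E)%E.
have mb : measurable_fun setT (fun v : R * R * R => (\1_(band tau) v)%:E : \bar R).
  by apply/measurable_EFinP; apply: measurable_indic; exact: measurable_band.
have mM : measurable_fun setT M.
  apply: (@measurable_int_param _ _ (fun z => (\1_(band tau) (spherical_coord z.1 z.2))%:E)) => //.
  exact: (measurableT_comp mb measurable_spherical_coord).
have M0 t : (0 <= M t)%E by apply: integral_ge0 => p _; rewrite lee_fin.
rewrite -(quarter_turn_fold mM M0).
- apply: eq_integral => t; rewrite inE/= in_itv/= => /andP[t0 tp].
  have st : 0 <= sin t by rewrite sin_ge0_pi// (ltW t0).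
  rewrite ger0_norm// ge0_integralZr//.
    apply: measurable_funTS; apply: (measurableT_comp mb).
    apply: measurable_triple => //; apply: measurable_funM => //.
      exact: measurable_cos.
    exact: measurable_sin.
- move=> t; apply: eq_integral => p _; congr EFin; rewrite !indicE.
  have E v : (v \in band tau) = (`|v.1.1 * v.2| <= tau).
    by apply/idP/idP => [/set_mem//|h]; exact/mem_set.
  rewrite !E /spherical_coord/= sinDpihalf cosDpihalf mulrN normrN.
  by congr (nat_of_bool (`|_| <= _))%:R; ring.
Qed.

Lemma is_derive_ln (u : R -> R) (t du : R) : 0 < u t -> is_derive t 1 u du ->
  is_derive t 1 (fun x => ln (u x)) (du / u t).
Proof.
move=> u0 Du; have D := is_derive1_ln u0.
rewrite [X in is_derive _ _ _ X](_ : _ = (u t)^-1 * du); last by rewrite mulrC.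
exact: (is_derive1_comp (f := @ln R) (g := u)).
Qed.

(** The derivative is the arc length 4 tau / (sin t cos t) times the weight sin t + cos t; the
    logarithms are antiderivatives of 1 / cos and 1 / sin. *)
Lemma is_derive_log_slice tau t : 0 < sin t -> 0 < cos t -> sin t < 1 -> cos t < 1 ->
  is_derive t 1 (fun t : R =>
      2 * tau * (ln (1 + sin t) - ln (1 - sin t) + ln (1 - cos t) - ln (1 + cos t)))
    (4 * tau * ((cos t)^-1 + (sin t)^-1)).
Proof.
move=> hs hc s1 c1.
have U1 : is_derive t 1 (fun x : R => 1 + sin x) (cos t).
  by apply: is_derive_eq; ring.
have D1 := is_derive_ln (u := fun x : R => 1 + sin x) ltac:(move=> /=; lra) U1.
have U2 : is_derive t 1 (fun x : R => 1 - sin x) (- cos t).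
  by apply: is_derive_eq; ring.
have D2 := is_derive_ln (u := fun x : R => 1 - sin x) ltac:(move=> /=; lra) U2.
have U3 : is_derive t 1 (fun x : R => 1 - cos x) (sin t).
  by apply: is_derive_eq; ring.
have D3 := is_derive_ln (u := fun x : R => 1 - cos x) ltac:(move=> /=; lra) U3.
have U4 : is_derive t 1 (fun x : R => 1 + cos x) (- sin t).
  by apply: is_derive_eq; ring.
have D4 := is_derive_ln (u := fun x : R => 1 + cos x) ltac:(move=> /=; lra) U4.
apply: is_derive_eq; rewrite /GRing.scale/=.
have e1 : (1 + sin t) * (1 - sin t) = cos t ^+ 2 by rewrite cos2sin2; ring.
have e2 : (1 + cos t) * (1 - cos t) = sin t ^+ 2 by rewrite sin2cos2; ring.
have -> : cos t / (1 + sin t) = (1 - sin t) / cos t.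
  apply/eqP; rewrite eqr_div; last 2 first; [by rewrite gt_eqF//; lra..|].
  by rewrite -expr2 -e1 mulrC.
have -> : - cos t / (1 - sin t) = - ((1 + sin t) / cos t).
  rewrite mulNr; congr (- _); apply/eqP; rewrite eqr_div; last 2 first; [by rewrite gt_eqF//; lra..|].
  by rewrite -expr2 -e1.
have -> : - sin t / (1 + cos t) = - ((1 - cos t) / sin t).
  rewrite mulNr; congr (- _); apply/eqP; rewrite eqr_div; last 2 first; [by rewrite gt_eqF//; lra..|].
  by rewrite -expr2 -e2 mulrC.
have -> : sin t / (1 - cos t) = (1 + cos t) / sin t.
  apply/eqP; rewrite eqr_div; last 2 first; [by rewrite gt_eqF//; lra..|].
  by rewrite -expr2 -e2.
by field; rewrite !gt_eqF//; lra.
Qed.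

Lemma slice_ge tau w t : 0 < tau -> 8 / 10 < w -> w ^+ 2 = 1 - tau ^+ 2 ->
  tau <= sin t -> tau <= cos t ->
  ((4 * tau * ((cos t)^-1 + (sin t)^-1))%:E <=
   (\int[leb]_(p in `]0%R, (2 * pi)%R]) (\1_(band tau) (spherical_coord t p))%:E) *
      (`|sin t| + `|cos t|)%:E)%E.
Proof.
move=> t0 w2 ww hs hc; have p3 := @pi_ge3 R; have w0 : 0 <= w by apply: ltW; clear - w2; lra.
have csE := cos2Dsin2 t.
have s0 : 0 < sin t by exact: lt_le_trans hs.
have co0 : 0 < cos t by exact: lt_le_trans hc.
have c0 : 0 < sin t * cos t by exact: mulr_gt0.
have mB : measurable [set p | band tau (spherical_coord t p)].
  rewrite -[X in measurable X]setTI.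
  have msp : measurable_fun setT (fun p : R => spherical_coord t p).
    apply: measurable_triple => //; apply: measurable_funM => //.
      exact: measurable_cos.
    exact: measurable_sin.
  by apply: msp => //; exact: measurable_band.
have r2 : tau / (sin t * cos t) <= pi / 2.
  rewrite ler_pdivrMr//.
  (* The squares of sin t and cos t sum to 1 and are at least tau ^ 2, so their product is at least
     tau ^ 2 (1 - tau ^ 2). Hence tau / (sin t cos t) <= 1 / w < 3 / 2 <= pi / 2. *)
  have : tau * w <= sin t * cos t.
    rewrite -(ler_pXn2r (n:=2)) ?nnegrE ?(ltW c0) ?mulr_ge0 ?(ltW t0)//.
    have : 0 <= (sin t ^+ 2 - tau ^+ 2) * (cos t ^+ 2 - tau ^+ 2).
      by rewrite mulr_ge0// subr_ge0 ler_pXn2r ?nnegrE// ltW.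
    rewrite !exprMn ww; move: (sin t ^+ 2) (cos t ^+ 2) (tau ^+ 2) csE => x y z.
    by clear => h; have -> : y = 1 - x; lra.
  have h1 : tau * (8 / 10) <= tau * w by rewrite ler_pM2l// ltW.
  have h2 : 3 / 2 * (sin t * cos t) <= pi / 2 * (sin t * cos t).
    by rewrite ler_pM2r//; clear - p3; lra.
  by move: (sin t * cos t) (tau * w) h1 h2 => x y; clear - t0; lra.
have := arc_ge mB c0 t0 r2.
move=> /(_ _)/wrap[].
  move=> p; rewrite /band/=; rewrite (_ : sin t * cos p * cos t = sin t * cos t * cos p)//; ring.
move=> HM.
have -> : (4 * tau * ((cos t)^-1 + (sin t)^-1))%:E =
    ((4 * (tau / (sin t * cos t)))%:E * (`|sin t| + `|cos t|)%:E)%E.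
  rewrite -EFinM !ger0_norm ?ltW//; congr EFin; field.
  by rewrite !gt_eqF.
by apply: lee_wpmul2r => //; rewrite lee_fin addr_ge0.
Qed.

(** The quarter turn is cut at a = asin tau and pi / 2 - a. Near both ends the whole circle of
    latitude lies in the band, which yields the term with pi; in between only the arcs of [arc_ge]
    are counted, which yields the logarithms. *)
Lemma band_int_ge tau w : 0 < tau -> tau <= 1 / 2 -> 0 <= w ->
  w ^+ 2 = 1 - tau ^+ 2 ->
  ((4 * (pi * (tau + (1 - w)) +
     tau * (ln (1 + w) - ln (1 - w) + ln (1 - tau) - ln (1 + tau))))%:E <=
   sphere_int (fun v => (\1_(band tau) v)%:E))%E.
Proof.
move=> t0 t1 w0 ww.
have p0 := pi_gt0 R; have p3 := @pi_ge3 R.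
have tt : -1 <= tau <= 1 by apply/andP; split; lra.
have w1 : w < 1 by nra.
have w2 : 8 / 10 < w by nra.
pose a : R := asin tau; pose b : R := pi / 2 - a.
have sa : sin a = tau by rewrite asinK// in_itv.
have ca : cos a = w by rewrite cos_asin// -ww sqrtr_sqr ger0_norm.
have sb : sin b = w by rewrite /b sinB sin_pihalf cos_pihalf ca; ring.
have cb : cos b = tau by rewrite /b cosB sin_pihalf cos_pihalf sa; ring.
have al : - (pi / 2) <= a <= pi / 2 by rewrite asin_geNpi2// asin_lepi2.
have monos (x y : R) : - (pi / 2) <= x -> x <= y -> y <= pi / 2 -> sin x <= sin y.
  move=> hx xy hy; have xi : x \in `[- (pi / 2), pi / 2] by rewrite in_itv/=; apply/andP; split; lra.
  have yi : y \in `[- (pi / 2), pi / 2] by rewrite in_itv/=; apply/andP; split; lra.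
  by rewrite leNgt (ltr_sin yi xi) -leNgt.
have a0 : 0 < a.
  rewrite ltNge; apply/negP => a0; have := monos a 0; rewrite sa sin0; lra.
have a6 : a <= pi / 6.
  rewrite leNgt; apply/negP => a6.
  have i6 : (pi / 6 : R) \in `[- (pi / 2), pi / 2].
    by rewrite in_itv/=; apply/andP; split; lra.
  have ia : a \in `[- (pi / 2), pi / 2] by rewrite in_itv.
  by have := ltr_sin i6 ia; rewrite sin_pi6 sa a6; lra.
have sc t : cos t = sin (pi / 2 - t) by rewrite sinB sin_pihalf cos_pihalf; ring.
pose M (t : R) := (\int[leb]_(p in `]0%R, (2 * pi)%R]) (\1_(band tau) (spherical_coord t p))%:E)%E.
have mb : measurable_fun setT (fun v : R * R * R => (\1_(band tau) v)%:E : \bar R).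
  by apply/measurable_EFinP; apply: measurable_indic; exact: measurable_band.
have mM : measurable_fun setT M.
  apply: (@measurable_int_param _ _ (fun z => (\1_(band tau) (spherical_coord z.1 z.2))%:E)) => //.
  exact: (measurableT_comp mb measurable_spherical_coord).
have M0 t : (0 <= M t)%E by apply: integral_ge0 => p _; rewrite lee_fin.
pose K t := (M t * (`|sin t| + `|cos t|)%:E)%E.
have mK : measurable_fun setT K.
  apply: emeasurable_funM => //; apply/measurable_EFinP; apply: measurable_funD.
    by apply: measurableT_comp => //; exact: measurable_sin.
  by apply: measurableT_comp => //; exact: measurable_cos.
have K0 t : (0 <= K t)%E by apply: mule_ge0; [exact: M0|rewrite lee_fin addr_ge0].
rewrite sphere_int_band -/M (_ : (\int[leb]_(t in _) _ = \int[leb]_(t in `]0%R, (pi / 2)%R]) K t)%E)//.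
have Mfull t : `|sin t * cos t| <= tau -> M t = (2 * pi)%:E.
  move=> h; rewrite /M (eq_integral (cst 1%E)); last first.
    move=> p _; rewrite indicE mem_set// /band/= mulrAC normrM.
    by rewrite (le_trans _ h)// ler_piMr// cos_max.
  rewrite integral_cst//= mul1e lebesgue_measure_itv/= lte_fin ifT; last lra.
  by rewrite sube0.
have dF (x : R) : is_derive x 1 (fun t : R => 2 * pi * (sin t - cos t)) (2 * pi * (sin x + cos x)).
  by apply: is_derive_eq; rewrite /GRing.scale/=; ring.
have cF : continuous (fun t : R => 2 * pi * (sin t + cos t)).
  move=> x; apply: cvgM; first exact: cvg_cst.
  by apply: cvgD; [exact: continuous_sin|exact: continuous_cos].
have Kfull x y : 0 <= x -> x <= y -> y <= pi / 2 ->
    (forall t, x < t <= y -> `|sin t * cos t| <= tau) ->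
    (\int[leb]_(t in `]x, y]) K t =
      (2 * pi * (sin y - cos y) - 2 * pi * (sin x - cos x))%:E)%E.
  move=> x0 xy y2 h; rewrite -(FTC2_is_derive dF cF xy).
  apply: eq_integral => t; rewrite inE/= in_itv/= => /[dup] /h ht /andP[t2 t3].
  rewrite /K Mfull// -EFinM; congr EFin.
  by rewrite !ger0_norm ?cos_ge0_pihalf ?sin_ge0_pi//; apply/andP; split; lra.
have ab : a < b by rewrite /b; lra.
rewrite (@integral_itv_split _ K 0 a (pi / 2))//; [|lra|lra].
rewrite (@integral_itv_split _ K a b (pi / 2))//; [|lra|rewrite /b; lra].
rewrite (Kfull 0 a)//; [|lra|lra|]; last first.
  move=> t /andP[h1 h2]; rewrite normrM ger0_norm; last by rewrite sin_ge0_pi//; lra.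
  rewrite (@le_trans _ _ (sin t))//.
    by rewrite ler_piMr ?cos_max// sin_ge0_pi//; lra.
  by rewrite -sa; apply: monos; lra.
rewrite (Kfull b (pi / 2))//; [|rewrite /b; lra|rewrite /b; lra|]; last first.
  move=> t /andP[h1 h2]; rewrite mulrC normrM ger0_norm; last by rewrite cos_ge0_pihalf//; lra.
  rewrite (@le_trans _ _ (cos t))//.
    by rewrite ler_piMr ?sin_max// cos_ge0_pihalf//; lra.
  by rewrite -sa sc; apply: monos; rewrite /b in h1; lra.
pose B (t : R) : R := 2 * tau * (ln (1 + sin t) - ln (1 - sin t) + ln (1 - cos t) - ln (1 + cos t)).
pose k (t : R) : R := 4 * tau * ((cos t)^-1 + (sin t)^-1).
have mid t : a <= t <= b -> [/\ tau <= sin t, tau <= cos t, sin t < 1 & cos t < 1].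
  move=> /andP[h1 h2]; have st : tau <= sin t by rewrite -sa; apply: monos; rewrite /b in h2; lra.
  have ct : tau <= cos t by rewrite -sa sc; apply: monos; rewrite /b in h2; lra.
  have := cos2Dsin2 t; split=> //; nra.
have DB (t : R) : a <= t <= b -> is_derive t 1 B (k t).
  move=> /mid[hs hc s1 c1]; apply: is_derive_log_slice => //.
    exact: lt_le_trans hs.
  exact: lt_le_trans hc.
have cB (t : R) : a <= t <= b -> {for t, continuous B}.
  move=> tab; apply: differentiable_continuous; apply/derivable1_diffP.
  by have [] := DB t tab.
have ck : {within `[a, b], continuous k}.
  apply: continuous_in_subspaceT => t; rewrite inE/= in_itv/= => /mid[hs hc _ _].
  apply: cvgM; first exact: cvg_cst.
  apply: cvgD; apply: cvgV; rewrite ?gt_eqF//; [lra|exact: continuous_cos|lra|exact: continuous_sin].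
have mk : measurable_fun `[a, b] k by exact: subspace_continuous_measurable_fun.
have mk' : measurable_fun `]a, b] (EFin \o k).
  apply/measurable_EFinP; apply: measurable_funS mk => //.
  by apply: subset_itvr; rewrite bnd_simp.
have midI : ((B b - B a)%:E <= \int[leb]_(t in `]a, b]) K t)%E.
  rewrite EFinB -(continuous_FTC2 ab ck); first last.
  - move=> t; rewrite in_itv/= => /andP[/ltW h1 /ltW h2].
    by rewrite derive1E; apply: derive_val; apply: DB; rewrite h1.
  - split.
    + by move=> t; rewrite in_itv/= => /andP[/ltW h1 /ltW h2]; have [] := DB t; rewrite ?h1.
    + by apply: cvg_at_right_filter; apply: cB; rewrite lexx ltW.
    + by apply: cvg_at_left_filter; apply: cB; rewrite lexx ltW.
  rewrite -(@integral_itv_obnd_cbnd _ _ (BRight b)); last exact: mk'.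
  apply: ge0_le_integral => //.
  - move=> t; rewrite /= in_itv/= => /andP[/ltW h1 h2].
    have [] := mid t; rewrite ?h1// => hs hc _ _; rewrite lee_fin /k.
    have tau0 := ltW t0.
    apply: mulr_ge0; first by apply: mulr_ge0.
    by apply: addr_ge0; rewrite invr_ge0; [exact: le_trans hc|exact: le_trans hs].
  - exact: measurable_funTS.
  move=> t; rewrite /= in_itv/= => /andP[/ltW h1 h2].
  have [] := mid t; rewrite ?h1// => hs hc _ _.
  exact: (slice_ge t0 w2 ww hs hc).
apply: (@le_trans _ _ ((2 * pi * (sin a - cos a) - 2 * pi * (sin 0 - cos 0))%:E +
   ((B b - B a)%:E + (2 * pi * (sin (pi / 2) - cos (pi / 2)) - 2 * pi * (sin b - cos b))%:E))%E).
  rewrite -!EFinD lee_fin /B sa sb ca cb sin0 cos0 sin_pihalf cos_pihalf; lra.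
by rewrite leeD2l// leeD2r.
Qed.

End Band.

Section AxialBand.
Context {R : realType}.
Local Notation leb := (@lebesgue_measure R).
Implicit Types n : R * R * R.

Lemma sphere_measureE (A : set (R * R * R)) : measurable A ->
  sphere_measure A = ((4 * pi)^-1%:E * sphere_int (fun v => (\1_A v)%:E))%E.
Proof.
move=> mA; apply: (congr1 (fun x : \bar R => (4 * pi)^-1%:E * x)%E).
rewrite /sphere_int.
(* The absolute value makes the integrand nonnegative at all angles, as [measurable_int_param]
   asks. *)
pose F (z : R * R) : \bar R := (\1_A (spherical_coord z.1 z.2) * `|sin z.1|)%:E.
have mb : measurable_fun setT (fun v : R * R * R => \1_A v : R) by exact: measurable_indic.
have mF : measurable_fun setT F.
  apply/measurable_EFinP; apply: measurable_funM.
    exact: (measurableT_comp mb measurable_spherical_coord).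
  apply: measurableT_comp => //; apply: (measurableT_comp measurable_sin); exact: measurable_fst.
have F0 z : (0 <= F z)%E by rewrite lee_fin mulr_ge0.
pose G t := (\int[leb]_(p in `]0%R, (2 * pi)%R]) F (t, p))%E.
have mG : measurable_fun setT G by exact: measurable_int_param.
have inner t : 0 <= sin t ->
    (\int[leb]_(p in `[0%R, (2 * pi)%R]) (\1_A (spherical_coord t p) * sin t)%:E = G t)%E.
  move=> st; rewrite -(@integral_itv_obnd_cbnd _ _ (BRight (2 * pi))).
    by apply: eq_integral => p _; rewrite /F/= ger0_norm.
  apply: measurable_funTS; apply/measurable_EFinP; apply: measurable_funM => //.
  apply: (measurableT_comp mb).
  apply: measurable_triple => //; apply: measurable_funM => //.
    exact: measurable_cos.
  exact: measurable_sin.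
transitivity (\int[leb]_(t in `[0%R, pi]) G t)%E.
  by apply: eq_integral => t; rewrite inE/= in_itv/= => tp; rewrite inner// sin_ge0_pi.
rewrite -(@integral_itv_obnd_cbnd _ _ (BRight pi)); last exact: measurable_funTS.
apply: eq_integral => t; rewrite inE/= in_itv/= => /andP[t0 tp].
have st : 0 <= sin t by rewrite sin_ge0_pi// (ltW t0).
by apply: eq_integral => p _; rewrite /F/= ger0_norm// EFinM.
Qed.

Lemma measurable_axial n : measurable_fun setT (axial n).
Proof.
have [m1 m2 m3] := @measurable_coord R.
have md : measurable_fun setT (fun r => 2 * dot3 r n).
  apply: measurable_funM => //; apply: measurable_funD; last exact: measurable_funM.
  by apply: measurable_funD; apply: measurable_funM.
by apply: measurable_triple; apply: measurable_funD => //; apply: measurable_funM.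
Qed.

(** The factor 1 / sqrt 2 of the axial law times the area bound of [band_int_ge] over 4 pi. *)
Definition band_bound (tau w : R) : R :=
  (Num.sqrt 2)^-1 * (tau + (1 - w) +
    tau / pi * (ln (1 + w) - ln (1 - w) + ln (1 - tau) - ln (1 + tau))).

Lemma axial_band_ge n tau w : unit_vector n ->
  0 < tau -> tau <= 1 / 2 -> 0 <= w -> w ^+ 2 = 1 - tau ^+ 2 ->
  ((band_bound tau w)%:E <= sphere_measure (axial n @^-1` band tau))%E.
Proof.
move=> n1 t0 t1 w0 ww; have mb := @measurable_band R tau.
have mpre : measurable (axial n @^-1` band tau).
  by rewrite -[X in measurable X]setTI; exact: measurable_axial.
rewrite sphere_measureE//.
have p0 := pi_gt0 R.
have mi : measurable_fun setT (fun v : R * R * R => (\1_(band tau) v)%:E : \bar R).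
  by apply/measurable_EFinP; exact: measurable_indic.
have i0 v : (0 <= (\1_(band tau) v)%:E :> \bar R)%E by rewrite lee_fin.
have ev : even3 (fun v : R * R * R => (\1_(band tau) v)%:E : \bar R).
  move=> x y z; congr EFin; rewrite !indicE.
  have E v : (v \in band tau) = (`|v.1.1 * v.2| <= tau).
    by apply/idP/idP => [/set_mem//|h]; exact/mem_set.
  by rewrite !E/= mulrNN.
have := axial_law_ge n1 mi i0 ev.
have := band_int_ge t0 t1 w0 ww.
set X := (4 * _) => h1 h2.
have -> : band_bound tau w = (4 * pi)^-1 * ((Num.sqrt 2)^-1 * X).
  have pn0 : (pi : R) != 0 by rewrite gt_eqF.
  have sn0 : Num.sqrt 2 != 0 :> R by rewrite gt_eqF// sqrtr_gt0.
  rewrite /band_bound /X; clear - pn0 sn0.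
  move: (Num.sqrt 2 : R) (pi : R) (ln (1 + w) - ln (1 - w) + ln (1 - tau) - ln (1 + tau)) pn0 sn0 => s p L pn0 sn0.
  by field; apply/andP; split.
rewrite EFinM; apply: lee_wpmul2l; first by rewrite lee_fin invr_ge0 mulr_ge0// ltW.
by apply: le_trans h2; rewrite EFinM; apply: lee_wpmul2l.
Qed.

End AxialBand.

(** * Numerical lower bounds for the band probabilities *)

Section BandNumerics.
Context {R : realType}.

(** The left side is 2 (z - 1) / (z + 1), the first Pade approximant of ln at 1; the difference has
    derivative (z - 1) ^ 2 / (z (z + 1) ^ 2). *)
Lemma ln_ge_pade (z : R) : 1 <= z -> 2 - 4 / (z + 1) <= ln z.
Proof.
rewrite le_eqVlt => /predU1P[<-|z1]; first by rewrite ln1 (_ : 1 + 1 = 2)//; lra.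
pose g (x : R) := ln x + 4 / (x + 1).
have Dg (x : R) : 0 < x -> is_derive x 1 g (x^-1 - 4 / (x + 1) ^+ 2).
  move=> x0; have D1 := is_derive1_ln x0.
  have x1 : x + 1 != 0 by rewrite gt_eqF//; lra.
  have D2 : is_derive x 1 (fun x : R => x + 1) 1 by apply: is_derive_eq; ring.
  have D3 : is_derive x 1 (fun y : R => (y + 1)^-1) (- (x + 1) ^- 2 *: (1 : R)).
    exact: (is_deriveV (f := fun y : R => y + 1)).
  apply: is_derive_eq; rewrite /GRing.scale/=; field.
  by rewrite x1 gt_eqF.
have cg : {within `[1, z], continuous g}.
  apply: continuous_in_subspaceT => x; rewrite inE/= in_itv/= => /andP[x1 _].
  apply: differentiable_continuous; apply/derivable1_diffP.
  by have [] := Dg x (lt_le_trans ltr01 x1).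
have Dg' (x : R) : x \in `]1, z[ -> is_derive x 1 g (x^-1 - 4 / (x + 1) ^+ 2).
  by rewrite in_itv/= => /andP[x1 _]; apply: Dg; apply: lt_trans x1.
have [c] := MVT z1 Dg' cg.
rewrite in_itv/= => /andP[c1 _]; rewrite /g ln1 => E.
have e2 : 4 / (1 + 1) = 2 :> R by rewrite (_ : 1 + 1 = 2)//; lra.
suff : 0 <= (c^-1 - 4 / (c + 1) ^+ 2) * (z - 1) by rewrite -E e2; lra.
rewrite mulr_ge0//; last lra.
have -> : c^-1 - 4 / (c + 1) ^+ 2 = (c - 1) ^+ 2 / (c * (c + 1) ^+ 2).
  by field; rewrite !gt_eqF//; lra.
by rewrite divr_ge0 ?sqr_ge0// mulr_ge0 ?sqr_ge0//; lra.
Qed.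

(** 2 is the telescoping product of (n + 1) / n for n from 8 to 15, and near 1 the Pade bound, here
    2 / (2 n + 1), is sharp. *)
Lemma ln2_ge : 6926 / 10000 <= ln 2 :> R.
Proof.
have h (p q : R) : 0 < q -> q <= p -> 2 * (p - q) <= (ln p - ln q) * (p + q).
  move=> q0 qp; have p0 : 0 < p by lra.
  rewrite -ler_pdivrMr; last lra.
  rewrite -ln_div//; apply: le_trans (ln_ge_pade _); last by rewrite ler_pdivlMr// mul1r.
  by rewrite le_eqVlt; apply/orP; left; apply/eqP; field; rewrite !gt_eqF//; lra.
have -> : ln 2 = (ln 16 - ln 15) + (ln 15 - ln 14) + (ln 14 - ln 13) + (ln 13 - ln 12)
   + (ln 12 - ln 11) + (ln 11 - ln 10) + (ln 10 - ln 9) + (ln 9 - ln 8) :> R.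
  have -> : 16 = 2 * 8 :> R by lra.
  by rewrite lnM ?posrE//; ring.
have {}h (n : nat) : (0 < n)%N -> 2 <= (ln n.+1%:R - ln n%:R) * (n.+1 + n)%N%:R :> R.
  move=> n0; have := h n.+1%:R n%:R; rewrite ltr0n ler_nat natrD leqnSn => /(_ n0 isT).
  by rewrite -natrB ?leqnSn// subSn// subnn mulr1.
have h1 := h 15 isT; have h2 := h 14 isT; have h3 := h 13 isT; have h4 := h 12 isT.
have h5 := h 11 isT; have h6 := h 10 isT; have h7 := h 9 isT; have h8 := h 8 isT.
clear h.
lra.
Qed.

Definition band_prob (tau q : R) := forall n, unit_vector n ->
  (q%:E <= sphere_measure (axial n @^-1` band tau))%E.

Lemma sqrt_compl_bound (tau w : R) : 0 < tau -> tau <= 1 / 2 -> 0 <= w ->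
  w ^+ 2 = 1 - tau ^+ 2 -> tau ^+ 2 / 2 + tau ^+ 4 / 8 <= 1 - w.
Proof.
move=> t0 t1 w0 ww.
have x0 : 0 <= tau ^+ 2 by exact: sqr_ge0.
have x1 : tau ^+ 2 <= 1 / 4 by clear - t0 t1; nra.
have -> : tau ^+ 4 = (tau ^+ 2) ^+ 2 by rewrite -exprM.
set x := tau ^+ 2 in ww x0 x1 *.
have y0 : 0 <= 1 - x / 2 - x ^+ 2 / 8 by clear - x0 x1; nra.
have : w <= 1 - x / 2 - x ^+ 2 / 8.
  rewrite -(ler_pXn2r (n:=2)) ?nnegrE// ww -subr_ge0.
  have -> : (1 - x / 2 - x ^+ 2 / 8) ^+ 2 - (1 - x) = x ^+ 3 / 8 + (x ^+ 2) ^+ 2 / 64 by field.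
  have c3 : 0 <= x ^+ 3 := exprn_ge0 3 x0.
  have c4 : 0 <= (x ^+ 2) ^+ 2 := sqr_ge0 _.
  by clear - c3 c4; lra.
by clear; lra.
Qed.

(** As (1 - w) (1 + w) = tau ^ 2, the logarithms of [band_bound] combine to ln ((1 + w) ^ 2 (1 -
    tau) / (tau ^ 2 (1 + tau))). The hypothesis on [z] is squared so that 2 ^ (k / 2) stays rational
    for odd [k]; thus [z] can be kept in [1, sqrt 2], where the Pade bound is sharp. *)
Lemma band_prob_ge (l p s tau v z c q : R) (k : nat) :
  l <= ln 2 -> p <= pi^-1 -> s <= (Num.sqrt 2)^-1 -> 0 <= l -> 0 <= p -> 0 <= s ->
  0 < tau -> tau <= 1 / 2 -> 0 <= v -> v ^+ 2 <= 1 - tau ^+ 2 -> 1 <= z ->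
  2 ^+ k * z ^+ 2 * (tau ^+ 2) ^+ 2 * (1 + tau) ^+ 2 <=
    ((1 + v) ^+ 2) ^+ 2 * (1 - tau) ^+ 2 ->
  4 <= (2 - c) * (z + 1) ->
  0 <= c ->
  q <= s * (tau + (tau ^+ 2 / 2 + tau ^+ 4 / 8) + tau * p * (k%:R / 2 * l + c)) ->
  band_prob tau q.
Proof.
move=> ll pp ss l0 pl0 s0 t0 t1 v0 vt z1 yz cz c0 qle n n1.
pose w := Num.sqrt (1 - tau ^+ 2).
have ww : w ^+ 2 = 1 - tau ^+ 2 by rewrite sqr_sqrtr//; clear - t0 t1; nra.
have w0 : 0 <= w by exact: sqrtr_ge0.
apply: le_trans (axial_band_ge n1 t0 t1 w0 ww); rewrite lee_fin.
have vw : v <= w by rewrite -(ler_pXn2r (n:=2)) ?nnegrE// ww.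
have w2 := sqrt_compl_bound t0 t1 w0 ww.
have w1 : w < 1.
  have : 0 < tau ^+ 2 / 2 + tau ^+ 4 / 8 by rewrite addr_gt0 ?divr_gt0 ?exprn_gt0.
  by clear - w2; lra.
set L := ln (1 + w) - ln (1 - w) + ln (1 - tau) - ln (1 + tau).
have Lge : k%:R / 2 * l + c <= L.
  have p1w : 0 < 1 + w by clear - w0; lra.
  have p1v : 0 <= 1 + v by clear - v0; lra.
  have pv1w : 1 + v <= 1 + w by rewrite lerD2l.
  have m1w : 0 < 1 - w by rewrite subr_gt0.
  have m1t : 0 < 1 - tau by clear - t1; lra.
  have p1t : 0 < 1 + tau by clear - t0; lra.
  have z0 : 0 < z by exact: lt_le_trans z1.
  have lt : ln (1 - w) = 2 * ln tau - ln (1 + w).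
    apply/eqP; rewrite eq_sym subr_eq -lnM ?posrE//.
    have -> : (1 - w) * (1 + w) = tau ^+ 2.
      have -> : (1 - w) * (1 + w) = 1 - w ^+ 2 by ring.
      by rewrite ww; ring.
    by rewrite lnXn// mulr_natl.
  have : ln (2 ^+ k * z ^+ 2 * (tau ^+ 2) ^+ 2 * (1 + tau) ^+ 2) <=
      ln (((1 + w) ^+ 2) ^+ 2 * (1 - tau) ^+ 2).
    rewrite ler_ln ?posrE; first last.
    - by rewrite mulr_gt0 ?exprn_gt0.
    - by rewrite !mulr_gt0 ?exprn_gt0.
    apply: (le_trans yz); apply: ler_wpM2r; first exact: sqr_ge0.
    have h1 : (1 + v) ^+ 2 <= (1 + w) ^+ 2 by rewrite ler_pXn2r ?nnegrE// ltW.
    by rewrite ler_pXn2r ?nnegrE ?sqr_ge0.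
  rewrite !lnM ?posrE ?mulr_gt0 ?exprn_gt0// !lnXn ?exprn_gt0//.
  have lz := ln_ge_pade z1.
  have cz' : c <= 2 - 4 / (z + 1).
    rewrite lerBrDr -lerBrDl ler_pdivrMr//; last exact: addr_gt0.
  have l3 : k%:R * l <= k%:R * ln 2 :> R by apply: ler_wpM2l.
  rewrite -[ln 2 *+ k]mulr_natl /L lt.
  clear - lz cz' l3; lra.
have L0 : 0 <= k%:R / 2 * l + c.
  by apply: addr_ge0 => //; apply: mulr_ge0 => //; exact: divr_ge0.
have t2 : 0 <= tau ^+ 2 / 2 + tau ^+ 4 / 8.
  by rewrite addr_ge0 ?divr_ge0 ?exprn_ge0// ltW.
apply: (le_trans qle); apply: ler_pM => //.
  by rewrite !addr_ge0 ?mulr_ge0// ltW.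
rewrite -/L; apply: lerD; first by clear - w2; lra.
apply: ler_pM => //; first by rewrite mulr_ge0// ltW.
by apply: ler_wpM2l => //; exact: ltW.
Qed.

Lemma sqrt2V_ge : 7071 / 10000 <= (Num.sqrt 2)^-1 :> R.
Proof.
have s20 : 0 < Num.sqrt 2 :> R by rewrite sqrtr_gt0.
have sn0 : Num.sqrt 2 != 0 :> R by rewrite gt_eqF.
rewrite -(ler_pM2r s20) (mulVf sn0).
have h : Num.sqrt 2 ^+ 2 = 2 :> R by rewrite sqr_sqrtr.
nra.
Qed.

Lemma piV_ge : 1000 / 3144 <= pi^-1 :> R.
Proof.
have p0 := pi_gt0 R; have pn0 : (pi : R) != 0 by rewrite gt_eqF.
rewrite -(ler_pM2r p0) (mulVf pn0).
have := @pi_le R; lra.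
Qed.

(* [v] bounds [sqrt (1 - tau ^ 2)] from below, and [2 ^ (k / 2) * z] bounds from below the
   argument of the logarithm in [band_bound]; [c] is a lower bound of [ln z] given by
   [ln_ge_pade]. *)
Lemma band_prob_num (tau v z c q : R) (k : nat) :
  0 < tau -> tau <= 1 / 2 -> 0 <= v -> v ^+ 2 <= 1 - tau ^+ 2 -> 1 <= z ->
  2 ^+ k * z ^+ 2 * (tau ^+ 2) ^+ 2 * (1 + tau) ^+ 2 <=
    ((1 + v) ^+ 2) ^+ 2 * (1 - tau) ^+ 2 ->
  4 <= (2 - c) * (z + 1) ->
  0 <= c ->
  q <= 7071 / 10000 * (tau + (tau ^+ 2 / 2 + tau ^+ 4 / 8) +
         tau * (1000 / 3144) * (k%:R / 2 * (6926 / 10000) + c)) ->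
  band_prob tau q.
Proof.
by apply: (band_prob_ge ln2_ge piV_ge sqrt2V_ge); lra.
Qed.

(** Here and below the widths are those of [potential_step_le] rounded down to a multiple of 1 /
    1000: from e (2 - e) <= s, the width x / (8 s) ensures sqrt (8 e') <= x, and sqrt (theta / 8) /
    s ensures e' <= theta. *)
Lemma band_031 : band_prob (31 / 1000) (79 / 1000).
Proof. by apply: (@band_prob_num (31 / 1000) (999 / 1000) (1349 / 1000) (2971 / 10000) _ 23); lra. Qed.

Lemma band_048 : band_prob (48 / 1000) (113 / 1000).
Proof. by apply: (@band_prob_num (48 / 1000) (998 / 1000) (1086 / 1000) (824 / 10000) _ 21); lra. Qed.

Lemma band_061 : band_prob (61 / 1000) (138 / 1000).
Proof. by apply: (@band_prob_num (61 / 1000) (998 / 1000) (1311 / 1000) (2691 / 10000) _ 19); lra. Qed.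

Lemma band_062 : band_prob (62 / 1000) (140 / 1000).
Proof. by apply: (@band_prob_num (62 / 1000) (998 / 1000) (1266 / 1000) (2347 / 10000) _ 19); lra. Qed.

Lemma band_077 : band_prob (77 / 1000) (166 / 1000).
Proof. by apply: (@band_prob_num (77 / 1000) (997 / 1000) (1125 / 1000) (1176 / 10000) _ 18); lra. Qed.

Lemma band_087 : band_prob (87 / 1000) (183 / 1000).
Proof. by apply: (@band_prob_num (87 / 1000) (996 / 1000) (1221 / 1000) (1990 / 10000) _ 17); lra. Qed.

Lemma band_095 : band_prob (95 / 1000) (196 / 1000).
Proof. by apply: (@band_prob_num (95 / 1000) (995 / 1000) (1006 / 1000) (59 / 10000) _ 17); lra. Qed.

Lemma band_097 : band_prob (97 / 1000) (199 / 1000).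
Proof. by apply: (@band_prob_num (97 / 1000) (995 / 1000) (1360 / 1000) (3050 / 10000) _ 16); lra. Qed.

Lemma band_103 : band_prob (103 / 1000) (208 / 1000).
Proof. by apply: (@band_prob_num (103 / 1000) (994 / 1000) (1190 / 1000) (1735 / 10000) _ 16); lra. Qed.

Lemma band_110 : band_prob (110 / 1000) (219 / 1000).
Proof. by apply: (@band_prob_num (110 / 1000) (993 / 1000) (1028 / 1000) (276 / 10000) _ 16); lra. Qed.

Lemma band_116 : band_prob (116 / 1000) (228 / 1000).
Proof. by apply: (@band_prob_num (116 / 1000) (993 / 1000) (1291 / 1000) (2540 / 10000) _ 15); lra. Qed.

Lemma band_122 : band_prob (122 / 1000) (237 / 1000).
Proof. by apply: (@band_prob_num (122 / 1000) (992 / 1000) (1152 / 1000) (1412 / 10000) _ 15); lra. Qed.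

Lemma band_134 : band_prob (134 / 1000) (255 / 1000).
Proof. by apply: (@band_prob_num (134 / 1000) (990 / 1000) (1315 / 1000) (2721 / 10000) _ 14); lra. Qed.

Lemma band_151 : band_prob (151 / 1000) (279 / 1000).
Proof. by apply: (@band_prob_num (151 / 1000) (988 / 1000) (1412 / 1000) (3416 / 10000) _ 13); lra. Qed.

Lemma band_171 : band_prob (171 / 1000) (306 / 1000).
Proof. by apply: (@band_prob_num (171 / 1000) (985 / 1000) (1053 / 1000) (516 / 10000) _ 13); lra. Qed.

Lemma band_181 : band_prob (181 / 1000) (319 / 1000).
Proof. by apply: (@band_prob_num (181 / 1000) (983 / 1000) (1300 / 1000) (2608 / 10000) _ 12); lra. Qed.

Lemma band_191 : band_prob (191 / 1000) (332 / 1000).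
Proof. by apply: (@band_prob_num (191 / 1000) (981 / 1000) (1141 / 1000) (1317 / 10000) _ 12); lra. Qed.

Lemma band_193 : band_prob (193 / 1000) (334 / 1000).
Proof. by apply: (@band_prob_num (193 / 1000) (981 / 1000) (1113 / 1000) (1069 / 10000) _ 12); lra. Qed.

Lemma band_203 : band_prob (203 / 1000) (347 / 1000).
Proof. by apply: (@band_prob_num (203 / 1000) (979 / 1000) (1391 / 1000) (3270 / 10000) _ 11); lra. Qed.

Lemma band_215 : band_prob (215 / 1000) (361 / 1000).
Proof. by apply: (@band_prob_num (215 / 1000) (976 / 1000) (1205 / 1000) (1859 / 10000) _ 11); lra. Qed.

Lemma band_232 : band_prob (232 / 1000) (381 / 1000).
Proof. by apply: (@band_prob_num (232 / 1000) (972 / 1000) (1407 / 1000) (3381 / 10000) _ 10); lra. Qed.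

Lemma band_263 : band_prob (263 / 1000) (416 / 1000).
Proof. by apply: (@band_prob_num (263 / 1000) (964 / 1000) (1016 / 1000) (158 / 10000) _ 10); lra. Qed.

Lemma band_288 : band_prob (288 / 1000) (443 / 1000).
Proof. by apply: (@band_prob_num (288 / 1000) (957 / 1000) (1128 / 1000) (1203 / 10000) _ 9); lra. Qed.

Lemma band_325 : band_prob (325 / 1000) (480 / 1000).
Proof. by apply: (@band_prob_num (325 / 1000) (945 / 1000) (1140 / 1000) (1308 / 10000) _ 8); lra. Qed.

Lemma band_362 : band_prob (362 / 1000) (514 / 1000).
Proof. by apply: (@band_prob_num (362 / 1000) (932 / 1000) (1179 / 1000) (1642 / 10000) _ 7); lra. Qed.

Lemma band_379 : band_prob (379 / 1000) (529 / 1000).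
Proof. by apply: (@band_prob_num (379 / 1000) (925 / 1000) (1026 / 1000) (256 / 10000) _ 7); lra. Qed.

Lemma band_385 : band_prob (385 / 1000) (534 / 1000).
Proof. by apply: (@band_prob_num (385 / 1000) (922 / 1000) (1383 / 1000) (3214 / 10000) _ 6); lra. Qed.

Lemma band_408 : band_prob (408 / 1000) (553 / 1000).
Proof. by apply: (@band_prob_num (408 / 1000) (912 / 1000) (1154 / 1000) (1429 / 10000) _ 6); lra. Qed.

End BandNumerics.

(** * Unit quaternions *)

Section Quaternions.
Context {R : realType}.
Implicit Types (q p : R * R * R * R) (r : R * R * R).

(* [(((a, b), c), d)] encodes [a + i (b X + c Y + d Z)]. *)
Definition quat_mx q : 'M[R[i]]_2 :=
  mx2 (q.1.1.1 +i* q.2) (q.1.2 +i* q.1.1.2) (- q.1.2 +i* q.1.1.2) (q.1.1.1 +i* (- q.2)).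

(** The cross product carries a minus sign because (i X) (i Y) = - i Z. *)
Definition quat_mul p q : R * R * R * R :=
  (p.1.1.1 * q.1.1.1 - p.1.1.2 * q.1.1.2 - p.1.2 * q.1.2 - p.2 * q.2,
   p.1.1.1 * q.1.1.2 + p.1.1.2 * q.1.1.1 - (p.1.2 * q.2 - p.2 * q.1.2),
   p.1.1.1 * q.1.2 + p.1.2 * q.1.1.1 - (p.2 * q.1.1.2 - p.1.1.2 * q.2),
   p.1.1.1 * q.2 + p.2 * q.1.1.1 - (p.1.1.2 * q.1.2 - p.1.2 * q.1.1.2)).

Definition quat_norm q : R := q.1.1.1 ^+ 2 + q.1.1.2 ^+ 2 + q.1.2 ^+ 2 + q.2 ^+ 2.

Definition quat_f q : R * R * R * R :=
  quat_mul (quat_mul (quat_mul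
    (q.1.1.1, q.1.1.2, - q.1.2, - q.2) (q.1.1.1, - q.1.1.2, q.1.2, - q.2))
    (q.1.1.1, - q.1.1.2, - q.1.2, q.2)) q.

(** The squared length [rr] is kept, so that [gmap_quat] is an identity for all [r]. *)
Definition quat_g r q : R * R * R * R :=
  let rr := r.1.1 ^+ 2 + r.1.2 ^+ 2 + r.2 ^+ 2 in
  let rv := 2 * (r.1.1 * q.1.1.2 + r.1.2 * q.1.2 + r.2 * q.2) in
  (rr * q.1.1.1, rv * r.1.1 - rr * q.1.1.2, rv * r.1.2 - rr * q.1.2, rv * r.2 - rr * q.2).

Definition quat_step q r := quat_f (quat_g r q).

Lemma mulmx_mx2 (a b c d a' b' c' d' : R[i]) :
  mx2 a b c d *m mx2 a' b' c' d' =
  mx2 (a * a' + b * c') (a * b' + b * d') (c * a' + d * c') (c * b' + d * d').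
Proof.
apply/matrixP => i j; rewrite !mxE !big_ord_recl big_ord0 addr0 !mxE/=.
by case: i => [[|[|//]] ?]; case: j => [[|[|//]] ?].
Qed.

Lemma complex_eq (a b c d : R) : a = c -> b = d -> a +i* b = c +i* d.
Proof. by move=> -> ->. Qed.

Ltac quat_ring := rewrite /quat_mx ?mulmx_mx2 /=; congr mx2; apply: complex_eq => /=; ring.

Lemma quat_mx_mul p q : quat_mx (quat_mul p q) = quat_mx p *m quat_mx q.
Proof. by case: p => [[[a b] c] d]; case: q => [[[a' b'] c'] d']; quat_ring. Qed.

Lemma pauliX_conj q : pauliX *m quat_mx q *m pauliX =
  quat_mx (q.1.1.1, q.1.1.2, - q.1.2, - q.2).
Proof. by case: q => [[[a b] c] d]; rewrite /pauliX; quat_ring. Qed.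

Lemma pauliY_conj q : pauliY *m quat_mx q *m pauliY =
  quat_mx (q.1.1.1, - q.1.1.2, q.1.2, - q.2).
Proof. by case: q => [[[a b] c] d]; rewrite /pauliY; quat_ring. Qed.

Lemma pauliZ_conj q : pauliZ *m quat_mx q *m pauliZ =
  quat_mx (q.1.1.1, - q.1.1.2, - q.1.2, q.2).
Proof. by case: q => [[[a b] c] d]; rewrite /pauliZ; quat_ring. Qed.

Lemma fmap_quat q : Defs.fmap (quat_mx q) = quat_mx (quat_f q).
Proof.
rewrite /Defs.fmap /quat_f !quat_mx_mul -pauliX_conj -pauliY_conj -pauliZ_conj.
move: (quat_mx q) (@pauliX R) (@pauliY R) (@pauliZ R) => W X Y Z.
have E (A B : 'M[R[i]]_2) : B *m (A *m W *m A) = B *m A *m W *m A by rewrite !mulmxA.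
by rewrite (E Y) (E Z).
Qed.

Lemma dot_sigmaE r : dot_sigma r =
  mx2 (r.2%:C) (r.1.1 -i* r.1.2) (r.1.1 +i* r.1.2) (- r.2)%:C.
Proof.
case: r => [[x y] z]; rewrite /dot_sigma /pauliX /pauliY /pauliZ; apply/matrixP => i j.
rewrite !mxE; case: i => [[|[|//]] ?]; case: j => [[|[|//]] ?];
  by apply: complex_eq => /=; ring.
Qed.

Lemma dot_sigma_adj r : (dot_sigma r) ^t* = dot_sigma r.
Proof.
rewrite dot_sigmaE; apply/matrixP => i j; rewrite !mxE.
case: i => [[|[|//]] ?]; case: j => [[|[|//]] ?]; by apply: complex_eq => /=; ring.
Qed.

Lemma gmap_quat r q : gmap r (quat_mx q) = quat_mx (quat_g r q).
Proof.
rewrite /gmap dot_sigma_adj dot_sigmaE.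
by case: r => [[x y] z]; case: q => [[[a b] c] d]; quat_ring.
Qed.

Lemma quat_norm_mul p q : quat_norm (quat_mul p q) = quat_norm p * quat_norm q.
Proof. by rewrite /quat_norm/=; ring. Qed.

Lemma quat_norm_f q : quat_norm q = 1 -> quat_norm (quat_f q) = 1.
Proof.
move=> q1; rewrite /quat_f !quat_norm_mul q1.
by rewrite {1 2 3}/quat_norm/= !sqrrN -/(quat_norm q) q1 !mulr1.
Qed.

Lemma quat_norm_g q r : unit_vector r -> quat_norm q = 1 -> quat_norm (quat_g r q) = 1.
Proof.
rewrite /unit_vector => r1; rewrite /quat_norm /quat_g r1/= !mul1r => q1.
case: r r1 => [[x y] z]/=; case: q q1 => [[[a b] c] d]/= q1 r1.
set s := x * b + y * c + z * d.
transitivity (a ^+ 2 + b ^+ 2 + c ^+ 2 + d ^+ 2 + 4 * s ^+ 2 * ((x ^+ 2 + y ^+ 2 + z ^+ 2) - 1)).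
  by rewrite /s; ring.
by rewrite r1 q1 subrr mulr0 addr0.
Qed.

Definition infid q : R := 1 - q.1.1.1.

Lemma infid_f q : quat_norm q = 1 -> infid (quat_f q) = 8 * (q.1.1.2 * q.2) ^+ 2.
Proof.
case: q => [[[a b] c] d]; rewrite /quat_norm/= => q1.
(* The real part is a polynomial in a ^ 2; eliminating it by the unit norm leaves (1 - 2 d ^ 2) ^ 2
   + 4 d ^ 2 (1 - 2 b ^ 2 - d ^ 2) = 1 - 8 b ^ 2 d ^ 2. *)
have -> : infid (quat_f (a, b, c, d)) = 1 - ((a ^+ 2 + b ^+ 2 + c ^+ 2 - d ^+ 2) ^+ 2 +
   4 * d ^+ 2 * (a ^+ 2 + c ^+ 2 - b ^+ 2)).
  by rewrite /infid /quat_f/=; ring.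
have -> : a ^+ 2 = 1 - b ^+ 2 - c ^+ 2 - d ^+ 2 by rewrite -q1; ring.
ring.
Qed.

Lemma infid_bounds q : quat_norm q = 1 -> 0 <= infid q <= 2.
Proof.
case: q => [[[a b] c] d]; rewrite /quat_norm /infid/= => q1.
have : a ^+ 2 <= 1 by have := sqr_ge0 b; have := sqr_ge0 c; have := sqr_ge0 d; lra.
by move=> a1; apply/andP; split; nra.
Qed.

Lemma infid_step q n r : quat_norm q = 1 -> unit_vector r ->
  (exists rho : R, [/\ rho ^+ 2 = infid q * (2 - infid q), q.1.1.2 = rho * n.1.1,
     q.1.2 = rho * n.1.2 & q.2 = rho * n.2]) ->
  infid (quat_step q r) =
  8 * (infid q * (2 - infid q)) ^+ 2 * ((axial n r).1.1 * (axial n r).2) ^+ 2.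
Proof.
move=> q1 r1 [rho [rE qb qc qd]].
rewrite /quat_step infid_f ?quat_norm_g// -rE /quat_g r1 /axial /lin3 /dot3/= qb qc qd.
by ring.
Qed.

(** [rho] is the length of the vector part, as 1 - a ^ 2 = e (2 - e). For U = +-1 there is no
    direction and the pole is chosen. *)
Lemma vec_direction q : quat_norm q = 1 -> exists2 n : R * R * R, unit_vector n &
  exists rho : R, [/\ rho ^+ 2 = infid q * (2 - infid q), q.1.1.2 = rho * n.1.1,
     q.1.2 = rho * n.1.2 & q.2 = rho * n.2].
Proof.
case: q => [[[a b] c] d]; rewrite /quat_norm /infid/= => q1.
have E : (1 - a) * (2 - (1 - a)) = b ^+ 2 + c ^+ 2 + d ^+ 2.
  by transitivity (1 - a ^+ 2); [ring|rewrite -q1; ring].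
have s0 : 0 <= b ^+ 2 + c ^+ 2 + d ^+ 2 by rewrite !addr_ge0 ?sqr_ge0.
pose rho := Num.sqrt (b ^+ 2 + c ^+ 2 + d ^+ 2).
have r2 : rho ^+ 2 = b ^+ 2 + c ^+ 2 + d ^+ 2 by rewrite sqr_sqrtr.
have [r0|r0] := eqVneq rho 0.
  exists (0, 0, 1); first by rewrite /unit_vector/=; ring.
  exists 0; rewrite E -r2 r0 expr0n/= !mul0r; split=> //.
  - by move: r2; rewrite r0 expr0n/=; have := sqr_ge0 b; have := sqr_ge0 c; have := sqr_ge0 d; nra.
  - by move: r2; rewrite r0 expr0n/=; have := sqr_ge0 b; have := sqr_ge0 c; have := sqr_ge0 d; nra.
  - by move: r2; rewrite r0 expr0n/=; have := sqr_ge0 b; have := sqr_ge0 c; have := sqr_ge0 d; nra.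
exists (b / rho, c / rho, d / rho).
  by rewrite /unit_vector/= !expr_div_n -!mulrDl r2 divff// -r2 expf_neq0.
by exists rho => /=; rewrite E r2; split=> //; field.
Qed.

Lemma quat_mx_adj q : (quat_mx q) ^t* = quat_mx (q.1.1.1, - q.1.1.2, - q.1.2, - q.2).
Proof.
apply/matrixP => i j; rewrite !mxE.
by case: i => [[|[|//]] ?]; case: j => [[|[|//]] ?]; apply: complex_eq => /=; ring.
Qed.

(** With determinant 1 the inverse is the adjugate, and by unitarity it is the adjoint; comparing
    entries pairs x with w and y with z. *)
Lemma SU2_quat (U : 'M[R[i]]_2) : inSU2 U -> exists2 q, quat_norm q = 1 & U = quat_mx q.
Proof.
move=> [/unitarymxP UU dU].
pose x := U 0 0; pose y := U 0 1; pose z := U 1 0; pose w := U 1 1.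
have UE : U = mx2 x y z w.
  apply/matrixP => i j; rewrite !mxE.
  by case: i => [[|[|//]] hi]; case: j => [[|[|//]] hj] /=; congr (U _ _); apply/val_inj.
have d1 : x * w - y * z = 1.
  rewrite -dU [in RHS]UE (expand_det_row _ 0) !big_ord_recl big_ord0 /cofactor !det_mx11 !mxE/=.
  by rewrite expr0 expr1; ring.
have BU : mx2 w (- y) (- z) x *m U = 1%:M.
  rewrite UE mulmx_mx2; apply/matrixP => i j; rewrite !mxE.
  by case: i => [[|[|//]] hi]; case: j => [[|[|//]] hj] /=; rewrite -?d1; ring.
have adjE : U ^t* = mx2 w (- y) (- z) x.
  by rewrite -[LHS]mul1mx -BU -mulmxA UU mulmx1.
have e1 : conjc x = w.
  by have := congr1 (fun M : 'M[R[i]]_2 => M 0 0) adjE; rewrite !mxE.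
have e2 : conjc y = - z.
  by have := congr1 (fun M : 'M[R[i]]_2 => M 1 0) adjE; rewrite !mxE.
clear adjE BU; clearbody x y z w; case: x y e1 e2 d1 UE => [a d] [c b] <- e2.
have -> : z = - c +i* b by rewrite -[z]opprK -e2; apply: complex_eq => //=; rewrite opprK.
move=> d1 UE.
exists (a, b, c, d); last by rewrite UE.
have := congr1 (@complex.Re R) d1; rewrite /quat_norm /=.
move=> <-; ring.
Qed.

Lemma hsnorm_quat q : hsnorm (quat_mx q - 1%:M) ^+ 2 =
  ((q.1.1.1 - 1) ^+ 2 + q.1.1.2 ^+ 2 + q.1.2 ^+ 2 + q.2 ^+ 2) / 2.
Proof.
case: q => [[[a b] c] d].
have -> : quat_mx (a, b, c, d) - 1%:M = quat_mx (a - 1, b, c, d).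
  apply/matrixP => i j; rewrite !mxE.
  by case: i => [[|[|//]] ?]; case: j => [[|[|//]] ?]; apply: complex_eq => /=; ring.
rewrite /hsnorm quat_mx_adj -quat_mx_mul exprMn sqr_sqrtr.
  by rewrite /mxtrace !big_ord_recl big_ord0 !mxE/=; field.
rewrite /mxtrace !big_ord_recl big_ord0 !mxE/=.
set X := (X in 0 <= X).
have -> : X = 2 * ((a - 1) ^+ 2 + b ^+ 2 + c ^+ 2 + d ^+ 2) by rewrite /X; ring.
by rewrite mulr_ge0 ?addr_ge0 ?sqr_ge0.
Qed.

End Quaternions.

(** * Random orbits *)

Section IndependentPairs.
Local Open Scope ereal_scope.
Context (R : realType).

Lemma measure_rect_unique d1 d2 (T1 : measurableType d1) (T2 : measurableType d2)
    (m m' : {measure set (T1 * T2) -> \bar R}) : m setT < +oo ->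
  (forall A B, measurable A -> measurable B -> m (A `*` B) = m' (A `*` B)) ->
  forall C, measurable C -> m C = m' C.
Proof.
move=> moo mE C mC.
pose G : set (set (T1 * T2)) :=
  [set C | exists A, measurable A /\ exists B, measurable B /\ C = A `*` B].
apply: (measure_unique G (fun=> setT)) => //.
- rewrite measurable_prod_measurableType //; congr (<<s _ >>).
  rewrite predeqE; split => [[A mA [B mB <-]]|[A [mA [B [mB ->]]]]].
    by exists A; split => //; exists B.
  by exists A => //; exists B.
- move=> /= _ _ [X1 [mX1 [X2 [mX2 ->]]]] [Y1 [mY1 [Y2 [mY2 ->]]]].
  rewrite -setXI; exists (X1 `&` Y1); split; first exact: measurableI.
  by exists (X2 `&` Y2); split => //; exact: measurableI.
- move=> _; exists setT; split; first exact: measurableT.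
  by exists setT; split; [exact: measurableT|rewrite setXTT].
- by rewrite predeqE => z; split => // _; exists 0%N.
- by move=> _ [A [mA [B [mB ->]]]]; exact: mE.
Qed.

Context d (T : measurableType d) (P : probability T R).

Definition indep_fun d1 d2 (S : measurableType d1) (V : measurableType d2)
    (X : T -> S) (Y : T -> V) :=
  forall A B, measurable A -> measurable B ->
    P (X @^-1` A `&` Y @^-1` B) = P (X @^-1` A) * P (Y @^-1` B).

(** Rectangles determine a joint law, so (X, Y) is distributed as X and Y taken on two independent
    copies of the sample space; Tonelli then integrates over the copy of Y first. *)
Lemma indep_fun_integral d1 d2 (S : measurableType d1) (V : measurableType d2)
    (X : T -> S) (Y : T -> V) (Psi : S * V -> \bar R) :
  measurable_fun setT X -> measurable_fun setT Y -> indep_fun X Y ->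
  measurable_fun setT Psi -> (forall z, 0 <= Psi z) ->
  \int[P]_w Psi (X w, Y w) = \int[P]_w \int[P]_w' Psi (X w, Y w').
Proof.
move=> mX mY iXY mPsi Psi0.
have mXY : measurable_fun setT (fun w => (X w, Y w)) by exact: measurable_fun_pair.
have mXX : measurable_fun setT (fun z : T * T => (X z.1, Y z.2)).
  by apply: measurable_fun_pair; [exact: measurableT_comp|exact: measurableT_comp].
have [m1 m1E] := pushforward_measureP P mXY.
have [m2 m2E] := pushforward_measureP (P \x P) mXX.
have m12 C : measurable C -> m1 C = m2 C.
  apply: measure_rect_unique.
    rewrite m1E (_ : _ @^-1` _ = setT)//.
    exact: (le_lt_trans (probability_le1 P measurableT) (ltry 1%R)).
  move=> A B mA mB; rewrite m1E m2E.
  have -> : (fun z : T * T => (X z.1, Y z.2)) @^-1` (A `*` B) = (X @^-1` A) `*` (Y @^-1` B).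
    by apply/seteqP; split.
  have mXA : measurable (X @^-1` A) by rewrite -[X in measurable X]setTI; exact: mX.
  have mYB : measurable (Y @^-1` B) by rewrite -[X in measurable X]setTI; exact: mY.
  transitivity (P (X @^-1` A) * P (Y @^-1` B)); last exact/esym/product_measure1E.
  by rewrite -iXY//; congr (P _); apply/seteqP; split.
transitivity (\int[m1]_z Psi z).
  have E : \int[pushforward P (fun w => (X w, Y w))]_z Psi z = \int[P]_w Psi (X w, Y w).
    exact: (@ge0_integral_pushforward _ _ _ _ R _ mXY P setT Psi measurableT mPsi (fun z _ => Psi0 z)).
  rewrite -E; apply: eq_measure_integral => A mA _.
  by rewrite m1E.
transitivity (\int[m2]_z Psi z).
  by apply: eq_measure_integral => A mA _; exact: m12.
transitivity (\int[P \x P]_z Psi (X z.1, Y z.2)).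
  have E : \int[pushforward (P \x P) (fun z : T * T => (X z.1, Y z.2))]_z Psi z = \int[P \x P]_z Psi (X z.1, Y z.2).
    exact: (@ge0_integral_pushforward _ _ _ _ R _ mXX (P \x P) setT Psi measurableT mPsi (fun z _ => Psi0 z)).
  rewrite -E; apply: eq_measure_integral => A mA _.
  by rewrite m2E.
rewrite (fubini_tonelli1 (fun z : T * T => Psi (X z.1, Y z.2)))//.
by apply: measurableT_comp.
Qed.

(** P restricted to [E] and P scaled by [P E] have images that agree on rectangles, hence on all of
    [C]. This serves a new state computed from the old state and a draw. *)
Lemma indep_fun_event d1 d2 (S : measurableType d1) (V : measurableType d2)
    (X : T -> S) (Y : T -> V) (E : set T) :
  measurable_fun setT X -> measurable_fun setT Y -> measurable E ->
  (forall A B, measurable A -> measurable B ->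
    P (X @^-1` A `&` Y @^-1` B `&` E) = P (X @^-1` A `&` Y @^-1` B) * P E) ->
  forall C, measurable C ->
    P ((fun w => (X w, Y w)) @^-1` C `&` E) = P ((fun w => (X w, Y w)) @^-1` C) * P E.
Proof.
move=> mX mY mE iE C mC.
have mXY : measurable_fun setT (fun w => (X w, Y w)) by exact: measurable_fun_pair.
have [m1 m1E] := pushforward_measureP (mrestr P mE) mXY.
have [m2 m2E] := pushforward_measureP P mXY.
have PE0 : (0 <= fine (P E))%R by apply: fine_ge0; exact: measure_ge0.
pose m3 : {measure set (S * V) -> \bar R} := mscale (NngNum PE0) m2.
have fPE : (fine (P E))%:E = P E by rewrite fineK// fin_num_measure.
have m3E A : m3 A = P ((fun w => (X w, Y w)) @^-1` A) * P E.
  by rewrite /m3 /= /mscale/= m2E fPE muleC.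
have : m1 C = m3 C.
  apply: measure_rect_unique => //.
    rewrite m1E (_ : _ @^-1` _ = setT)// /= /mrestr setTI.
    exact: (le_lt_trans (probability_le1 P mE) (ltry 1%R)).
  by move=> A B mA mB; rewrite m1E m3E /= /mrestr; exact: iE.
by rewrite m1E m3E.
Qed.

End IndependentPairs.

Section RandomOrbit.
Local Open Scope ereal_scope.
Context (R : realType) d (T : measurableType d) (P : probability T R).
Context d1 d2 (S : measurableType d1) (V : measurableType d2).
Variables (step : S -> V -> S) (k : nat) (r : 'I_k.+1 -> T -> V) (s0 : S).
Hypothesis mstep : measurable_fun setT (fun z : S * V => step z.1 z.2).
Hypothesis mr : forall i, measurable_fun setT (r i).
Hypothesis indep_r : forall (J : {set 'I_k.+1}) (A : 'I_k.+1 -> set V),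
  (forall i, measurable (A i)) ->
  P (\bigcap_(i in [set` J]) (r i @^-1` A i)) = \prod_(i in J) P (r i @^-1` A i).

(** [inord i] is the i-th draw for i <= k; the independence and expectation bounds on the orbit stop
    accordingly. *)
Fixpoint orbit_at (j : nat) (w : T) : S :=
  if j is i.+1 then step (orbit_at i w) (r (inord i) w) else s0.

Lemma measurable_orbit_at j : measurable_fun setT (orbit_at j).
Proof.
elim: j => [|j IH] /=; first exact: measurable_cst.
exact: (measurableT_comp mstep (measurable_fun_pair IH (mr _))).
Qed.

Let future (j : nat) (A : 'I_k.+1 -> set V) : set T :=
  \bigcap_(i in [set` finset (fun i : 'I_k.+1 => (j <= i)%N)]) (r i @^-1` A i).

Let mpre i (A : set V) : measurable A -> measurable (r i @^-1` A).
Proof. by move=> mA; rewrite -[X in measurable X]setTI; exact: mr. Qed.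

Let mfuture j A : (forall i, measurable (A i)) -> measurable (future j A).
Proof.
move=> mA; apply: fin_bigcap_measurable; first exact: finite_finset.
by move=> i _; exact: mpre.
Qed.

Let futureS j A (C : set V) : (j < k.+1)%N ->
  r (inord j) @^-1` C `&` future j.+1 A =
  future j (fun i => if i == inord j then C else A i).
Proof.
move=> jk; apply/seteqP; split => w.
  move=> [Cw Aw] i /=; rewrite inE => ji; case: eqP => [->//|/eqP ij].
  apply: Aw => /=; rewrite inE ltn_neqAle ji andbT.
  by apply: contra ij => /eqP ji'; apply/eqP/val_inj; rewrite /= inordK.
move=> Aw; split.
  have := Aw (inord j); rewrite /= inE inordK// leqnn eqxx; exact.
move=> i /=; rewrite inE => ji; have := Aw i; rewrite /= inE (ltnW ji).
case: eqP => [ij|_]; last exact.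
by move: ji; rewrite ij inordK// ltnn.
Qed.

Let P_futureS j A (C : set V) : (j < k.+1)%N -> (forall i, measurable (A i)) ->
  measurable C ->
  P (r (inord j) @^-1` C `&` future j.+1 A) = P (r (inord j) @^-1` C) * P (future j.+1 A).
Proof.
move=> jk mA mC; rewrite futureS// /future !indep_r//; last first.
  by move=> i; case: eqP.
rewrite (bigD1 (inord j)) ?inE ?inordK//= eqxx; congr (_ * _).
apply: eq_big => [i|i].
  rewrite !inE. rewrite ltn_neqAle andbC; congr (_ && _).
  by rewrite -(inj_eq val_inj) /= inordK// eq_sym.
by rewrite inE => /andP[_ /negbTE->].
Qed.

(** Independence from the next draw alone would not survive the induction, so an event about all
    remaining draws is carried along and one draw is split off per step. *)
Lemma orbit_at_indep_future j : (j <= k.+1)%N -> forall B A, measurable B ->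
  (forall i, measurable (A i)) ->
  P (orbit_at j @^-1` B `&` future j A) = P (orbit_at j @^-1` B) * P (future j A).
Proof.
elim: j => [_ B A mB mA|j IH jk B A mB mA].
  have [Bs|Bs] := pselect (B s0).
    by rewrite (_ : orbit_at 0 @^-1` B = setT) ?setTI ?probability_setT ?mul1e//; apply/seteqP; split.
  by rewrite (_ : orbit_at 0 @^-1` B = set0) ?set0I ?measure0 ?mul0e//; apply/seteqP; split.
have mX := measurable_orbit_at j.
have trip B' A' C : measurable B' -> (forall i, measurable (A' i)) -> measurable C ->
    P (orbit_at j @^-1` B' `&` r (inord j) @^-1` C `&` future j.+1 A') =
    P (orbit_at j @^-1` B') * P (r (inord j) @^-1` C) * P (future j.+1 A').
  move=> mB' mA' mC; rewrite -setIA -muleA -P_futureS// futureS// IH//.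
    exact: ltnW.
  by move=> i; case: eqP.
have mstepB : measurable ((fun z : S * V => step z.1 z.2) @^-1` B).
  by rewrite -[X in measurable X]setTI; exact: mstep.
apply: (@indep_fun_event R d T P d1 d2 S V (orbit_at j) (r (inord j)) (future j.+1 A) mX
  (mr _) (mfuture _ mA) _ _ mstepB) => B' C mB' mC.
rewrite trip//; congr (_ * _).
have := @trip B' (fun=> setT) C mB' (fun=> measurableT) mC.
have -> : future j.+1 (fun=> setT) = setT by apply/seteqP; split.
by rewrite setIT probability_setT mule1.
Qed.

Lemma orbit_at_indep j : (j <= k)%N -> indep_fun P (orbit_at j) (r (inord j)).
Proof.
move=> jk B C mB mC.
have E : future j (fun i => if i == inord j then C else setT) = r (inord j) @^-1` C.
  rewrite -futureS ?ltnS// (_ : future j.+1 _ = setT) ?setIT//.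
  by apply/seteqP; split.
rewrite -E orbit_at_indep_future//; first exact: leqW.
by move=> i; case: eqP.
Qed.

(** A supermartingale argument in which the index of [Phi] counts the steps left: the expectation of
    [Phi (N - j)] at time j does not increase with j. [Inv] restricts the one-step estimate to
    reachable states. *)
Lemma orbit_at_expectation_le (Inv : set S) (Phi : nat -> S -> \bar R) :
  (forall j w, Inv (orbit_at j w)) ->
  (forall j, measurable_fun setT (Phi j)) -> (forall j s, 0 <= Phi j s) ->
  (forall j i s, Inv s -> \int[P]_w Phi j (step s (r i w)) <= Phi j.+1 s) ->
  forall N, (N <= k.+1)%N -> \int[P]_w Phi 0%N (orbit_at N w) <= Phi N s0.
Proof.
move=> HInv mPhi Phi0 Hstep N Nk.
suff H : forall j, (j <= N)%N -> \int[P]_w Phi (N - j)%N (orbit_at j w) <= Phi N s0.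
  by have := H N (leqnn _); rewrite subnn.
elim=> [_|j IH jN] /=.
  by rewrite subn0 integral_cst//= probability_setT mule1.
apply: le_trans (IH (ltnW jN)).
have mX := measurable_orbit_at j.
rewrite (@indep_fun_integral R d T P d1 d2 S V (orbit_at j) (r (inord j))
  (fun z => Phi (N - j.+1)%N (step z.1 z.2)))//; last 2 first.
- by apply: orbit_at_indep; rewrite -ltnS (leq_trans jN).
- exact: (measurableT_comp (mPhi _) mstep).
apply: ge0_le_integral => //=.
- by move=> w _; apply: integral_ge0 => w' _.
- apply: (@measurable_fun_fubini_tonelli_F _ _ T T R P
    (fun z : T * T => Phi (N - j.+1)%N (step (orbit_at j z.1) (r (inord j) z.2)))) => //.
  have m1 : measurable_fun setT (fun z : T * T => orbit_at j z.1) by exact: measurableT_comp.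
  have m2 : measurable_fun setT (fun z : T * T => r (inord j) z.2) by exact: measurableT_comp.
  exact: (measurableT_comp (mPhi _) (measurableT_comp mstep (measurable_fun_pair m1 m2))).
- exact: measurableT_comp.
move=> w _; apply: le_trans (Hstep _ _ _ (HInv j w)) _.
by rewrite subnSK.
Qed.

End RandomOrbit.

(** * Potential of the infidelity *)

Section Potential.
Context {R : realType}.
Implicit Types (q s : R * R * R * R) (e x : R).

Definition tail_set e : set (R * R * R * R) := [set q | e < infid q].

(* Equal to 0, u1, u2, u3 on the infidelity ranges cut at x ^ 2 / 8, 0.145 and 0.3. *)
Definition potential (x u1 u2 u3 : R) q : R :=
  u1 * \1_(tail_set (x ^+ 2 / 8)) q + (u2 - u1) * \1_(tail_set (145 / 1000)) q +
  (u3 - u2) * \1_(tail_set (3 / 10)) q.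

Lemma measurable_quat_coord :
  [/\ measurable_fun setT (fun q : R * R * R * R => q.1.1.1),
      measurable_fun setT (fun q : R * R * R * R => q.1.1.2),
      measurable_fun setT (fun q : R * R * R * R => q.1.2) &
      measurable_fun setT (fun q : R * R * R * R => q.2)].
Proof.
have m1 : measurable_fun setT (fun q : R * R * R * R => q.1) by exact: measurable_fst.
have [h1 h2 h3] := @measurable_coord R.
split.
- exact: (measurableT_comp h1 m1).
- exact: (measurableT_comp h2 m1).
- exact: (measurableT_comp h3 m1).
- exact: measurable_snd.
Qed.

Lemma measurable_tail_set e : measurable (tail_set e).
Proof.
have [m1 _ _ _] := measurable_quat_coord.
have mi : measurable_fun setT (@infid R) by apply: measurable_funB.
rewrite /tail_set -[X in measurable X]setTI.
have -> : [set q | e < infid q] = @infid R @^-1` `]e, +oo[%classic.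
  by apply/seteqP; split => q /=; rewrite in_itv/= andbT.
exact: mi.
Qed.

Lemma measurable_potential x u1 u2 u3 : measurable_fun setT (potential x u1 u2 u3).
Proof.
by do !apply: measurable_funD; apply: measurable_funM => //;
  apply: measurable_indic; exact: measurable_tail_set.
Qed.

Lemma potential_ge0 x u1 u2 u3 q : 0 <= u1 -> u1 <= u2 -> u2 <= u3 ->
  0 <= potential x u1 u2 u3 q.
Proof.
move=> h1 h2 h3; have I0 A : 0 <= \1_A q :> R by rewrite indicE.
by rewrite !addr_ge0 ?mulr_ge0 ?subr_ge0.
Qed.

End Potential.

Section IndicatorIntegral.
Local Open Scope ereal_scope.
Context (R : realType) d (T : measurableType d) (P : probability T R).

Lemma integral_indic3 (a b c : R) (A B C : set T) : (0 <= a)%R -> (0 <= b)%R -> (0 <= c)%R ->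
  measurable A -> measurable B -> measurable C ->
  \int[P]_w (a * \1_A w + b * \1_B w + c * \1_C w)%:E = a%:E * P A + b%:E * P B + c%:E * P C.
Proof.
move=> a0 b0 c0 mA mB mC.
have I z (D : set T) : measurable D -> measurable_fun setT (fun w => (z * \1_D w)%:E : \bar R).
  by move=> mD; apply/measurable_EFinP; apply: measurable_funM => //; exact: measurable_indic.
have J z (D : set T) : (0 <= z)%R -> measurable D -> \int[P]_w (z * \1_D w)%:E = z%:E * P D.
  move=> z0 mD; under eq_integral do rewrite EFinM.
  rewrite ge0_integralZl_EFin//; last by apply/measurable_EFinP; exact: measurable_indic.
  by rewrite integral_indic// setIT.
have N z (D : set T) w : (0 <= z)%R -> 0 <= (z * \1_D w)%:E :> \bar R.
  by move=> z0; rewrite lee_fin mulr_ge0// indicE.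
under eq_integral do rewrite !EFinD.
rewrite ge0_integralD//; [|by move=> w _; apply: adde_ge0; exact: N| |by move=> w _; exact: N|exact: I].
  rewrite ge0_integralD//; [|by move=> w _; exact: N|exact: I|by move=> w _; exact: N|exact: I].
  by rewrite !J.
by apply: emeasurable_funD; exact: I.
Qed.

End IndicatorIntegral.

(** * One step of the infidelity and of its potential *)

Section InfidelityStep.
Context {R : realType}.
Implicit Types (q : R * R * R * R) (n r : R * R * R).

Lemma infid_step_le q r s tau theta n : quat_norm q = 1 -> unit_vector r ->
  (exists rho : R, [/\ rho ^+ 2 = infid q * (2 - infid q), q.1.1.2 = rho * n.1.1,
     q.1.2 = rho * n.1.2 & q.2 = rho * n.2]) ->
  infid q * (2 - infid q) <= s -> 8 * (s * tau) ^+ 2 <= theta -> band tau (axial n r) ->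
  infid (quat_step q r) <= theta.
Proof.
move=> q1 r1 hn es st; rewrite /band/= => hb.
rewrite (infid_step q1 r1 hn); apply: le_trans st.
have e0 : 0 <= infid q * (2 - infid q) by have /andP[? ?] := infid_bounds q1; nra.
rewrite -mulrA -exprMn ler_pM2l//.
rewrite -[leLHS]real_normK ?num_real// lerXn2r ?nnegrE//.
  by rewrite mulr_ge0 ?(le_trans e0 es) ?(le_trans (normr_ge0 _) hb).
by rewrite normrM ger0_norm// ler_pM.
Qed.

(** Valid for every draw: 8 b ^ 2 d ^ 2 <= 2 (b ^ 2 + d ^ 2) ^ 2, and g preserves the length of the
    vector part. *)
Lemma infid_step_half q r : quat_norm q = 1 -> unit_vector r ->
  infid (quat_step q r) <= 2 * (infid q * (2 - infid q)) ^+ 2.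
Proof.
move=> q1 r1; rewrite /quat_step infid_f ?quat_norm_g//.
have := quat_norm_g r1 q1; have : (quat_g r q).1.1.1 = q.1.1.1 by rewrite /quat_g r1/= mul1r.
rewrite /infid /quat_norm; case: (quat_g r q) => [[[a b] c] z]/= <-.
move=> H; have -> : (1 - a) * (2 - (1 - a)) = b ^+ 2 + c ^+ 2 + z ^+ 2.
  by transitivity (1 - a ^+ 2); [ring|rewrite -H; ring].
rewrite exprMn.
have := sqr_ge0 (b ^+ 2 - z ^+ 2); have := sqr_ge0 b; have := sqr_ge0 c; have := sqr_ge0 z.
set u := b ^+ 2; set y := c ^+ 2; set v := z ^+ 2; clearbody u y v.
by move=> z0 y0 x0 h; nra.
Qed.

Lemma infid_step_sqr q r : quat_norm q = 1 -> unit_vector r ->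
  infid (quat_step q r) <= 8 * infid q ^+ 2.
Proof.
move=> q1 r1; apply: le_trans (infid_step_half q1 r1) _.
have /andP[] := infid_bounds q1; move: (infid q) => e; move=> e0 e2.
have : (e * (2 - e)) ^+ 2 <= (e * 2) ^+ 2 by rewrite lerXn2r// ?nnegrE; nra.
by rewrite !expr2; nra.
Qed.

End InfidelityStep.

Section PotentialStep.
Context (R : realType) d (T : measurableType d) (P : probability T R).
Variable X : T -> R * R * R.
Hypothesis mX : measurable_fun setT X.
Hypothesis X_unit : forall w, unit_vector (X w).
Hypothesis X_law : forall A, measurable A -> P (X @^-1` A) = sphere_measure A.
Implicit Types q : R * R * R * R.

Lemma measurable_quat_step : measurable_fun setT
  (fun z : (R * R * R * R) * (R * R * R) => quat_step z.1 z.2).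
Proof.
have [a1 a2 a3 a4] := @measurable_quat_coord R.
have [c1 c2 c3] := @measurable_coord R.
have m1 : measurable_fun setT (fun z : (R * R * R * R) * (R * R * R) => z.1) by exact: measurable_fst.
have m2 : measurable_fun setT (fun z : (R * R * R * R) * (R * R * R) => z.2) by exact: measurable_snd.
have A1 := measurableT_comp a1 m1; have A2 := measurableT_comp a2 m1.
have A3 := measurableT_comp a3 m1; have A4 := measurableT_comp a4 m1.
have C1 := measurableT_comp c1 m2; have C2 := measurableT_comp c2 m2.
have C3 := measurableT_comp c3 m2.
have mrr : measurable_fun setT (fun z : (R * R * R * R) * (R * R * R) =>
    z.2.1.1 ^+ 2 + z.2.1.2 ^+ 2 + z.2.2 ^+ 2).
  by do !apply: measurable_funD; apply: measurable_funX.
have mrv : measurable_fun setT (fun z : (R * R * R * R) * (R * R * R) =>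
    2 * (z.2.1.1 * z.1.1.1.2 + z.2.1.2 * z.1.1.2 + z.2.2 * z.1.2)).
  by apply: measurable_funM => //; do !apply: measurable_funD; apply: measurable_funM.
have quad (W : measurableType _) (f1 f2 f3 f4 : W -> R) : measurable_fun setT f1 ->
    measurable_fun setT f2 -> measurable_fun setT f3 -> measurable_fun setT f4 ->
    measurable_fun setT (fun w => (f1 w, f2 w, f3 w, f4 w)).
  by move=> h1 h2 h3 h4; do !apply: measurable_fun_pair.
have mg : measurable_fun setT (fun z : (R * R * R * R) * (R * R * R) => quat_g z.2 z.1).
  exact: (quad _ _ _ _ _ _ (measurable_funM mrr A1)
    (measurable_funB (measurable_funM mrv C1) (measurable_funM mrr A2))
    (measurable_funB (measurable_funM mrv C2) (measurable_funM mrr A3))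
    (measurable_funB (measurable_funM mrv C3) (measurable_funM mrr A4))).

have mN (W : measurableType _) (f : W -> R) : measurable_fun setT f ->
  measurable_fun setT (fun w => - f w) by move=> h; exact: measurableT_comp.
have mmul (W : measurableType _) (p p' : W -> R * R * R * R) : measurable_fun setT p ->
    measurable_fun setT p' -> measurable_fun setT (fun w => quat_mul (p w) (p' w)).
  move=> h h'.
  have [b1 b2 b3 b4] := And4 (measurableT_comp a1 h) (measurableT_comp a2 h)
    (measurableT_comp a3 h) (measurableT_comp a4 h).
  have [b5 b6 b7 b8] := And4 (measurableT_comp a1 h') (measurableT_comp a2 h')
    (measurableT_comp a3 h') (measurableT_comp a4 h').
  by apply: quad; do ?[apply: measurable_funB|apply: measurable_funD|apply: measurable_funM].
have mf : measurable_fun setT (@quat_f R).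
  have N2 := mN _ _ _ a2; have N3 := mN _ _ _ a3; have N4 := mN _ _ _ a4.
  exact: (mmul _ _ _ _ (mmul _ _ _ _ (mmul _ _ _ _ (quad _ _ _ _ _ _ a1 a2 N3 N4)
    (quad _ _ _ _ _ _ a1 N2 a3 N4)) (quad _ _ _ _ _ _ a1 N2 N3 a4)) (@measurable_id _ _ _)).
exact: (measurableT_comp mf mg).
Qed.

Lemma measurable_quat_step_comp q : measurable_fun setT (fun w => quat_step q (X w)).
Proof.
have mq : measurable_fun setT (fun w => (q, X w)).
  by apply: measurable_fun_pair => //; exact: measurable_cst.
exact: (measurableT_comp measurable_quat_step mq).
Qed.

Lemma measurable_step_tail q e : measurable [set w | tail_set e (quat_step q (X w))].
Proof.
rewrite -[X in measurable X]setTI; apply: measurable_quat_step_comp => //.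
exact: measurable_tail_set.
Qed.

Lemma prob_step_tail_le q s tau theta p : quat_norm q = 1 ->
  infid q * (2 - infid q) <= s -> 8 * (s * tau) ^+ 2 <= theta -> band_prob tau p ->
  (P [set w | tail_set theta (quat_step q (X w))] <= (1 - p)%:E)%E.
Proof.
move=> q1 es st hp; have [n n1 hn] := vec_direction q1.
have mb : measurable (axial n @^-1` band tau).
  rewrite -[X in measurable X]setTI; apply: measurable_axial => //.
  exact: measurable_band.
have mXb : measurable (X @^-1` (axial n @^-1` band tau)).
  by rewrite -[X in measurable X]setTI; exact: mX.
have PXb : (p%:E <= P (X @^-1` (axial n @^-1` band tau)))%E by rewrite X_law//; exact: hp.
apply: (@le_trans _ _ (P (~` (X @^-1` (axial n @^-1` band tau))))).
  apply: le_measure; rewrite ?inE; [exact: measurable_step_tail|exact: measurableC|].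
  move=> w /= hw hb; move: hw; rewrite /tail_set/= ltNge.
  by rewrite (infid_step_le q1 (X_unit w) hn es st hb).
rewrite probability_setC// EFinB.
by apply: leeB.
Qed.

Lemma prob_step_tail0 q theta : (forall w, infid (quat_step q (X w)) <= theta) ->
  P [set w | tail_set theta (quat_step q (X w))] = 0%E.
Proof.
move=> H; rewrite (_ : [set w | _] = set0) ?measure0//.
by apply/seteqP; split=> w //=; rewrite /tail_set/= ltNge H.
Qed.

End PotentialStep.

(** The primed threshold and the [v] weights have one more step to go than [x] and the [u] weights.
    Each range uses its largest e (2 - e): 0.145 * 1.855, then 0.3 * 1.7 = 0.51, then 1. The literal
    probabilities are those of [band_263], [band_379], [band_134] and [band_193]. *)
Lemma potential_step_le (R : realType) d (T : measurableType d) (P : probability T R)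
    (X : T -> R * R * R) (mX : measurable_fun setT X)
    (X_unit : forall w, unit_vector (X w))
    (X_law : forall A, measurable A -> P (X @^-1` A) = sphere_measure A)
    (x x' u1 u2 u3 v1 v2 v3 d1 d2 d3 t1 t2 t3 : R) (q : R * R * R * R) :
  quat_norm q = 1 -> 0 <= u1 -> u1 <= u2 -> u2 <= u3 ->
  0 <= x -> x <= 1 -> 0 <= x' -> x' ^+ 2 <= x ->
  band_prob t1 d1 -> band_prob t2 d2 -> band_prob t3 d3 ->
  0 <= t1 -> 0 <= t2 -> 0 <= t3 ->
  8 * t1 * (145 / 1000 * (1855 / 1000)) <= x -> 8 * t2 * (51 / 100) <= x -> 8 * t3 <= x ->
  u1 * (1 - d1) <= v1 ->
  u1 * (1 - d2) + (u2 - u1) * (1 - 416 / 1000) + (u3 - u2) * (1 - 529 / 1000) <= v2 ->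
  u1 * (1 - d3) + (u2 - u1) * (1 - 255 / 1000) + (u3 - u2) * (1 - 334 / 1000) <= v3 ->
  (\int[P]_w (potential x u1 u2 u3 (quat_step q (X w)))%:E <= (potential x' v1 v2 v3 q)%:E)%E.
Proof.
move=> q1 u1_0 u12 u23 x0 x1 x'0 xx hb1 hb2 hb3 t1_0 t2_0 t3_0 ht1 ht2 ht3 hv1 hv2 hv3.
pose A e := [set w | tail_set e (quat_step q (X w))].
have mA e : measurable (A e) by exact: (measurable_step_tail mX).
have -> : (\int[P]_w (potential x u1 u2 u3 (quat_step q (X w)))%:E =
    u1%:E * P (A (x ^+ 2 / 8)%R) + (u2 - u1)%:E * P (A (145 / 1000)%R) + (u3 - u2)%:E * P (A (3 / 10)%R))%E.
  by rewrite -(integral_indic3 P) ?subr_ge0//.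
pose a e := fine (P (A e)).
have aE e : P (A e) = (a e)%:E by rewrite /a fineK// fin_num_measure.
have a_le s tau theta p : infid q * (2 - infid q) <= s -> 8 * (s * tau) ^+ 2 <= theta ->
    band_prob tau p -> a theta <= 1 - p.
  by move=> h1 h2 h3; rewrite -lee_fin -aE; exact: (prob_step_tail_le mX X_unit X_law q1 h1 h2 h3).
have a_0 theta : 2 * (infid q * (2 - infid q)) ^+ 2 <= theta -> a theta = 0.
  move=> h; rewrite /a /A prob_step_tail0// => w.
  by apply: le_trans h; exact: infid_step_half.
rewrite !aE -!EFinM -!EFinD lee_fin /potential !indicE.
have tail e : (q \in tail_set e) = (e < infid q) by rewrite /tail_set; apply/idP/idP; rewrite inE.
rewrite !tail; clear tail mA aE; clearbody a.
have /andP[] := infid_bounds q1; move: (infid q) a_le a_0 => e a_le a_0 e0 e2.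
have x2 : 0 <= x' ^+ 2 by exact: sqr_ge0.
have tail_sq s t : 0 <= s * t -> 8 * (s * t) <= x -> 8 * (s * t) ^+ 2 <= x ^+ 2 / 8.
  clear - x0 => s0 sx; have : (8 * (s * t)) ^+ 2 <= x ^+ 2 by rewrite lerXn2r// nnegrE mulr_ge0.
  by rewrite exprMn; lra.
(* Success is kept for every draw: e (2 - e) <= x / 4, so the next infidelity is at most 2 (x / 4) ^
   2 = x ^ 2 / 8 and the potential becomes 0. *)
have [e_x|x_e] := leP e (x' ^+ 2 / 8).
  have s2 : e * (2 - e) <= 2 * (x' ^+ 2 / 8) by clear - e_x e0; nra.
  have s3 : (e * (2 - e)) ^+ 2 <= (x / 4) ^+ 2.
    rewrite lerXn2r ?nnegrE//; first by clear - e0 e2; nra.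
      by clear - x0; lra.
    by clear - s2 xx; lra.
  have hx : (x / 4) ^+ 2 = x ^+ 2 / 16 by field.
  have hx2 : x ^+ 2 <= 1 by rewrite expr_le1.
  rewrite hx in s3.
  rewrite !a_0; [|by clear - s3 hx2; lra|by clear - s3 hx2; lra|by clear - s3; lra].
  have -> : (145 / 1000 < e) = false by apply/negbTE; rewrite -leNgt; clear - e_x xx x1; lra.
  have -> : (3 / 10 < e) = false by apply/negbTE; rewrite -leNgt; clear - e_x xx x1; lra.
  by rewrite !mulr0 !addr0.
(* Since 2 (0.145 * 1.855) ^ 2 <= 0.145, the two upper tails vanish and the only loss is to miss x ^
   2 / 8. *)
have [e_s|s_e] := leP e (145 / 1000).
  have -> : (3 / 10 < e) = false by apply/negbTE; rewrite -leNgt; clear - e_s; lra.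
  have s1 : e * (2 - e) <= 145 / 1000 * (1855 / 1000) by clear - e0 e_s; nra.
  have s0 : 0 <= e * (2 - e) by clear - e0 e2; nra.
  have s3 : 2 * (145 / 1000 * (1855 / 1000)) ^+ 2 <= 145 / 1000 :> R by clear; lra.
  have s2 : 2 * (e * (2 - e)) ^+ 2 <= 145 / 1000.
    move: s1 s3; move: (145 / 1000 * (1855 / 1000)) => m; move: (145 / 1000) => z; clear - s0 => s1 s3.
    apply: le_trans s3; rewrite ler_pM2l; last by clear; lra.
    by apply: lerXn2r; rewrite ?nnegrE ?(le_trans s0).
  have B1 := a_le _ _ _ _ s1 (tail_sq (145 / 1000 * (1855 / 1000)) t1 _ _) hb1.
  rewrite (a_0 (145 / 1000)); last exact: s2.
  rewrite (a_0 (3 / 10)); last by clear - s2; lra.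
  rewrite /= !mulr0 !addr0 mulr1; apply: le_trans hv1; apply: ler_wpM2l => //.
  apply: B1; first by clear - t1_0; lra.
  by clear - ht1; lra.
(* From here on all three cuts may be exceeded, and each tail probability is weighted by the jump of
   the potential at its cut. *)
have [e_m|m_e] := leP e (3 / 10).
  have s1 : e * (2 - e) <= 51 / 100 by clear - e0 e_m; nra.
  have B1 := a_le _ _ _ _ s1 (tail_sq (51 / 100) t2 _ _) hb2.
  have B2 : a (145 / 1000) <= 1 - 416 / 1000.
    by apply: (a_le _ _ _ _ s1 _ (@band_263 R)); clear; lra.
  have B3 : a (3 / 10) <= 1 - 529 / 1000.
    by apply: (a_le _ _ _ _ s1 _ (@band_379 R)); clear; lra.
  rewrite /= mulr0 addr0 !mulr1 addrCA subrr addr0.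
  apply: le_trans hv2; apply: lerD; [apply: lerD|]; apply: ler_wpM2l; rewrite ?subr_ge0//.
  apply: B1; first by clear - t2_0; lra.
  by clear - ht2; lra.
have s1 : e * (2 - e) <= 1 by have := sqr_ge0 (e - 1); clear; rewrite !expr2; nra.
have B1 := a_le _ _ _ _ s1 (tail_sq 1 t3 _ _) hb3.
have B2 : a (145 / 1000) <= 1 - 255 / 1000.
  by apply: (a_le _ _ _ _ s1 _ (@band_134 R)); clear; lra.
have B3 : a (3 / 10) <= 1 - 334 / 1000.
  by apply: (a_le _ _ _ _ s1 _ (@band_193 R)); clear; lra.
rewrite /= !mulr1 (addrC v1) subrK (addrC v2) subrK.
apply: le_trans hv3; apply: lerD; [apply: lerD|]; apply: ler_wpM2l; rewrite ?subr_ge0//.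
by apply: B1; rewrite mul1r.
Qed.

(** * Failure probability after N steps *)

Section TailBounds.
Context (R : realType) d (T : measurableType d) (P : probability T R).
Variables (k : nat) (r : 'I_k.+1 -> T -> R * R * R) (q0 : R * R * R * R).
Hypothesis mr : forall i, measurable_fun setT (r i).
Hypothesis r_unit : forall i w, unit_vector (r i w).
Hypothesis r_law : forall i A, measurable A -> P (r i @^-1` A) = sphere_measure A.
Hypothesis r_indep : forall (J : {set 'I_k.+1}) (A : 'I_k.+1 -> set (R * R * R)),
  (forall i, measurable (A i)) ->
  P (\bigcap_(i in [set` J]) (r i @^-1` A i)) = (\prod_(i in J) P (r i @^-1` A i))%E.
Hypothesis q0_norm : quat_norm q0 = 1.

Notation orbit := (orbit_at (@quat_step R) r q0).

Lemma quat_norm_orbit j w : quat_norm (orbit j w) = 1.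
Proof. by elim: j => //= j IH; exact/quat_norm_f/quat_norm_g. Qed.

Lemma measurable_orbit_tail e j : measurable [set w | e < infid (orbit j w)].
Proof.
have mo := measurable_orbit_at q0 (@measurable_quat_step R) mr j.
rewrite -[X in measurable X]setTI; exact: (mo measurableT _ (measurable_tail_set e)).
Qed.

(** At [j = 0] all weights are 1 and the potential is the indicator of failure; at [j = N] it is at
    most [u3 N], whatever the start. *)
Lemma orbit_tail_le (x u1 u2 u3 : nat -> R) N :
  (N <= k.+1)%N -> u1 0%N = 1 -> u2 0%N = 1 -> u3 0%N = 1 ->
  (forall j, [/\ 0 <= u1 j, u1 j <= u2 j & u2 j <= u3 j]) ->
  (forall j i q, quat_norm q = 1 ->
    (\int[P]_w (potential (x j) (u1 j) (u2 j) (u3 j) (quat_step q (r i w)))%:E <=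
     (potential (x j.+1) (u1 j.+1) (u2 j.+1) (u3 j.+1) q)%:E)%E) ->
  (P [set w | x 0%N ^+ 2 / 8 < infid (orbit N w)]%R <= (u3 N)%:E)%E.
Proof.
move=> Nk u10 u20 u30 mono Hstep.
pose Phi j q : \bar R := (potential (x j) (u1 j) (u2 j) (u3 j) q)%:E.
have := @orbit_at_expectation_le R d T P _ _ _ _ (@quat_step R) k r q0
  (@measurable_quat_step R) mr r_indep [set q | quat_norm q = 1] Phi _ _ _ _ N Nk.
move=> /(_ quat_norm_orbit) H.
have {}H : (\int[P]_w Phi 0%N (orbit N w) <= Phi N q0)%E.
  apply: H.
  - by move=> j; apply/measurable_EFinP; exact: measurable_potential.
  - by move=> j q; rewrite lee_fin; have [? ? ?] := mono j; exact: potential_ge0.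
  - by move=> j i q q1; exact: Hstep.
apply: (@le_trans _ _ (Phi N q0)); last first.
  rewrite lee_fin /potential !indicE; have [h1 h2 h3] := mono N.
  have b1 (b : bool) : b%:R <= 1 :> R by case: b.
  have g (z : R) (b : bool) : 0 <= z -> z * b%:R <= z by move=> z0; exact: ler_piMr z0 (b1 b).
  have e1 := g _ (q0 \in tail_set (x N ^+ 2 / 8)) h1.
  have h2' : 0 <= u2 N - u1 N by rewrite subr_ge0.
  have h3' : 0 <= u3 N - u2 N by rewrite subr_ge0.
  have e2 := g _ (q0 \in tail_set (145 / 1000)) h2'.
  have e3 := g _ (q0 \in tail_set (3 / 10)) h3'.
  apply: (le_trans (lerD (lerD e1 e2) e3)).
  by rewrite (addrC (u1 N)) subrK (addrC (u2 N)) subrK.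
apply: le_trans H; rewrite le_eqVlt; apply/orP; left; apply/eqP.
have mtail := measurable_orbit_tail (x 0%N ^+ 2 / 8) N.
transitivity (\int[P]_w (\1_[set w | (x 0%N ^+ 2 / 8 < infid (orbit N w))%R] w)%:E)%E.
  by rewrite integral_indic// setIT.
apply: eq_integral => w _; rewrite /Phi /potential u10 u20 u30 !subrr !mul0r !addr0 mul1r.
by rewrite !indicE; congr (_%:R%:E); apply/idP/idP; rewrite !inE.
Qed.

End TailBounds.

Notation quat_orbit := (orbit_at (@quat_step _)).

(* [x j] is the threshold with [j] steps to go, [x j.+1 ^+ 2 <= x j]. The weights [u1], [u2],
   [u3] come from iterating the transition bounds of [potential_step_le]; from [j = 4] on they
   form a vector that one step multiplies by at most 3/4. *)
Lemma orbit_tail_39 (R : realType) d (T : measurableType d) (P : probability T R)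
    (k : nat) (r : 'I_k.+1 -> T -> R * R * R) (q0 : R * R * R * R)
    (mr : forall i, measurable_fun setT (r i))
    (r_unit : forall i w, unit_vector (r i w))
    (r_law : forall i A, measurable A -> P (r i @^-1` A) = sphere_measure A)
    (r_indep : forall (J : {set 'I_k.+1}) (A : 'I_k.+1 -> set (R * R * R)),
      (forall i, measurable (A i)) ->
      P (\bigcap_(i in [set` J]) (r i @^-1` A i)) = (\prod_(i in J) P (r i @^-1` A i))%E)
    (q0_norm : quat_norm q0 = 1) (N : nat) : (1 < N)%N -> (N <= k.+1)%N ->
  (P [set w | (390 / 1000) ^+ 2 / 8 < infid (quat_orbit r q0 N w)]%R <= (1 * (3 / 4) ^+ N.-1)%:E)%E.
Proof.
move=> N1 Nk.
(* Each threshold is the square root of the previous one rounded down to a hundredth, until it is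
   frozen at 0.88. *)
pose x j : R := match j with 0%N => 390 / 1000 | 1%N => 620 / 1000 | 2%N => 780 / 1000 | _ => 880 / 1000 end.
pose u1 j : R := match j with 0%N => 1 | 1%N => 681 / 1000 | 2%N => 380 / 1000
    | 3%N => 185 / 1000 | m.+4 => 90 / 1000 * (3 / 4) ^+ m end.
pose u2 j : R := match j with 0%N => 1 | 1%N => 804 / 1000 | 2%N => 602 / 1000
    | 3%N => 437 / 1000 | m.+4 => 325 / 1000 * (3 / 4) ^+ m end.
pose u3 j : R := match j with 0%N => 1 | 1%N => 887 / 1000 | 2%N => 715 / 1000
    | 3%N => 546 / 1000 | m.+4 => 420 / 1000 * (3 / 4) ^+ m end.
have p0 m : 0 <= (3 / 4) ^+ m :> R by apply: exprn_ge0; clear; lra.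
have mono j : [/\ 0 <= u1 j, u1 j <= u2 j & u2 j <= u3 j].
  case: j => [|[|[|[|m]]]]; rewrite /u1 /u2 /u3; try by split; clear; lra.
  by have := p0 m; move: ((3 / 4) ^+ m) => z; clear => z0; split; lra.
have x01 j : 0 <= x j /\ x j <= 1.
  by case: j => [|[|[|[|j]]]]; rewrite /x; split; clear; lra.
have xsq j : x j.+1 ^+ 2 <= x j.
  by case: j => [|[|[|[|j]]]]; rewrite /x; clear; lra.
have := @orbit_tail_le R d T P k r q0 mr r_unit r_indep q0_norm x u1 u2 u3 N Nk erefl erefl erefl mono.
move=> H; apply: le_trans (H _) _; last first.
  (* The margin is smallest from N = 4 on, where 0.420 stands against (3 / 4) ^ 3 = 0.4219. *)
  rewrite lee_fin {H xsq x01}; case: N N1 {Nk} => [|[|[|[|m]]]] // _;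
    rewrite /u3 /=; [by clear; lra|by clear; lra|].
  have -> : (3 / 4) ^+ m.+3 = (3 / 4) ^+ m * (27 / 64) :> R.
    by rewrite 3!exprSr -2!mulrA; congr (_ * _); clear; lra.
  by have := p0 m; move: ((3 / 4) ^+ m) => z; clear => z0; lra.
move=> j i q q1; have [h1 h2 h3] := mono j; have [x0 x1] := x01 j; have [x0' _] := x01 j.+1.
have xs := xsq j; clear H xsq x01 mono.
have step := @potential_step_le R d T P (r i) (mr i) (r_unit i) (r_law i) (x j) (x j.+1)
  (u1 j) (u2 j) (u3 j) (u1 j.+1) (u2 j.+1) (u3 j.+1).
case: j h1 h2 h3 x0 x1 x0' xs step => [|[|[|[|m]]]] h1 h2 h3 x0 x1 x0' xs step.
- apply: (step _ _ _ _ _ _ _ q1 h1 h2 h3 x0 x1 x0' xs (@band_181 R) (@band_095 R) (@band_048 R));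
    rewrite /x /u1 /u2 /u3; clear; lra.
- apply: (step _ _ _ _ _ _ _ q1 h1 h2 h3 x0 x1 x0' xs (@band_288 R) (@band_151 R) (@band_077 R));
    rewrite /x /u1 /u2 /u3; clear; lra.
- apply: (step _ _ _ _ _ _ _ q1 h1 h2 h3 x0 x1 x0' xs (@band_362 R) (@band_191 R) (@band_097 R));
    rewrite /x /u1 /u2 /u3; clear; lra.
- apply: (step _ _ _ _ _ _ _ q1 h1 h2 h3 x0 x1 x0' xs (@band_408 R) (@band_215 R) (@band_110 R));
    rewrite /x /u1 /u2 /u3; clear; lra.
- have := p0 m; have := exprSr (3 / 4 : R) m; move: h1 h2 h3 step; rewrite /u1 /u2 /u3.
  move: ((3 / 4) ^+ m) ((3 / 4) ^+ m.+1) => z z' h1 h2 h3 step z'E z0.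
  apply: (step _ _ _ _ _ _ _ q1 h1 h2 h3 x0 x1 x0' xs (@band_408 R) (@band_215 R) (@band_110 R));
    rewrite /x; clear -z'E z0; lra.
Qed.

(** The scheme of [orbit_tail_39] for targets that the squarings of 0.39 do not reach; the factor
    1.12 is the price of the smaller threshold. *)
Lemma orbit_tail_25 (R : realType) d (T : measurableType d) (P : probability T R)
    (k : nat) (r : 'I_k.+1 -> T -> R * R * R) (q0 : R * R * R * R)
    (mr : forall i, measurable_fun setT (r i))
    (r_unit : forall i w, unit_vector (r i w))
    (r_law : forall i A, measurable A -> P (r i @^-1` A) = sphere_measure A)
    (r_indep : forall (J : {set 'I_k.+1}) (A : 'I_k.+1 -> set (R * R * R)),
      (forall i, measurable (A i)) ->
      P (\bigcap_(i in [set` J]) (r i @^-1` A i)) = (\prod_(i in J) P (r i @^-1` A i))%E)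
    (q0_norm : quat_norm q0 = 1) (N : nat) : (1 < N)%N -> (N <= k.+1)%N ->
  (P [set w | (250 / 1000) ^+ 2 / 8 < infid (quat_orbit r q0 N w)]%R <= (112 / 100 * (3 / 4) ^+ N.-1)%:E)%E.
Proof.
move=> N1 Nk.
pose x j : R := match j with 0%N => 250 / 1000 | 1%N => 500 / 1000 | 2%N => 700 / 1000
    | 3%N => 830 / 1000 | _ => 880 / 1000 end.
pose u1 j : R := match j with 0%N => 1 | 1%N => 772 / 1000 | 2%N => 478 / 1000
    | 3%N => 249 / 1000 | m.+4 => 117 / 1000 * (3 / 4) ^+ m end.
pose u2 j : R := match j with 0%N => 1 | 1%N => 862 / 1000 | 2%N => 670 / 1000
    | 3%N => 492 / 1000 | m.+4 => 358 / 1000 * (3 / 4) ^+ m end.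
pose u3 j : R := match j with 0%N => 1 | 1%N => 921 / 1000 | 2%N => 771 / 1000
    | 3%N => 601 / 1000 | m.+4 => 460 / 1000 * (3 / 4) ^+ m end.
have p0 m : 0 <= (3 / 4) ^+ m :> R by apply: exprn_ge0; clear; lra.
have mono j : [/\ 0 <= u1 j, u1 j <= u2 j & u2 j <= u3 j].
  case: j => [|[|[|[|m]]]]; rewrite /u1 /u2 /u3; try by split; clear; lra.
  by have := p0 m; move: ((3 / 4) ^+ m) => z; clear => z0; split; lra.
have x01 j : 0 <= x j /\ x j <= 1.
  by case: j => [|[|[|[|j]]]]; rewrite /x; split; clear; lra.
have xsq j : x j.+1 ^+ 2 <= x j.
  by case: j => [|[|[|[|j]]]]; rewrite /x; clear; lra.
have := @orbit_tail_le R d T P k r q0 mr r_unit r_indep q0_norm x u1 u2 u3 N Nk erefl erefl erefl mono.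
move=> H; apply: le_trans (H _) _; last first.
  rewrite lee_fin {H xsq x01}; case: N N1 {Nk} => [|[|[|[|m]]]] // _;
    rewrite /u3 /=; [by clear; lra|by clear; lra|].
  have -> : (3 / 4) ^+ m.+3 = (3 / 4) ^+ m * (27 / 64) :> R.
    by rewrite 3!exprSr -2!mulrA; congr (_ * _); clear; lra.
  by have := p0 m; move: ((3 / 4) ^+ m) => z; clear => z0; lra.
move=> j i q q1; have [h1 h2 h3] := mono j; have [x0 x1] := x01 j; have [x0' _] := x01 j.+1.
have xs := xsq j; clear H xsq x01 mono.
have step := @potential_step_le R d T P (r i) (mr i) (r_unit i) (r_law i) (x j) (x j.+1)
  (u1 j) (u2 j) (u3 j) (u1 j.+1) (u2 j.+1) (u3 j.+1).
case: j h1 h2 h3 x0 x1 x0' xs step => [|[|[|[|m]]]] h1 h2 h3 x0 x1 x0' xs step.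
- apply: (step _ _ _ _ _ _ _ q1 h1 h2 h3 x0 x1 x0' xs (@band_116 R) (@band_061 R) (@band_031 R));
    rewrite /x /u1 /u2 /u3; clear; lra.
- apply: (step _ _ _ _ _ _ _ q1 h1 h2 h3 x0 x1 x0' xs (@band_232 R) (@band_122 R) (@band_062 R));
    rewrite /x /u1 /u2 /u3; clear; lra.
- apply: (step _ _ _ _ _ _ _ q1 h1 h2 h3 x0 x1 x0' xs (@band_325 R) (@band_171 R) (@band_087 R));
    rewrite /x /u1 /u2 /u3; clear; lra.
- apply: (step _ _ _ _ _ _ _ q1 h1 h2 h3 x0 x1 x0' xs (@band_385 R) (@band_203 R) (@band_103 R));
    rewrite /x /u1 /u2 /u3; clear; lra.
- have := p0 m; have := exprSr (3 / 4 : R) m; move: h1 h2 h3 step; rewrite /u1 /u2 /u3.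
  move: ((3 / 4) ^+ m) ((3 / 4) ^+ m.+1) => z z' h1 h2 h3 step z'E z0.
  apply: (step _ _ _ _ _ _ _ q1 h1 h2 h3 x0 x1 x0' xs (@band_408 R) (@band_215 R) (@band_110 R));
    rewrite /x; clear -z'E z0; lra.
Qed.

(** * From orbits to matrices *)

Section OrbitMatrix.
Context {R : realType}.
Implicit Types (q : R * R * R * R).

Lemma Fmap_orbit d (T : measurableType d) k (r : 'I_k.+1 -> T -> R * R * R) q w :
  Fmap (fun j => r j w) (quat_mx q) = quat_mx (quat_orbit r q k.+1 w).
Proof.
have enumE : enum 'I_k.+1 = [seq inord i | i <- iota 0 k.+1].
  rewrite -val_enum_ord -map_comp -[LHS]map_id; apply: eq_map => i /=.
  by rewrite inord_val.
rewrite /Fmap enumE.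
suff H n : foldl (fun W j => Defs.fmap (gmap (r j w) W)) (quat_mx q)
    [seq inord i | i <- iota 0 n] = quat_mx (quat_orbit r q n w) by exact: H.
elim: n => [|j IH] //.
rewrite -[in iota _ _]addn1 iotaD map_cat foldl_cat IH /= add0n.
by rewrite gmap_quat fmap_quat.
Qed.

Lemma hsnorm_quat_le q eps : 0 <= eps -> (hsnorm (quat_mx q - 1%:M) <= eps) =
  (((q.1.1.1 - 1) ^+ 2 + q.1.1.2 ^+ 2 + q.1.2 ^+ 2 + q.2 ^+ 2) / 2 <= eps ^+ 2).
Proof.
move=> e0; rewrite -hsnorm_quat ler_pXn2r ?nnegrE//.
by rewrite /hsnorm mulr_ge0 ?sqrtr_ge0.
Qed.

Lemma infid_hsnorm q : quat_norm q = 1 ->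
  ((q.1.1.1 - 1) ^+ 2 + q.1.1.2 ^+ 2 + q.1.2 ^+ 2 + q.2 ^+ 2) / 2 = infid q.
Proof.
case: q => [[[a b] c] d]; rewrite /quat_norm /infid/= => H.
transitivity ((1 - 2 * a + (a ^+ 2 + b ^+ 2 + c ^+ 2 + d ^+ 2)) / 2); first by ring.
by rewrite H; field.
Qed.

Lemma quat_orbit_infid_sqr d (T : measurableType d) k (r : 'I_k.+1 -> T -> R * R * R) q w N m x :
  (forall i, unit_vector (r i w)) -> quat_norm q = 1 ->
  infid (quat_orbit r q N w) <= x ^+ 2 / 8 ->
  infid (quat_orbit r q (N + m) w) <= (x ^+ (2 ^ m)) ^+ 2 / 8.
Proof.
move=> r1 q1 H.
have orb1 j : quat_norm (quat_orbit r q j w) = 1.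
  by elim: j => //= j IH; exact/quat_norm_f/quat_norm_g.
elim: m => [|m IH]; first by rewrite addn0 expn0 expr1.
rewrite addnS /=; apply: le_trans (infid_step_sqr (orb1 _) (r1 _)) _.
rewrite expnS mulnC exprM; move: IH; have /andP[] := infid_bounds (orb1 (N + m)%N).
move: (infid _) ((x ^+ (2 ^ m)) ^+ 2) => e y e0 _ ey.
have : e ^+ 2 <= (y / 8) ^+ 2 by rewrite lerXn2r ?nnegrE// (le_trans e0).
by rewrite expr_div_n; lra.
Qed.

(** The draws lie on the sphere only almost surely. Sending the exceptional values to the pole
    preserves law and independence and makes the pointwise estimates applicable to every outcome. *)
Definition unitize (v : R * R * R) : R * R * R :=
  if v.1.1 ^+ 2 + v.1.2 ^+ 2 + v.2 ^+ 2 == 1 then v else (0, 0, 1).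

Lemma unitize_unit v : unit_vector (unitize v).
Proof.
rewrite /unitize /unit_vector; case: eqP => //= _.
by rewrite !expr0n expr1n/= !add0r.
Qed.

Lemma unitize_id v : unit_vector v -> unitize v = v.
Proof. by rewrite /unitize /unit_vector => ->; rewrite eqxx. Qed.

Lemma measurable_unit_vector : measurable (@unit_vector R).
Proof.
have [m1 m2 m3] := @measurable_coord R.
have mf : measurable_fun setT (fun v : R * R * R => v.1.1 ^+ 2 + v.1.2 ^+ 2 + v.2 ^+ 2).
  by do !apply: measurable_funD; apply: measurable_funX.
have := mf measurableT _ (@measurable_set1 R 1); rewrite setTI; apply.
Qed.

Lemma measurable_unitize : measurable_fun setT (@unitize).
Proof.
have [m1 m2 m3] := @measurable_coord R.
have mf : measurable_fun setT (fun v : R * R * R => v.1.1 ^+ 2 + v.1.2 ^+ 2 + v.2 ^+ 2).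
  by do !apply: measurable_funD; apply: measurable_funX.
apply: (measurable_fun_ifT (measurable_fun_eqr mf (measurable_cst _))).
  exact: measurable_id.
exact: measurable_cst.
Qed.

Lemma spherical_coord_unit (t p : R) : unit_vector (spherical_coord t p).
Proof.
rewrite /unit_vector /spherical_coord/= !exprMn -mulrDr cos2Dsin2 mulr1.
by rewrite addrC cos2Dsin2.
Qed.

Lemma sphere_measure_eq (A B : set (R * R * R)) :
  (forall v, unit_vector v -> A v <-> B v) -> sphere_measure A = sphere_measure B.
Proof.
move=> AB; rewrite /sphere_measure.
have E v : unit_vector v -> \1_A v = \1_B v :> R.
  move=> v1; rewrite !indicE (_ : (v \in A) = (v \in B))//.
  by apply/idP/idP; rewrite !inE => h; [exact: (AB v v1).1|exact: (AB v v1).2].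
apply: (congr1 (fun x : \bar R => (4 * pi)^-1%:E * x)%E).
apply: eq_integral => t _; apply: eq_integral => p _.
by rewrite E//; exact: spherical_coord_unit.
Qed.

End OrbitMatrix.

(** [N] random steps bring sqrt (8 e) below [x] and [m] further ones square it. The tail hypothesis
    ranges over all families of draws because it is applied to the unitized ones. *)
Lemma success_prob (R : realType) d (T : measurableType d) (P : probability T R) (k : nat)
    (r : 'I_k.+1 -> T -> R * R * R) (U : 'M[R[i]]_2) (eps eta x : R) (N m : nat) :
  iid_uniform_sphere P r -> inSU2 U -> 0 <= eps -> (N + m = k.+1)%N ->
  (x ^+ (2 ^ m)) ^+ 2 / 8 <= eps ^+ 2 ->
  (forall (r' : 'I_k.+1 -> T -> R * R * R) q, (forall i, measurable_fun setT (r' i)) ->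
    (forall i w, unit_vector (r' i w)) ->
    (forall i A, measurable A -> P (r' i @^-1` A) = sphere_measure A) ->
    (forall (J : {set 'I_k.+1}) (A : 'I_k.+1 -> set (R * R * R)),
      (forall i, measurable (A i)) ->
      P (\bigcap_(i in [set` J]) (r' i @^-1` A i)) = (\prod_(i in J) P (r' i @^-1` A i))%E) ->
    quat_norm q = 1 ->
    (P [set w | x ^+ 2 / 8 < infid (quat_orbit r' q N w)]%R <= eta%:E)%E) ->
  ((1 - eta)%:E <= P [set w | (hsnorm (Fmap (fun j => r j w) U - 1%:M) <= eps)%R])%E.
Proof.
move=> [mr law_r indep_r] /SU2_quat[q q1 ->] eps0 Nmk x_eps tail.
pose r' i w := unitize (r i w).
have mu := @measurable_unitize R; have mS := @measurable_unit_vector R.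
have mr' i : measurable_fun setT (r' i) by exact: (measurableT_comp mu (mr i)).
have mpre (A : set (R * R * R)) : measurable A -> measurable (@unitize R @^-1` A).
  by move=> mA; rewrite -[X in measurable X]setTI; exact: mu.
have mrpre i (A : set (R * R * R)) : measurable A -> measurable (r i @^-1` A).
  by move=> mA; rewrite -[X in measurable X]setTI; exact: mr.
have r'_unit i w : unit_vector (r' i w) by exact: unitize_unit.
have r'_law i A : measurable A -> P (r' i @^-1` A) = sphere_measure A.
  move=> mA; transitivity (P (r i @^-1` (@unitize R @^-1` A))) => //.
  rewrite law_r; last exact: mpre.
  by apply: sphere_measure_eq => v v1; rewrite /= unitize_id.
have r'_indep (J : {set 'I_k.+1}) (A : 'I_k.+1 -> set (R * R * R)) : (forall i, measurable (A i)) ->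
    P (\bigcap_(i in [set` J]) (r' i @^-1` A i)) = (\prod_(i in J) P (r' i @^-1` A i))%E.
  by move=> mA; apply: (indep_r J (fun i => @unitize R @^-1` A i)) => i; exact: mpre.
have := tail r' q mr' r'_unit r'_law r'_indep q1 => {}tail.
pose B := [set w | x ^+ 2 / 8 < infid (quat_orbit r' q N w)].
have mB : measurable B by exact: (measurable_orbit_tail q mr').
(* On [G], of probability 1 since [sphere_measure] sees only the sphere, the original and the
   unitized draws produce the same orbit. *)
pose G := \bigcap_(i in [set` [set: 'I_k.+1]%SET]) (r i @^-1` @unit_vector R).
have mG : measurable G.
  by apply: fin_bigcap_measurable => [|i _]; [exact: finite_finset|exact: mrpre].
have PG : P G = 1%E.
  rewrite /G (indep_r _ (fun=> @unit_vector R))// big1// => i _.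
  rewrite law_r// (@sphere_measure_eq R _ setT)// -(law_r i)//.
  by rewrite preimage_setT probability_setT.
have PCG : P (~` G) = 0%E by rewrite probability_setC// PG subee.
pose dev (p : R * R * R * R) := ((p.1.1.1 - 1) ^+ 2 + p.1.1.2 ^+ 2 + p.1.2 ^+ 2 + p.2 ^+ 2) / 2.
have -> : [set w | hsnorm (Fmap (fun j => r j w) (quat_mx q) - 1%:M) <= eps] =
    [set w | dev (quat_orbit r q k.+1 w) <= eps ^+ 2].
  by apply/funext => w; rewrite /mkset Fmap_orbit hsnorm_quat_le.
set E := [set w | _].
have mE : measurable E.
  have mo := measurable_orbit_at q (@measurable_quat_step R) mr k.+1.
  have [a1 a2 a3 a4] := @measurable_quat_coord R.
  have mf : measurable_fun setT dev.
    apply: measurable_funM => //; do !apply: measurable_funD; apply: measurable_funX => //.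
    exact: measurable_funB.
  have -> : E = (quat_orbit r q k.+1) @^-1` (dev @^-1` `]-oo, eps ^+ 2]).
    by apply/seteqP; split => w; rewrite /E /= in_itv.
  rewrite -[X in measurable X]setTI; apply: (mo measurableT).
  by rewrite -[X in measurable X]setTI; exact: (mf measurableT).
have sub : ~` B `<=` E `|` ~` G.
  move=> w /= Bw; have [Gw|Gw] := pselect (G w); last by right.
  left; rewrite /E /mkset.
  have rw i : unit_vector (r i w) by apply: (Gw i); rewrite /= inE.
  have orbE j : quat_orbit r q j w = quat_orbit r' q j w.
    by elim: j => //= j ->; rewrite /r' unitize_id.
  have orb1 : quat_norm (quat_orbit r' q k.+1 w) = 1.
    by elim: k.+1 => //= j IH; exact/quat_norm_f/quat_norm_g.
  rewrite orbE /dev infid_hsnorm//; apply: le_trans x_eps.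
  rewrite -Nmk; apply: quat_orbit_infid_sqr => //.
  by move: Bw; rewrite /B /= => /negP; rewrite -leNgt.
apply: (@le_trans _ _ (P (~` B))).
  rewrite probability_setC// EFinB; exact: leeB.
apply: (@le_trans _ _ (P (E `|` ~` G))).
  by apply: le_measure; rewrite ?inE//; [exact: measurableC|exact/measurableU/measurableC].
apply: le_trans (measureU2 _ _ _) _ => //; first exact: measurableC.
by rewrite [X in (_ + X)%E](_ : _ = 0%E) ?adde0.
Qed.

(** * Number of iterations *)

Section IterationCount.
Context {R : realType}.
Implicit Types eps eta : R.

Lemma ln_43_gt0 : 0 < ln (4 / 3) :> R.
Proof. by rewrite ln_gt0//; lra. Qed.

Lemma ln_2_gt0 : 0 < ln 2 :> R.
Proof. by rewrite ln_gt0//; lra. Qed.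

(** (4 / 3) ^ 5 > 4. This gives 2 / log2 (4 / 3) <= 5, the exponent of eta in the pulse count. *)
Lemma ln_43_ge : 2 / 5 * ln 2 <= ln (4 / 3) :> R.
Proof.
have : ln (2 ^+ 2) <= ln ((4 / 3) ^+ 5) :> R.
  rewrite ler_ln ?posrE; [lra|exact: exprn_gt0|].
  by apply: exprn_gt0; lra.
by rewrite !lnXn//; lra.
Qed.

(** 1.12 ^ 5 < 16 / 9: at rate 3 / 4 the factor 1.12 costs at most 2 / 5 of a step. *)
Lemma ln_112_le : ln (112 / 100) <= 2 / 5 * ln (4 / 3) :> R.
Proof.
have : ln ((112 / 100) ^+ 5) <= ln ((4 / 3) ^+ 2) :> R.
  rewrite ler_ln ?posrE; [lra|apply: exprn_gt0; lra|].
  by apply: exprn_gt0; lra.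
rewrite !lnXn//; lra.
Qed.

Lemma mul_pow34_le c eta n : 0 < c -> 0 < eta -> ln c - ln eta <= n%:R * ln (4 / 3) ->
  c * (3 / 4) ^+ n <= eta.
Proof.
move=> c0 e0 H; have p0 : 0 < 3 / 4 :> R by lra.
rewrite -ler_ln ?posrE//; last by rewrite mulr_gt0// exprn_gt0.
rewrite lnM ?posrE ?exprn_gt0// lnXn//.
have -> : ln (3 / 4) = - ln (4 / 3) :> R.
  by rewrite -lnV ?posrE; [congr ln; field|lra].
move: (ln (4 / 3)) H => z; rewrite mulNrn mulr_natl; lra.
Qed.

Lemma dyadic_scale (L : R) : 1 <= L -> exists m : nat, 2 ^+ m <= L < 2 ^+ m.+1.
Proof.
move=> L1; have [n Ln] : exists n : nat, L < 2 ^+ n.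
  exists (Num.bound L); apply: lt_le_trans (archi_boundP _) _; first exact: le_trans L1.
  by rewrite -natrX ler_nat ltnW// ltn_expl.
elim: n Ln => [|n IH] Ln; first by move: Ln; rewrite expr0 ltNge L1.
have [/IH//|L2] := ltP L (2 ^+ n).
by exists n; rewrite L2.
Qed.

(* With L = log2 (1 / (sqrt 8 * eps)) = 2 ^ m * c and 1 <= c < 2, the last [m] steps only square
   sqrt (8 * infidelity) and turn the threshold 2 ^ - c into sqrt 8 * eps. If 2 ^ - c < 0.39
   then c > 4/3, and the surplus c ^ log2 (4/3) >= 1.12 in the budget for the first [N] steps
   pays for the smaller threshold 1/4. *)
Lemma iteration_split eps eta (k : nat) :
  0 < eps -> eps < 1 / Num.sqrt 8 -> 0 < eta -> eta < 1 ->
  iterations eta eps <= k%:R -> log2 (1 / eta) / log2 (4 / 3) + 1 <= k%:R ->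
  exists N m (x : R), [/\ (1 < N)%N, (N + m = k)%N, (x ^+ (2 ^ m)) ^+ 2 / 8 <= eps ^+ 2 &
    x = 390 / 1000 /\ 1 * (3 / 4) ^+ N.-1 <= eta \/
    x = 250 / 1000 /\ 112 / 100 * (3 / 4) ^+ N.-1 <= eta].
Proof.
move=> e0; have s8 : 0 < Num.sqrt 8 :> R by rewrite sqrtr_gt0.
rewrite ltr_pdivlMr// mulrC => se1 eta0 eta1.
have epsE : eps ^+ 2 = (Num.sqrt 8 * eps) ^+ 2 / 8 by rewrite exprMn sqr_sqrtr//; field.
rewrite epsE /iterations; have : 0 < Num.sqrt 8 * eps by exact: mulr_gt0.
move: (Num.sqrt 8 * eps) se1 => s s1 s0 {s8 epsE e0 eps}.
have l2 := ln_2_gt0; have l43 := ln_43_gt0.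
have -> : log2 (1 / eta) / log2 (4 / 3) = - ln eta / ln (4 / 3).
  by rewrite /log2 div1r lnV ?posrE//; field; rewrite !gt_eqF.
set L := log2 (1 / s).
have LE : ln s = - (L * ln 2).
  by rewrite /L /log2 div1r lnV ?posrE//; field; rewrite gt_eqF.
have lneta : 0 < - ln eta by rewrite oppr_gt0 ln_lt0// eta0.
set A := - ln eta / ln (4 / 3) => k1 k2.
have AE : - ln eta = A * ln (4 / 3) by rewrite /A divfK ?gt_eqF.
have A0 : 0 < A by rewrite /A divr_gt0.
have bound (N : nat) c : 0 < c -> (0 < N)%N -> (A + ln c / ln (4 / 3) + 1 <= N%:R) ->
    c * (3 / 4) ^+ N.-1 <= eta.
  move=> c0 N0 AN; apply: mul_pow34_le => //.
  have -> : ln c - ln eta = (A + ln c / ln (4 / 3)) * ln (4 / 3).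
    by rewrite mulrDl -AE divfK ?gt_eqF// addrC.
  rewrite ler_pM2r// -subn1 natrB//; clear - AN; lra.
(* Here the double logarithm gives no positive contribution, so the second lower bound on k takes
   over; as s >= 1 / 2 > 0.39, no squaring phase is planned. *)
have [L1|L1] := leP L 1.
  have k_gt1 : (1 < k)%N by rewrite -(ltr_nat R); clear - k2 A0; lra.
  exists k, 0%N, (390 / 1000); split; [exact: k_gt1|exact: addn0| |].
    rewrite expn0 expr1.
    have s_ge : 2^-1 <= s.
      by rewrite -ler_ln ?posrE ?invr_gt0// lnV ?posrE// LE lerN2 ler_piMl// ltW.
    have : (390 / 1000) ^+ 2 <= s ^+ 2.
      by apply: lerXn2r; rewrite ?nnegrE; [clear; lra|clear - s0; lra|clear - s_ge; lra].
    by move: (s ^+ 2) => z; clear; lra.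
  left; split; [by []|apply: (bound k 1 ltr01 (ltnW k_gt1))].
  by rewrite ln1 mul0r addr0.
have [m /andP[mL Lm]] := dyadic_scale (ltW L1).
have p2 : 0 < 2 ^+ m :> R by exact: exprn_gt0.
pose c := L / 2 ^+ m.
have c1 : 1 <= c by rewrite /c ler_pdivlMr// mul1r.
have c2 : c < 2 by rewrite /c ltr_pdivrMr// -exprS.
have LcE : L = c * 2 ^+ m by rewrite /c divfK ?gt_eqF.
have c0 : 0 < c by exact: lt_le_trans c1.
have lnc : 0 <= ln c by exact: ln_ge0.
have log2L : log2 L = m%:R + ln c / ln 2.
  by rewrite /log2 LcE lnM ?posrE// lnXn// mulrDl addrC -[ln 2 *+ m]mulr_natl mulfK ?gt_eqF.
rewrite log2L in k1.
have km : (m.+1 < k)%N.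
  rewrite -(ltr_nat R) -natr1.
  have : 0 <= ln c / ln 2 by rewrite divr_ge0// ltW.
  by clear - k1 A0; lra.
(* y = 2 ^ - c is the value that m squarings turn exactly into s. *)
pose y := expR (- (c * ln 2)).
have sE : s = y ^+ (2 ^ m).
  rewrite /y -expRM_natl natrX -[LHS]lnK ?posrE// LE LcE; congr expR.
  by rewrite mulrN; congr (- _); rewrite mulrA (mulrC _ c).
have Nk : (k - m + m = k)%N by rewrite subnK// ltnW// ltnW.
have N1 : (1 < k - m)%N by rewrite ltn_subRL addn1.
have N0 := ltnW N1.
have kmR : (k - m)%:R = k%:R - m%:R :> R by rewrite natrB// ltnW// ltnW.
have fin z : 0 <= z -> z <= y -> (z ^+ (2 ^ m)) ^+ 2 / 8 <= s ^+ 2 / 8.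
  move=> z0 zy; rewrite ler_pM2r; last by clear; lra.
  have y0 : 0 <= y by exact: expR_ge0.
  rewrite sE; apply: lerXn2r; rewrite ?nnegrE ?exprn_ge0//.
  by apply: lerXn2r; rewrite ?nnegrE.
have lcc : 0 <= ln c / ln 2 by rewrite divr_ge0// ltW.
have [y39|y39] := leP (390 / 1000) y.
  exists (k - m)%N, m, (390 / 1000); split; [exact: N1|exact: Nk| |].
    by apply: fin y39; clear; lra.
  left; split; [by []|apply: (bound _ 1 ltr01 N0)].
  by rewrite ln1 mul0r addr0 kmR; clear - k1 lcc; lra.
exists (k - m)%N, m, (250 / 1000); split; [exact: N1|exact: Nk| |].
  apply: fin; first by clear; lra.
  have -> : 250 / 1000 = expR (- (2 * ln 2)) :> R.
    by rewrite expRN expRM_natl lnK ?posrE//; lra.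
  by rewrite ler_expR lerN2 ler_pM2r// ltW.
right; split; [by []|apply: (bound _ _ _ N0)]; first by clear; lra.
rewrite kmR.
(* Otherwise y ^ 3 >= 2 ^ - 4 = 0.0625, which exceeds 0.39 ^ 3. *)
have c43 : 4 / 3 <= c.
  rewrite leNgt; apply/negP => c43.
  have : expR (- (4 * ln 2)) <= y ^+ 3.
    rewrite /y -expRM_natl ler_expR mulrN lerN2 mulrA ler_pM2r//; clear - c43; lra.
  rewrite expRN expRM_natl lnK ?posrE// => y3.
  have : y ^+ 3 <= (390 / 1000) ^+ 3.
    by apply: lerXn2r; rewrite ?nnegrE ?expR_ge0; [|clear; lra|exact: ltW].
  by move: (y ^+ 3) y3 => z; clear; lra.
have h1 : ln (112 / 100) / ln (4 / 3) <= 2 / 5 :> R by rewrite (ler_pdivrMr _ _ l43); exact: ln_112_le.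
have h2 : 2 / 5 <= ln c / ln 2.
  rewrite (ler_pdivlMr _ _ l2); apply: le_trans ln_43_ge _.
  by rewrite ler_ln ?posrE//; clear; lra.
by clear - h1 h2 k1; lra.
Qed.

(** Rounding up costs less than 1, so k < A + log2 L + 2, where A is the logarithm of 1 / eta to
    base 4 / 3. Then 4 ^ 2 = 16, 4 ^ log2 L = L ^ 2, and 4 ^ A <= 1 / eta ^ 5 by [ln_43_ge]. *)
Lemma iterations_pow4 eps eta (k : nat) :
  0 < eps -> eps < 1 / Num.sqrt 8 -> 0 < eta -> eta < 1 ->
  k%:Z = Num.ceil (iterations eta eps) ->
  (4 ^ k)%:R <= 16 / eta ^+ 5 * log2 (1 / (Num.sqrt 8 * eps)) ^+ 2.
Proof.
move=> e0; have s8 : 0 < Num.sqrt 8 :> R by rewrite sqrtr_gt0.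
rewrite ltr_pdivlMr// mulrC => se1 eta0 eta1 kE.
have k_lt : k%:R - 1 < iterations eta eps.
  have := ceilB1_lt (iterations eta eps); rewrite -kE.
  by rewrite intrB.
move: k_lt; rewrite /iterations; have : 0 < Num.sqrt 8 * eps by exact: mulr_gt0.
move: (Num.sqrt 8 * eps) se1 => s s1 s0 k_lt.
have l2 := ln_2_gt0; have l43 := ln_43_gt0.
have L0 : 0 < log2 (1 / s).
  by rewrite /log2 divr_gt0// div1r lnV ?posrE// oppr_gt0 ln_lt0// s0.
move: (log2 (1 / s)) L0 k_lt => L L0.
have lneta : 0 < - ln eta by rewrite oppr_gt0 ln_lt0// eta0.
have -> : log2 (1 / eta) / log2 (4 / 3) = - ln eta / ln (4 / 3).
  by rewrite /log2 div1r lnV ?posrE//; field; rewrite !gt_eqF.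
set A := - ln eta / ln (4 / 3).
have AE : - ln eta = A * ln (4 / 3) by rewrite /A divfK ?gt_eqF.
have A0 : 0 < A by rewrite /A divr_gt0.
have LE : ln L = log2 L * ln 2 by rewrite /log2 divfK ?gt_eqF.
move=> k_lt.
have r0 : 0 < 16 / eta ^+ 5 * L ^+ 2 by rewrite mulr_gt0 ?divr_gt0 ?exprn_gt0.
rewrite natrX -ler_ln ?posrE ?exprn_gt0//.
rewrite lnM ?posrE ?exprn_gt0 ?divr_gt0 ?exprn_gt0// lnM ?posrE ?invr_gt0 ?exprn_gt0//.
rewrite lnV ?posrE ?exprn_gt0// !lnXn//.
have -> : ln 4 = 2 * ln 2 :> R.
  by rewrite -[4]/((2 * 2)%:R) natrM lnM ?posrE//; ring.
have -> : ln 16 = 4 * ln 2 :> R.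
  by rewrite -[16]/((2 ^ 4)%:R) natrX lnXn// mulr_natl.
rewrite -(mulr_natl (2 * ln 2) k) -(mulr_natl (ln eta) 5) -(mulr_natl (ln L) 2) LE -mulrN AE.
have h1 := ln_43_ge; have h2 : A * (2 / 5 * ln 2) <= A * ln (4 / 3) by rewrite ler_pM2l.
have h3 : (k%:R - 1) * ln 2 <= (A + log2 L + 1) * ln 2 by rewrite ler_pM2r// ltW.
move: (ln (4 / 3)) (ln 2) (log2 L) h2 h3 => a b c; clear => h2 h3.
lra.
Qed.

End IterationCount.

(** * Pulse words *)

Section PulseWords.
Context {R : realType}.
Local Notation M := 'M[R[i]]_2.
Implicit Types (F G : M -> M) (U A B : M) (V : nat -> M).

Lemma unitary_mul A B : A \is unitarymx -> B \is unitarymx -> A *m B \is unitarymx.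
Proof. exact: mul_unitarymx. Qed.

(** F U = A_1 U A_2 ... A_n U A_(n+1), peeled from the left with constants chosen before U. Unlike
    the indexed family of [pulses], this form multiplies without reindexing. *)
Fixpoint pulse_word (n : nat) F : Prop :=
  if n is m.+1 then exists A G, [/\ A \is unitarymx, pulse_word m G &
    forall U, F U = A *m U *m G U]
  else exists2 A, A \is unitarymx & forall U, F U = A.

Lemma pulse_word_ext n F G : pulse_word n F -> (forall U, G U = F U) -> pulse_word n G.
Proof.
case: n => [|n] /=.
  by move=> [A hA FA] GF; exists A => // U; rewrite GF.
by move=> [A [H [hA hH FA]]] GF; exists A, H; split => // U; rewrite GF.
Qed.

Lemma pulse_word_mull n F A : A \is unitarymx -> pulse_word n F ->
  pulse_word n (fun U => A *m F U).
Proof.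
move=> hA; case: n => [|n] /=.
  move=> [B hB FB]; exists (A *m B); first exact: (unitary_mul hA hB).
  by move=> U; rewrite FB.
move=> [B [H [hB hH FB]]]; exists (A *m B), H; split; [exact: (unitary_mul hA hB)|exact: hH|].
by move=> U; rewrite FB !mulmxA.
Qed.

Lemma pulse_word_mul m n F G : pulse_word m F -> pulse_word n G ->
  pulse_word (m + n) (fun U => F U *m G U).
Proof.
elim: m F => [|m IH] F /=.
  move=> [A hA FA] wG; apply: pulse_word_ext (pulse_word_mull hA wG) _ => U.
  by rewrite FA.
move=> [A [H [hA hH FA]]] wG; exists A, (fun U => H U *m G U); split; [exact: hA|exact: (IH _ hH wG)|].
by move=> U; rewrite FA !mulmxA.
Qed.

Lemma pulse_word_id : pulse_word 1 id.
Proof.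
have u1 : (1%:M : M) \is unitarymx by apply/unitarymxP; rewrite mul1mx trmx1 map_mx1.
exists 1%:M, (fun=> 1%:M); split; [exact: u1|by exists 1%:M|move=> U].
by rewrite mul1mx mulmx1.
Qed.

Lemma pulse_word_pulses n F : pulse_word n F -> exists V,
  (forall i, V i \is unitarymx) /\ forall U, F U = pulses n V U *m V n.+1.
Proof.
elim: n F => [|n IH] F /=.
  move=> [A hA FA]; exists (fun=> A); split=> [_|U]; first exact: hA.
  by rewrite /pulses big_nil mul1mx FA.
move=> [A [G [hA /IH[V [hV GV]] FA]]].
(* The factors of [pulses] are numbered from 1; index 0 is filled with [A] to keep the family
   unitary. *)
exists (fun i => if i is j.+1 then if j is 0 then A else V j else A).
split=> [[|[|i]]|U]; [exact: hA|exact: hA|exact: hV|].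
rewrite FA GV /pulses [in RHS]big_nat_recl//= !mulmxA; congr (_ *m _ *m _).
by apply: eq_big_nat => -[|i].
Qed.

Lemma unitary_dot_sigma (r : R * R * R) : unit_vector r -> dot_sigma r \is unitarymx.
Proof.
move=> r1; apply/unitarymxP; rewrite dot_sigma_adj dot_sigmaE mulmx_mx2.
have rE : (r.1.1 ^+ 2 + r.1.2 ^+ 2 + r.2 ^+ 2) +i* 0 = 1 :> R[i] by rewrite r1.
apply/matrixP => i j; rewrite !mxE.
by case: i => [[|[|//]] ?]; case: j => [[|[|//]] ?] /=; rewrite -?rE; apply: complex_eq => /=; ring.
Qed.

Lemma unitary_pauli : [/\ (pauliX : M) \is unitarymx, (pauliY : M) \is unitarymx &
  (pauliZ : M) \is unitarymx].
Proof.
have E (a b c : R) : dot_sigma (a, b, c) = a%:C *: pauliX + b%:C *: pauliY + c%:C *: pauliZ by [].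
split.
- have := @unitary_dot_sigma (1, 0, 0); rewrite E !scale0r scale1r !addr0; apply.
  by rewrite /unit_vector/=; ring.
- have := @unitary_dot_sigma (0, 1, 0); rewrite E !scale0r scale1r add0r addr0; apply.
  by rewrite /unit_vector/=; ring.
- have := @unitary_dot_sigma (0, 0, 1); rewrite E !scale0r scale1r !add0r; apply.
  by rewrite /unit_vector/=; ring.
Qed.

Lemma pulse_word_const A : A \is unitarymx -> pulse_word 0 (fun=> A).
Proof. by move=> hA; exists A. Qed.

(** Conjugation by constants adds no pulse, so each of the four factors of f contributes n. *)
Lemma pulse_word_step n F (r : R * R * R) : unit_vector r -> pulse_word n F ->
  pulse_word (4 * n) (fun U => Defs.fmap (gmap r (F U))).
Proof.
move=> r1 wF; have hD := unitary_dot_sigma r1; have [hX hY hZ] := unitary_pauli.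
have wD : pulse_word n (fun U => gmap r (F U)).
  rewrite /gmap -[n]addn0; apply: pulse_word_mul (pulse_word_mull hD wF) _.
  by apply: pulse_word_const; rewrite dot_sigma_adj.
have wC A : A \is unitarymx -> pulse_word n (fun U => A *m gmap r (F U) *m A).
  move=> hA; rewrite -[n]addn0; apply: pulse_word_mul (pulse_word_mull hA wD) _.
  exact: pulse_word_const.
have -> : (4 * n = n + n + n + n)%N by rewrite mulSn 2!mulSn mul1n !addnA.
apply: pulse_word_ext (pulse_word_mul (pulse_word_mul (pulse_word_mul (wC _ hX) (wC _ hY))
  (wC _ hZ)) wD) _ => U.
rewrite /Defs.fmap; move: (gmap r (F U)) (@pauliX R) (@pauliY R) (@pauliZ R) => W X Y Z.
have E A B : B *m (A *m W *m A) = B *m A *m W *m A by rewrite !mulmxA.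
by rewrite (E Y) (E Z).
Qed.

Lemma pulse_word_Fmap k (r : 'I_k -> R * R * R) : (forall j, unit_vector (r j)) ->
  pulse_word (4 ^ k) (Fmap r).
Proof.
move=> r1; rewrite /Fmap -[X in (4 ^ X)%N](size_enum_ord k).
elim/last_ind: (enum 'I_k) => [|s j IH] /=; first exact: pulse_word_id.
rewrite size_rcons expnS; apply: pulse_word_ext (pulse_word_step (r1 j) IH) _ => U.
by rewrite foldl_rcons.
Qed.

(** The trailing constant cancels against its adjoint and the leading one is absorbed into [V 1], a
    factor that is present because n > 0. *)
Lemma pulses_conj n V : (0 < n)%N -> (forall i, V i \is unitarymx) ->
  exists V' : nat -> M, [/\ V' 1%N \is unitarymx, forall i, (1 < i)%N -> V' i = V i &
    forall U, V n.+1 *m (pulses n V U *m V n.+1) *m (V n.+1) ^t* = pulses n V' U].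
Proof.
move=> n0 hV; exists (fun i => if i == 1%N then V n.+1 *m V 1%N else V i); split.
- exact: (unitary_mul (hV _) (hV _)).
- by move=> [|[|i]].
move=> U; have /unitarymxP uV := hV n.+1.
rewrite mulmxA -mulmxA uV mulmx1 /pulses.
rewrite (@big_ltn _ _ _ 1%N)// [in RHS](@big_ltn _ _ _ 1%N)//= -[LHS]/(_ *m (_ *m _)) 2!mulmxA.
congr (_ *m _); apply: eq_big_nat => i /andP[i1 _].
by case: i i1 => [|[|i]].
Qed.

End PulseWords.

Theorem mainTheorem1 (R : realType) (eps eta : R) (k : nat)
    (eps_gt0 : 0 < eps) (eps_lt : eps < 1 / Num.sqrt 8)
    (eta_gt0 : 0 < eta) (eta_lt1 : eta < 1)
    (k_gt0 : (0 < k)%N) (k_ge : iterations eta eps <= k%:R) :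
  (* success probability; the second lower bound on k follows from k_ge as soon
     as the double logarithm is nonnegative, i.e. eps <= 1 / (2 sqrt 8) *)
  (log2 (1 / eta) / log2 (4 / 3) + 1 <= k%:R ->
   forall (d : measure_display) (T : measurableType d) (P : probability T R)
     (r : 'I_k -> T -> R * R * R),
     iid_uniform_sphere P r ->
     forall U : 'M[R[i]]_2, inSU2 U ->
       ((1 - eta)%:E <=
        P [set w | (hsnorm (Fmap (fun j => r j w) U - 1%:M) <= eps)%R])%E)
  /\
  (* pulse form with 4 ^ k pulses; as the identities hold for every matrix U,
     homogeneity in U leaves no other possible number of pulses *)
  (forall r : 'I_k -> R * R * R, (forall j, unit_vector (r j)) ->
     exists V : nat -> 'M[R[i]]_2,
       [/\ forall i, V i \is unitarymx,
           forall U : 'M[R[i]]_2,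
             Fmap r U = pulses (4 ^ k) V U *m V (4 ^ k).+1
         & exists V' : nat -> 'M[R[i]]_2,
             [/\ V' 1%N \is unitarymx,
                 forall i, (1 < i)%N -> V' i = V i
               & forall U : 'M[R[i]]_2,
                   V (4 ^ k).+1 *m Fmap r U *m (V (4 ^ k).+1) ^t* =
                   pulses (4 ^ k) V' U]])
  /\
  (k%:Z = Num.ceil (iterations eta eps) ->
   (4 ^ k)%:R <= 16 / eta ^+ 5 * log2 (1 / (Num.sqrt 8 * eps)) ^+ 2).
Proof.
split; [|split].
- move=> k_ge2 d T P r iid_r U SU2_U.
  have [N [m [x [N1 Nmk x_eps tail]]]] :=
    iteration_split eps_gt0 eps_lt eta_gt0 eta_lt1 k_ge k_ge2.
  (* The orbit lemmas index the draws through [inord], which needs an ordinal type of successor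
     form. *)
  case: k k_gt0 {k_ge k_ge2} Nmk r iid_r => // k' _ Nmk r iid_r.
  have Nk : (N <= k'.+1)%N by rewrite -Nmk leq_addr.
  apply: (success_prob iid_r SU2_U (ltW eps_gt0) Nmk x_eps) => r' q mr r_unit r_law r_indep q1.
  case: tail => -[-> tail].
    apply: (le_trans (orbit_tail_39 mr r_unit r_law r_indep q1 N1 Nk)).
    by rewrite lee_fin; exact: tail.
  apply: (le_trans (orbit_tail_25 mr r_unit r_law r_indep q1 N1 Nk)).
  by rewrite lee_fin; exact: tail.
- move=> r r_unit.
  have [V [hV FV]] := pulse_word_pulses (pulse_word_Fmap r_unit).
  have k4 : (0 < 4 ^ k)%N by rewrite expn_gt0.
  exists V; split; [exact: hV|exact: FV|].
  have [V' [h1 h2 h3]] := pulses_conj k4 hV.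
  by exists V'; split; [exact: h1|exact: h2|move=> U; rewrite FV; exact: h3].
exact: iterations_pow4.
Qed.
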